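(* Let $A=k[[X,Y]]$ be the formal power series ring over an infinite field $k$. Let $$\mathbb M=\begin{pmatrix} X^3 & X^2Y^2 & XY^3 & Y^5 & 0 & 0 & 0\\ 0&0&X^3&0&X^2Y^2&XY^4&Y^5\end{pmatrix}$$ and let $M=\operatorname{Im}\left(A^{\oplus 7}\xrightarrow{\ \mathbb M\ }A^{\oplus 2}\right)\subseteq F=A^{\oplus 2}$. Then $\mathcal R(M)$ is a Buchsbaum ring, $\widetilde M=\overline M$, $M\neq\overline M$, and $\mathcal R(M)$ is not a multi-Rees algebra (i.e. $M$ is an indecomposable $A$-module).
   Context: Let $\mathfrak m=(X,Y)$ and $S=\operatorname{Sym}_A(F)=A[t_1,t_2]$ with its standard grading. The Rees algebra is $\mathcal R(M)=\operatorname{Im}(\operatorname{Sym}_A(M)\to S)$, $M^n=[\mathcal R(M)]_n$, and $\mathfrak M=\mathfrak m\mathcal R(M)+\bigoplus_{n>0}M^n$ is its graded maximal ideal. $\widetilde M=\bigcup_{\ell>0}\left[M^{\ell+1}:_F M^{\ell}\right]$ is the Ratliff–Rush closure of $M$, i.e. the set of $x\in F$ with $xM^\ell\subseteq M^{\ell+1}$ for some $\ell>0$ (products in $S$). $\overline M\subseteq F$ is the integral closure of $M$, i.e. the degree $1$ component of the integral closure of $\mathcal R(M)$ in $S$. $\mathcal R(M)$ is a multi-Rees algebra when $M$ is a direct sum of ideals of $A$; since $M$ is torsion-free of rank $2$, the assertion that $\mathcal R(M)$ is not a multi-Rees algebra means that $M$ is indecomposable. A Noetherian local ring $(R,\mathfrak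 n)$ is Buchsbaum if $\ell_R(R/Q)-e_Q(R)$ (length minus multiplicity) is independent of the choice of the parameter ideal $Q$ of $R$; $\mathcal R(M)$ is called Buchsbaum if $\mathcal R(M)_{\mathfrak M}$ is a Buchsbaum local ring. *)

(* Defs.v *)
From HB Require Import structures.
From mathcomp Require Import all_boot all_order all_algebra.
From mathcomp Require Import mpoly.
From mathcomp Require Import boolp classical_sets cardinality.

Set Implicit Arguments.
Unset Strict Implicit.
Unset Printing Implicit Defensive.

Import Order.TTheory GRing.Theory Num.Theory.

Local Open Scope classical_set_scope.
Local Open Scope ring_scope.

Section CommutativeAlgebra.
Variable R : comNzRingType.
Implicit Types (I J P Q : set R) (n d l e : nat).

Definition is_ideal I : Prop :=
  [/\ I 0, forall x y, I x -> I y -> I (x + y) & forall a x, I x -> I (a * x)].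

Definition ideal_gen (s : seq R) : set R :=
  [set x | exists c : nat -> R, x = \sum_(i < size s) c i * s`_i].

Definition ideal_mul I J : set R :=
  [set x | exists (r : nat) (a b : 'I_r -> R),
     (forall i, I (a i) /\ J (b i)) /\ x = \sum_(i < r) a i * b i].

Fixpoint ideal_pow I n : set R :=
  if n is n'.+1 then ideal_mul I (ideal_pow I n') else setT.

Definition prime_ideal P : Prop :=
  [/\ is_ideal P, ~ P 1 & forall x y, P (x * y) -> P x \/ P y].

Definition maximal_ideal P : Prop :=
  [/\ is_ideal P, ~ P 1 & forall J, is_ideal J -> P `<=` J -> J = P \/ J = setT].

Definition local_at (m : set R) : Prop :=
  maximal_ideal m /\ forall P, maximal_ideal P -> P = m.

Definition noetherian : Prop :=
  forall I, is_ideal I -> exists s : seq R, I = ideal_gen s.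

Definition strict_chain (p : set R -> Prop) n (C : nat -> set R) : Prop :=
  (forall i, (i <= n)%N -> p (C i)) /\ (forall i, (i < n)%N -> C i `<` C i.+1).

(* The supremum of the lengths (numbers of steps) of the chains is [n]. *)
Definition sup_chain (p : set R -> Prop) n : Prop :=
  (exists C, strict_chain p n C) /\
  (forall n' C, strict_chain p n' C -> (n' <= n)%N).

Definition krull_dim d : Prop := sup_chain prime_ideal d.

(* The R-module R / I has finite length [l]; its submodules are the J / I for
   the ideals J containing I. *)
Definition quotient_length I l : Prop :=
  sup_chain (fun J => is_ideal J /\ I `<=` J) l.

(* The ideals generated by a system of parameters: [d] elements of [m], where
   [d] is the Krull dimension, that generate an m-primary ideal. *)
Definition parameter_ideal (m : set R) d Q : Prop :=
  exists a : d.-tuple R,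
    [/\ forall x, x \in (a : seq R) -> m x, Q = ideal_gen a
      & exists n, ideal_pow m n `<=` Q].

(* Hilbert-Samuel: for large n, the length of R / Q^(n+1) is a polynomial in n of
   degree at most [d] = dim R whose coefficient in degree d is e_Q(R) / d!. *)
Definition multiplicity d Q e : Prop :=
  exists P : {poly rat},
    [/\ (size P <= d.+1)%N, P`_d = e%:R / d`!%:R
      & exists N, forall n, (N <= n)%N ->
          exists2 l, quotient_length (ideal_pow Q n.+1) l & P.[n%:R] = l%:R].

Definition buchsbaum_local : Prop :=
  noetherian /\ exists m d,
    [/\ local_at m, krull_dim d
      & exists c : int, forall Q, parameter_ideal m d Q ->
          exists l e, [/\ quotient_length Q l, multiplicity d Q e
                        & l%:Z - e%:Z = c]].

End CommutativeAlgebra.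

Section Modules.
Variables (R : comNzRingType) (V : lmodType R).

Definition is_submodule (N : set V) : Prop :=
  [/\ N 0, forall x y, N x -> N y -> N (x + y) & forall a x, N x -> N (a *: x)].

Definition indecomposable (M : set V) : Prop :=
  M <> [set 0] /\
  forall N1 N2 : set V, is_submodule N1 -> is_submodule N2 ->
    M = [set x | exists y z, [/\ N1 y, N2 z & x = y + z]] ->
    N1 `&` N2 = [set 0] -> N1 = [set 0] \/ N2 = [set 0].

End Modules.

Record pseries (n : nat) (R : Type) := PSeries { pscoef : 'X_{1..n} -> R }.

HB.instance Definition _ n R := gen_eqMixin (pseries n R).
HB.instance Definition _ n R := gen_choiceMixin (pseries n R).

Section PowerSeriesRing.
Variables (n : nat) (R : comNzRingType).
Implicit Types (f g h : pseries n R) (m : 'X_{1..n}).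

Lemma pseriesP f g : (forall m, pscoef f m = pscoef g m) -> f = g.
Proof.
by case: f g => [f] [g] /= fg; congr PSeries; apply/funext.
Qed.

Definition ps0 := PSeries (fun _ : 'X_{1..n} => 0 : R).
Definition psopp f := PSeries (fun m => - pscoef f m).
Definition psadd f g := PSeries (fun m => pscoef f m + pscoef g m).
Definition ps1 := PSeries (fun m : 'X_{1..n} => (m == 0%MM)%:R : R).
Definition psmul f g := PSeries (fun m =>
  \sum_(k : 'X_{1..n < (mdeg m).+1, (mdeg m).+1} | m == (k.1 + k.2)%MM)
     pscoef f k.1 * pscoef g k.2).

Fact psaddA : associative psadd.
Proof. by move=> f g h; apply: pseriesP => m; rewrite /= addrA. Qed.
Fact psaddC : commutative psadd.
Proof. by move=> f g; apply: pseriesP => m; rewrite /= addrC. Qed.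
Fact psadd0 : left_id ps0 psadd.
Proof. by move=> f; apply: pseriesP => m; rewrite /= add0r. Qed.
Fact psaddN : left_inverse ps0 psopp psadd.
Proof. by move=> f; apply: pseriesP => m; rewrite /= addNr. Qed.

HB.instance Definition _ :=
  GRing.isZmodule.Build (pseries n R) psaddA psaddC psadd0 psaddN.

(* The ring axioms are transferred from polynomials by truncation. *)
Definition pstrunc d f : {mpoly R[n]} :=
  \sum_(m : 'X_{1..n < d}) pscoef f m *: 'X_[m].

Lemma pstruncE d f m : (mdeg m < d)%N -> (pstrunc d f)@_m = pscoef f m.
Proof. exact: mcoeff_mpoly. Qed.

Lemma mdeg_addP d m m1 m2 : m = (m1 + m2)%MM -> (mdeg m < d)%N ->
  (mdeg m1 < d)%N /\ (mdeg m2 < d)%N.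
Proof.
by move=> ->; rewrite mdegD => lt; split; apply: leq_ltn_trans lt;
  rewrite ?leq_addr ?leq_addl.
Qed.

Lemma mcoeffM_low (p p' q q' : {mpoly R[n]}) d m : (mdeg m < d)%N ->
  (forall k, (mdeg k < d)%N -> p@_k = p'@_k) ->
  (forall k, (mdeg k < d)%N -> q@_k = q'@_k) ->
  (p * q)@_m = (p' * q')@_m.
Proof.
move=> ltmd pp' qq'; rewrite !mcoeffM; apply: eq_bigr => k /eqP mE.
have [l1 l2] := mdeg_addP mE ltmd.
by rewrite pp' ?qq'.
Qed.

Lemma psmulE d f g m : (mdeg m < d)%N ->
  pscoef (psmul f g) m = (pstrunc d f * pstrunc d g)@_m.
Proof.
move=> ltmd; rewrite mcoeffM /=; apply: eq_bigr => k /eqP mE.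
have [l1 l2] := mdeg_addP mE ltmd.
by rewrite !pstruncE.
Qed.

Fact psmulA : associative psmul.
Proof.
move=> f g h; apply: pseriesP => m; set d := (mdeg m).+1.
rewrite !(psmulE (d := d)) //.
transitivity (pstrunc d f * (pstrunc d g * pstrunc d h))@_m.
  apply: (@mcoeffM_low _ _ _ _ d) => // k ltk.
  by rewrite pstruncE // (psmulE (d := d)).
rewrite mulrA; apply: (@mcoeffM_low _ _ _ _ d) => // k ltk.
by rewrite pstruncE // (psmulE (d := d)).
Qed.

Fact psmulC : commutative psmul.
Proof.
move=> f g; apply: pseriesP => m.
by rewrite !(psmulE (d := (mdeg m).+1)) // mulrC.
Qed.

Fact psmul1 : left_id ps1 psmul.
Proof.
move=> f; apply: pseriesP => m; set d := (mdeg m).+1.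
rewrite (psmulE (d := d)) // -[RHS](@pstruncE d) // -[in RHS](mul1r (pstrunc _ f)).
apply: (@mcoeffM_low _ _ _ _ d) => // k ltk.
by rewrite pstruncE //= mcoeff1.
Qed.

Fact psmulD : left_distributive psmul psadd.
Proof.
move=> f g h; apply: pseriesP => m; rewrite /= -big_split /=.
by apply: eq_bigr => k _; rewrite mulrDl.
Qed.

Fact ps1_neq0 : ps1 != ps0.
Proof.
apply/eqP => /(congr1 (fun f => pscoef f 0%MM)) /=.
by rewrite eqxx => /eqP; rewrite oner_eq0.
Qed.

HB.instance Definition _ := GRing.Zmodule_isComNzRing.Build (pseries n R)
  psmulA psmulC psmul1 psmulD ps1_neq0.

Definition psunit : {pred pseries n R} := [pred f | `[< exists g, g * f = 1 >]].
Definition psinv f : pseries n R := xget f [set g | g * f = 1].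

Fact psmulV : {in psunit, left_inverse 1 psinv *%R}.
Proof. by move=> f /asboolP [g gf]; rewrite /psinv; case: xgetP => // /(_ g). Qed.
Fact psunitPl f g : g * f = 1 -> psunit f.
Proof. by move=> gf; apply/asboolP; exists g. Qed.
Fact psinv_out : {in [predC psunit], psinv =1 id}.
Proof.
move=> f /negP fNu; rewrite /psinv; case: xgetP => // g _ gf.
by case: fNu; exact: psunitPl gf.
Qed.

HB.instance Definition _ := GRing.ComNzRing_hasMulInverse.Build (pseries n R)
  psmulV psunitPl psinv_out.

Definition psX (i : 'I_n) : pseries n R := PSeries (fun m => (m == U_(i)%MM)%:R).

Lemma pscoefD f g m : pscoef (f + g) m = pscoef f m + pscoef g m.
Proof. by []. Qed.

Lemma pscoefXM i f m :
  pscoef (psX i * f) m = if (0 < m i)%N then pscoef f (m - U_(i))%MM else 0.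
Proof.
have -> : pscoef (psX i * f) m = (pstrunc (mdeg m).+1 f * 'X_i)@_m.
  rewrite mulrC [LHS](@psmulE (mdeg m).+1) //.
  apply: (@mcoeffM_low _ _ _ _ (mdeg m).+1) => // l ltl.
  by rewrite pstruncE //= mcoeffX eq_sym.
case: ifPn => [mi|]; last first.
  rewrite -leqNgt leqn0 => /eqP mi; rewrite mcoeffM big1 // => l /eqP mE.
  rewrite mcoeffX; case: eqP => [lE|]; last by rewrite mulr0.
  have := congr1 (fun u : 'X_{1..n} => u i) mE.
  by rewrite mi -lE mnmDE mnm1E eqxx addn1.
have mE : m = (U_(i) + (m - U_(i)))%MM.
  apply/mnmP => j; rewrite mnmDE mnmBE mnm1E.
  by case: eqP => [<-|]; rewrite ?subnKC // add0n subn0.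
rewrite [X in _@_X]mE mcoeffMX pstruncE //.
by rewrite [X in (_ < (mdeg X).+1)%N]mE mdegD mdeg1 add1n !ltnS leqnSn.
Qed.

End PowerSeriesRing.

Section PowerSeriesDomain.
Variables (n : nat) (R : idomainType).

Lemma pscoef_first (f : pseries n R) : f != 0 ->
  exists2 m, pscoef f m != 0 & forall k, (k < m)%O -> pscoef f k = 0.
Proof.
move=> f0; have [m fm] : exists m, pscoef f m != 0.
  apply: contrapT => nex; case/eqP: f0; apply: pseriesP => m /=.
  by apply/eqP; apply: contrapT => /negP fm; apply: nex; exists m.
elim/(well_founded_ind (@ltom_wf n)): m fm => m IH fm.
have [[k [km fk]]|nex] := pselect (exists k, (k < m)%O /\ pscoef f k != 0).
  exact: IH km fk.
exists m => // k km; apply/eqP; apply: contrapT => /negP fk.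
by apply: nex; exists k.
Qed.

Fact pseries_domain : GRing.integral_domain_axiom (pseries n R).
Proof.
move=> f g fg0; apply: contrapT => /negP.
rewrite negb_or => /andP [/pscoef_first [a fa af] /pscoef_first [b gb bg]].
have /(congr1 (fun h => pscoef h (a + b)%MM)) /= := fg0.
have lta : (mdeg a < (mdeg (a + b)%MM).+1)%N by rewrite mdegD ltnS leq_addr.
have ltb : (mdeg b < (mdeg (a + b)%MM).+1)%N by rewrite mdegD ltnS leq_addl.
rewrite (bigD1 (BMultinom lta, BMultinom ltb)) //= big1.
  by rewrite addr0 => /eqP; rewrite mulf_eq0 (negbTE fa) (negbTE gb).
move=> [[k1 ?] [k2 ?]] /= /andP [/eqP sE ne].
have [lt1|le1] := ltP k1 a; first by rewrite af ?mul0r.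
have [lt2|le2] := ltP k2 b; first by rewrite bg ?mulr0.
case/negP: ne; rewrite xpair_eqE -!val_eqE /=.
have [e1|ne1] := eqVneq k1 a.
  move: sE; rewrite e1 => /eqP; rewrite eqm_add2l eq_sym => k2b.
  by rewrite eqxx; exact: k2b.
have lt1 : (a < k1)%O by rewrite lt_neqAle eq_sym ne1.
by have := ltmc_le_add lt1 le2; rewrite sE ltxx.
Qed.

HB.instance Definition _ :=
  GRing.ComUnitRing_isIntegral.Build (pseries n R) pseries_domain.

End PowerSeriesDomain.

Section Rees.
Variable k : fieldType.

Definition Aring : idomainType := pseries 2 k.
Definition Xvar : Aring := psX k ord0.
Definition Yvar : Aring := psX k ord_max.
Definition Fmod : lmodType Aring := 'cV[Aring]_2.
Definition Salg : idomainType := {mpoly Aring[2]}.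

(* The identification of F = A^2 with the degree 1 component of S = Sym_A(F). *)
Definition sym1 (v : 'cV[Aring]_2) : {mpoly Aring[2]} :=
  \sum_(i < 2) v i 0 *: 'X_i.

Implicit Types M : set Fmod.

(* The image of Sym_A(M) -> S: the algebra Sym_A(M) is generated by M over A,
   so its elements are the expressions built from constants in A and elements
   of M by sums and products, and the image consists of their values in S. *)
Inductive rees M : set Salg :=
| rees_const (a : Aring) : rees M (a%:MP : {mpoly Aring[2]})
| rees_gen (v : Fmod) : M v -> rees M (sym1 v)
| rees_add (p q : Salg) : rees M p -> rees M q -> rees M (p + q)
| rees_mul (p q : Salg) : rees M p -> rees M q -> rees M (p * q).

(* M^n, the degree n component of R(M). *)
Definition rees_pow M (n : nat) : set Salg :=
  [set p | rees M p /\ (p : {mpoly Aring[2]}) \is n.-homog].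

(* The ideal (X, Y)R(M) + (+)_(n > 0) M^n of R(M). *)
Definition rees_max M : set Salg :=
  [set p | exists (a b : Salg) (N : nat) (g : nat -> Salg),
     [/\ rees M a, rees M b, forall n, rees_pow M n.+1 (g n)
       & p = (Xvar%:MP : {mpoly Aring[2]}) * a
             + (Yvar%:MP : {mpoly Aring[2]}) * b + \sum_(n < N) g n]].

Definition ratliff_rush M : set Fmod :=
  [set x | exists2 l, (0 < l)%N &
     forall p, rees_pow M l p -> rees_pow M l.+1 (sym1 x * p)].

(* The degree 1 component of the integral closure of R(M) in S. *)
Definition integral_closure M : set Fmod :=
  [set x | exists p : {poly Salg},
     [/\ p \is monic, forall i, rees M p`_i & root p (sym1 x)]].

Notation "p %:F" := (@FracField.tofrac Salg p).

(* The underlying set of the local ring R(M)_P, P = rees_max M, inside the field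
   of fractions of S: R(M) is a subring of the domain S. *)
Definition rees_loc_pred M : {pred {fraction Salg}} :=
  fun x => `[< exists a b : Salg,
     [/\ rees M a, rees M b, ~ rees_max M b & x = a%:F / b%:F] >].

Definition const_coef (p : {mpoly Aring[2]}) : k := pscoef (p@_0%MM) 0%MM.

Lemma pscoef0M (f g : Aring) : pscoef (f * g) 0%MM = pscoef f 0%MM * pscoef g 0%MM.
Proof.
rewrite [LHS](@psmulE 2 k 1) ?mdeg0 // (mcoeff0_is_multiplicative _ _).1.
by rewrite !pstruncE ?mdeg0.
Qed.

Lemma const_coefM : {morph const_coef : p q / p * q}.
Proof.
by move=> p q; rewrite /const_coef (mcoeff0_is_multiplicative _ _).1 pscoef0M.
Qed.

Lemma const_coefD : {morph const_coef : p q / p + q}.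
Proof. by move=> p q; rewrite /const_coef mcoeffD. Qed.

Lemma const_coef1 : const_coef 1 = 1.
Proof. by rewrite /const_coef mcoeff1 eqxx /= eqxx. Qed.

Lemma ps_split (f : Aring) :
  pscoef f 0%MM = 0 -> exists g h : Aring, f = Xvar * g + Yvar * h.
Proof.
move=> f0; exists (PSeries (fun m => pscoef f (m + U_(ord0))%MM)).
exists (PSeries (fun m =>
  if m ord0 == 0%N then pscoef f (m + U_(ord_max))%MM else 0)).
apply: pseriesP => m.
have addE (i : 'I_2) : (0 < m i)%N -> (m - U_(i) + U_(i))%MM = m.
  move=> mi; apply/mnmP => j; rewrite mnmDE mnmBE mnm1E.
  by case: eqP => [<-|]; rewrite ?subnK // addn0 subn0.
rewrite pscoefD !pscoefXM /=.
rewrite mnmBE mnm1E /= subn0.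
have [m0|] := posnP (m ord0); rewrite ?m0 /=.
  rewrite add0r; case: ifP => [m1|/negbT]; first by rewrite addE.
  rewrite -leqNgt leqn0 => /eqP m1; rewrite -f0; congr pscoef; apply/mnmP => i.
  rewrite mnm0E; case: i => [[|[|//]]] lti.
    by apply: etrans m0; congr (m _); apply: val_inj.
  by apply: etrans m1; congr (m _); apply: val_inj.
by move=> m0; rewrite addE //; case: ifP => _; rewrite addr0.
Qed.

Lemma rees_pow0P M p : rees_pow M 0 p -> p = (p@_0%MM)%:MP.
Proof.
case=> _ hp; apply/mpolyP => m; rewrite mcoeffC.
have [->|m0] := eqVneq m 0%MM; first by rewrite mulr1.
rewrite mulr0; apply: (dhomog_nemf_coeff hp).
by rewrite /= mdeg_eq0.
Qed.

Lemma const_coef_pos M n p : rees_pow M n.+1 p -> const_coef p = 0.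
Proof.
case=> _ hp; rewrite /const_coef (dhomog_nemf_coeff hp) //=.
by rewrite mdeg0.
Qed.

Lemma const_coef0 : const_coef 0 = 0.
Proof. by rewrite /const_coef mcoeff0. Qed.

Lemma const_coef_sum (g : nat -> Salg) N : (forall n, const_coef (g n) = 0) ->
  const_coef (\sum_(n < N) g n) = 0.
Proof.
move=> g0; elim/big_rec: _ => [|i x _ x0]; first exact: const_coef0.
by rewrite const_coefD g0 x0 addr0.
Qed.

Lemma const_coefC (a : Aring) : const_coef a%:MP = pscoef a 0%MM.
Proof. by rewrite /const_coef mcoeffC eqxx mulr1. Qed.

Lemma psX0 (i : 'I_2) : pscoef (psX k i) 0%MM = 0.
Proof.
rewrite /=; case: eqP => // /(congr1 (fun m : 'X_{1..2} => mdeg m)).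
by rewrite mdeg0 mdeg1.
Qed.

Lemma const_coef_max M p : rees_max M p -> const_coef p = 0.
Proof.
case=> a [b] [N] [g] [_ _ Mg ->].
rewrite !const_coefD !const_coefM !const_coefC !psX0 !mul0r !add0r.
by apply: const_coef_sum => n; apply: const_coef_pos (Mg n).
Qed.

Lemma rees0 M : rees M 0.
Proof. by rewrite -(mpolyC0 2 Aring); apply: rees_const. Qed.

Lemma rees1 M : rees M 1.
Proof. exact: rees_const. Qed.

Lemma rees_opp M p : rees M p -> rees M (- p).
Proof.
by rewrite -mulN1r -(mpolyC1 2 Aring) -mpolyCN => Mp; apply: rees_mul Mp; exact: rees_const.
Qed.

Lemma rees_sum M (I : finType) (P : pred I) (g : I -> Salg) :
  (forall i, P i -> rees M (g i)) -> rees M (\sum_(i | P i) g i).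
Proof.
by move=> Mg; elim/big_rec: _ => [|i x Pi]; [exact: rees0 | apply/rees_add/Mg].
Qed.

Lemma dhomog_sum (I : finType) (P : pred I) (g : I -> {mpoly Aring[2]}) n :
  (forall i, P i -> g i \is n.-homog) -> \sum_(i | P i) g i \is n.-homog.
Proof. by move=> hg; apply: rpred_sum. Qed.

Lemma rees_pow_zero M n : rees_pow M n 0.
Proof. by split; [exact: rees0 | exact: dhomog0]. Qed.

Lemma sym1_homog (v : 'cV[Aring]_2) : sym1 v \is 1.-homog.
Proof.
apply: dhomog_sum => i _; apply: dhomogZ.
by rewrite dhomogX /= mdeg1.
Qed.

Lemma rees_graded M p : rees M p ->
  exists N (g : nat -> Salg), (forall n, rees_pow M n (g n)) /\ p = \sum_(n < N) g n.
Proof.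
elim=> {p} [a|v Mv|p q _ [N [g [Mg ->]]] _ [N' [g' [Mg' ->]]]
  |p q _ [N [g [Mg ->]]] _ [N' [g' [Mg' ->]]]].
- exists 1%N, (fun n => if n is 0 then a%:MP else 0); split; last by rewrite big_ord1.
  case=> [|n]; last exact: rees_pow_zero.
  split; first exact: rees_const.
  by rewrite -[a%:MP]mulr1 mul_mpolyC; apply: dhomogZ; exact: dhomog1.
- exists 2%N, (fun n => if n == 1%N then sym1 v else 0); split.
    move=> n; case: eqP => [->|_]; last exact: rees_pow_zero.
    by split; [apply: rees_gen | exact: sym1_homog].
  by rewrite big_ord_recl big_ord1 add0r.
- exists (maxn N N'), (fun n =>
    (if (n < N)%N then g n else 0) + (if (n < N')%N then g' n else 0)); split.
    move=> n; split.
      by apply: rees_add; case: ifP => _;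
        [exact: (Mg _).1 | exact: rees0 | exact: (Mg' _).1 | exact: rees0].
    by apply: dhomogD; case: ifP => _;
      [exact: (Mg _).2 | exact: dhomog0 | exact: (Mg' _).2 | exact: dhomog0].
  rewrite big_split /= -!big_mkcond /=.
  by rewrite -!big_ord_widen ?leq_maxl ?leq_maxr.
exists (N + N')%N, (fun n =>
  \sum_(ij : 'I_N * 'I_N' | (ij.1 + ij.2)%N == n) g ij.1 * g' ij.2); split.
  move=> n; split.
    by apply: rees_sum => ij _; apply: rees_mul; [exact: (Mg _).1|exact: (Mg' _).1].
  apply: dhomog_sum => ij /eqP <-.
  by apply: dhomogM; [exact: (Mg _).2|exact: (Mg' _).2].
rewrite big_distrlr /= pair_bigA /=.
have ltij (ij : 'I_N * 'I_N') : (ij.1 + ij.2 < N + N')%N.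
  by rewrite -addnS leq_add // ltnW.
by rewrite (partition_big (fun ij => Ordinal (ltij ij)) xpredT).
Qed.

Lemma rees_max_const_coef M p : rees M p -> const_coef p = 0 -> rees_max M p.
Proof.
move=> /rees_graded [N [g [Mg ->]]].
wlog [N' ->] : N / exists N', N = N'.+1.
  case: N => [|N] IH; last by apply: IH; exists N.
  move=> _; exists 0, 0, 0%N, (fun=> 0).
  split; rewrite ?big_ord0 ?mulr0 ?addr0 //; try exact: rees0.
  by move=> n; exact: rees_pow_zero.
rewrite big_ord_recl const_coefD (@const_coef_sum (fun n => g n.+1)) ?addr0; last first.
  by move=> n; apply: const_coef_pos (Mg n.+1).
rewrite (rees_pow0P (Mg 0%N)) const_coefC => /ps_split [a [b ->]].
exists a%:MP, b%:MP, N', (fun n => g n.+1).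
split; try exact: rees_const; first by move=> n; exact: Mg.
by rewrite mpolyCD !mpolyCM.
Qed.

Lemma rees_denomM M (a b : Salg) : rees M a -> rees M b ->
  ~ rees_max M a -> ~ rees_max M b -> ~ rees_max M (a * b).
Proof.
move=> Ma Mb na nb /const_coef_max; rewrite const_coefM => /eqP.
by rewrite mulf_eq0 => /orP [] /eqP /rees_max_const_coef; [move/(_ _ Ma)|move/(_ _ Mb)].
Qed.

Fact rees_loc_subring M : subring_closed (rees_loc_pred M).
Proof.
have neq0 (b : Salg) : ~ rees_max M b -> b%:F != 0.
  move=> nb; rewrite tofrac_eq0; apply/eqP => b0; case: nb; rewrite b0.
  by apply: rees_max_const_coef; [exact: rees0|exact: const_coef0].
split.
- apply/asboolP; exists 1, 1; rewrite tofrac1 divr1.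
  split=> //; try exact: rees1.
  by move/const_coef_max; rewrite const_coef1 => /eqP; rewrite oner_eq0.
- move=> x y /asboolP [a [b [Ma Mb nb ->]]] /asboolP [c [d [Mc Md nd ->]]].
  apply/asboolP; exists (a * d - c * b), (b * d); split.
  + by apply: rees_add; [|apply: rees_opp]; apply: rees_mul.
  + exact: rees_mul.
  + exact: rees_denomM.
  + by rewrite -mulNr addf_div ?neq0 // tofracB !tofracM mulNr.
move=> x y /asboolP [a [b [Ma Mb nb ->]]] /asboolP [c [d [Mc Md nd ->]]].
apply/asboolP; exists (a * c), (b * d); split; try exact: rees_mul.
- exact: rees_denomM.
- by rewrite !tofracM mulf_div.
Qed.

HB.instance Definition _ M :=
  GRing.isSubringClosed.Build {fraction Salg} (rees_loc_pred M) (rees_loc_subring M).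

Record rees_loc M :=
  ReesLoc { rees_loc_val : {fraction Salg}; _ : rees_loc_val \in rees_loc_pred M }.

HB.instance Definition _ M := [isSub for @rees_loc_val M].
HB.instance Definition _ M := [Choice of rees_loc M by <:].
HB.instance Definition _ M := [SubChoice_isSubComNzRing of rees_loc M by <:].

Definition rees_buchsbaum M : Prop := buchsbaum_local (rees_loc M).

Definition Mmat : 'M[Aring]_(2, 7) :=
  let X := Xvar in let Y := Yvar in
  \matrix_(i < 2, j < 7) nth 0 (nth [::]
    [:: [:: X ^+ 3; X ^+ 2 * Y ^+ 2; X * Y ^+ 3; Y ^+ 5; 0;               0;          0];
        [:: 0;      0;               X ^+ 3;     0;      X ^+ 2 * Y ^+ 2; X * Y ^+ 4; Y ^+ 5]]
    i) j.

Definition Msub : set Fmod := [set v | exists u : 'cV[Aring]_7, v = Mmat *m u].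

End Rees.

Arguments Mmat : clear implicits.
Arguments Msub : clear implicits.

(* Main.v *)
(** Put z = (X Y^4, 0) and M' = M + A z. Multiplication by z maps the maximal ideal of
    R = R(M) into itself, so that R' = R(M') equals R + k z. Moreover R' is Cohen-Macaulay:
    over B = A[u_1, u_2, u_3], where u_1 = (X^3 + Y^5) t_1, u_2 = X Y^3 t_1 + X^3 t_2 and
    u_3 = Y^5 t_2 generate a reduction of M, it is the cokernel of an explicit 6 x 6 matrix,
    and Y, u_1, u_2, u_3 - X is a regular sequence on R'. For a parameter ideal Q of the
    localization of R at its graded maximal ideal, vanishing of Koszul homology gives the
    lengths of R'/Q^n R', and as R'/R has length 1 one finds
    l(R/Q^(n+1)) = e binomial(n+4, 4) + binomial(n+4, 3) - 1 with e = e_Q(R); at n = 0 this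
    is l(R/Q) - e_Q(R) = 3 for every Q.

    The integral closure and the Ratliff-Rush closure both equal M': z is integral by
    z^2 in M^2, z M is contained in M^2, and three monomial valuations cut M' out of A^2.
    The projection of a direct sum decomposition of M extends to an idempotent 2 x 2 matrix
    over A whose reduction is upper triangular with equal diagonal entries, hence it is 0
    or 1. *)
Require Import Defs.
From HB Require Import structures.
From mathcomp Require Import all_boot all_order all_algebra.
From mathcomp Require Import mpoly.
From mathcomp Require Import boolp classical_sets cardinality.
From mathcomp Require Import zify ring.

Set Implicit Arguments.
Unset Strict Implicit.
Unset Printing Implicit Defensive.

Import Order.TTheory GRing.Theory Num.Theory.

Local Open Scope classical_set_scope.
Local Open Scope ring_scope.

(** The definition quantifies over all parameter ideals, while regularity is checked for one
    sequence p only. Depth sensitivity bridges this: each member of p has a power in Q, and that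
    alone carries the vanishing of Koszul homology from p to generators q of Q. Once H_1(q; R') = 0,
    the graded ring of QR' is a polynomial ring over R'/QR', and Q^n R' / Q^n has one copy of R'/R
    for each monomial of degree n; this is why the correction to the length is the same for every Q.

    The matrix presentation turns regularity into linear algebra: an element is regular on the
    cokernel when the matrix stays injective modulo it, so a single determinant, nonzero after all
    four reductions, settles the whole sequence. The cokernel is R' itself because X and Y are
    regular on it, because a power of X Y^8 turns each of its elements into a multiple of the class
    of 1 over A[u_2, u_3], and because u_2, u_3 are algebraically independent.

    The Krull dimension is bounded above by the growth of R/m^n, through Artin-Rees, and below by an
    explicit chain of primes. *)

(** * Noetherian rings: polynomials, graded ideals, power series *)

Section Ideals.
Variable R : comNzRingType.
Implicit Types (I J : set R) (s : seq R).

Lemma ideal_opp I x : is_ideal I -> I x -> I (- x).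
Proof. by case=> _ _ Im Ix; rewrite -mulN1r; apply: Im. Qed.

Lemma ideal_sub I x y : is_ideal I -> I x -> I y -> I (x - y).
Proof. by move=> Ii Ix Iy; case: (Ii) => _ Ia _; apply/Ia => //; apply: ideal_opp. Qed.

Lemma ideal_mulr I x a : is_ideal I -> I x -> I (x * a).
Proof. by case=> _ _ Im Ix; rewrite mulrC; apply: Im. Qed.

Lemma ideal_sum I (T : Type) (r : seq T) (P : pred T) (F : T -> R) :
  is_ideal I -> (forall i, P i -> I (F i)) -> I (\sum_(i <- r | P i) F i).
Proof. by case=> I0 Ia _ IF; elim/big_rec: _ => // i x Pi; apply: Ia; apply: IF. Qed.

Lemma ideal_gen_ideal s : is_ideal (ideal_gen s).
Proof.
split.
- by exists (fun=> 0); rewrite big1 // => i _; rewrite mul0r.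
- move=> x y [c ->] [d ->]; exists (fun i => c i + d i).
  by rewrite -big_split; apply: eq_bigr => i _; rewrite mulrDl.
- move=> a x [c ->]; exists (fun i => a * c i).
  by rewrite big_distrr /=; apply: eq_bigr => i _; rewrite mulrA.
Qed.

Lemma mem_ideal_gen s x : x \in s -> ideal_gen s x.
Proof.
move=> xs; exists (fun i => (i == index x s)%:R).
have lt : (index x s < size s)%N by rewrite index_mem.
rewrite (bigD1 (Ordinal lt)) //= eqxx mul1r nth_index // big1 ?addr0 // => i.
by rewrite -val_eqE /= => /negbTE ->; rewrite mul0r.
Qed.

Lemma ideal_gen_sub I s : is_ideal I -> (forall x, x \in s -> I x) -> ideal_gen s `<=` I.
Proof.
move=> Ii Is x [c ->]; apply: ideal_sum => // i _.
by case: (Ii) => _ _; apply; apply/Is/mem_nth.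
Qed.

Lemma ideal_setT : is_ideal [set: R].
Proof. by split. Qed.

Lemma ideal_bigcup_chain (C : nat -> set R) :
  (forall n, is_ideal (C n)) -> (forall n, C n `<=` C n.+1) ->
  is_ideal [set x | exists n, C n x].
Proof.
move=> Ci Cs.
have Cm m n : (m <= n)%N -> C m `<=` C n.
  by elim: n => [|n IH]; [rewrite leqn0 => /eqP ->|rewrite leq_eqVlt => /predU1P [->|/IH h] //;
    apply: (subset_trans h)].
split.
- by exists 0%N; case: (Ci 0%N).
- move=> x y [m Cx] [n Cy]; exists (maxn m n); case: (Ci (maxn m n)) => _ + _; apply.
    by apply: Cm Cx; apply: leq_maxl.
  by apply: Cm Cy; apply: leq_maxr.
- by move=> a x [m Cx]; exists m; case: (Ci m) => _ _; apply.
Qed.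

(** The union of the chain is finitely generated, and its generators all lie in one stage. *)
Lemma noetherian_chain (C : nat -> set R) : noetherian R ->
  (forall n, is_ideal (C n)) -> (forall n, C n `<=` C n.+1) ->
  exists N, forall n, C n `<=` C N.
Proof.
move=> nR Ci Cs.
have Cm m n : (m <= n)%N -> C m `<=` C n.
  by elim: n => [|n IH]; [rewrite leqn0 => /eqP ->|rewrite leq_eqVlt => /predU1P [->|/IH h] //;
    apply: (subset_trans h)].
have [s sE] := nR _ (ideal_bigcup_chain Ci Cs).
have [N Ns] : exists N, forall x, x \in s -> C N x.
  have : forall x, x \in s -> exists n, C n x.
    by move=> x /mem_ideal_gen; rewrite -sE.
  elim: (s) => [|y t IH] st; first by exists 0%N.
  have [|N NC] := IH; first by move=> x xt; apply: st; rewrite inE xt orbT.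
  have [|M MC] := st y; first by rewrite mem_head.
  exists (maxn M N) => x; rewrite inE => /predU1P [->|/NC].
    by apply: Cm MC; apply: leq_maxl.
  by apply: Cm; apply: leq_maxr.
exists N => n x Cx; apply: (ideal_gen_sub (Ci N) Ns); rewrite -sE.
by exists n.
Qed.

End Ideals.

Lemma noetherian_surj (R S : comNzRingType) (f : {rmorphism R -> S}) :
  (forall y, exists x, f x = y) -> noetherian R -> noetherian S.
Proof.
move=> sf nR J [J0 Ja Jm].
have [|s sE] := nR (fun x => J (f x)).
  split; first by rewrite rmorph0.
    by move=> x y; rewrite rmorphD; apply: Ja.
  by move=> a x; rewrite rmorphM; apply: Jm.
exists (map f s); apply/seteqP; split => y; last first.
  apply: ideal_gen_sub => // _ /mapP [x xs ->].
  by have := mem_ideal_gen xs; rewrite -sE.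
have [x <-] := sf y => Jfx; have : ideal_gen s x by rewrite -sE.
case=> c ->; exists (f \o c); rewrite rmorph_sum size_map.
by apply: eq_bigr => i _; rewrite rmorphM (nth_map 0).
Qed.

Section HilbertBasis.
Variable R : comNzRingType.

(** Hilbert's basis theorem: the ideals [L n] of leading coefficients grow with [n] and stabilise at
    some [N]; lifts [t n] of generators of [L n], for n up to [N], generate [J]. *)
Lemma noetherian_poly : noetherian R -> noetherian {poly R}.
Proof.
move=> nR J Ji; case: (Ji) => J0 Ja Jm.
pose L n := [set a : R | exists p, [/\ J p, (size p <= n.+1)%N & a = p`_n]].
have Li n : is_ideal (L n).
  split.
  - by exists 0; rewrite size_poly0 coef0.
  - move=> x y [p [Jp sp ->]] [q [Jq sq ->]]; exists (p + q); split; first exact: Ja.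
      by rewrite (leq_trans (size_polyD _ _)) // geq_max sp.
    by rewrite coefD.
  - move=> a x [p [Jp sp ->]]; exists (a%:P * p); split; first exact: Jm.
      by rewrite mul_polyC (leq_trans (size_scale_leq _ _)).
    by rewrite coefCM.
have Ls n : L n `<=` L n.+1.
  move=> x [p [Jp sp ->]]; exists ('X * p); split; first exact: Jm.
    by rewrite mulrC (leq_trans (size_polyMleq _ _)) // size_polyX addn2.
  by rewrite coefXM.
have [N NL] := noetherian_chain nR Li Ls.
have /choice [t tP] : forall n, exists t : seq {poly R},
    (forall p : {poly R}, p \in t -> J p /\ (size p <= n.+1)%N) /\
    L n `<=` ideal_gen [seq p`_n | p : {poly R} <- t].
  move=> n; have [s sE] := nR _ (Li n).
  have : forall a, a \in s -> L n a by move=> a /mem_ideal_gen; rewrite -sE.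
  suff /[apply] -[w [wP sw]] : (forall a, a \in s -> L n a) -> exists t : seq {poly R},
      (forall p : {poly R}, p \in t -> J p /\ (size p <= n.+1)%N) /\
      ideal_gen s `<=` ideal_gen [seq p`_n | p : {poly R} <- t].
    by exists w; rewrite sE.
  elim: (s) => [|a u IH] Lu; first by exists [::]; split.
  have [|p [Jp sp aE]] := Lu a; first by rewrite mem_head.
  have [|w [wP uw]] := IH; first by move=> b bu; apply: Lu; rewrite inE bu orbT.
  exists (p :: w); split.
    by move=> q; rewrite inE => /predU1P [->|/wP].
  apply: ideal_gen_sub; first exact: ideal_gen_ideal.
  move=> b; rewrite inE => /predU1P [->|bu].
    by apply: mem_ideal_gen; rewrite aE mem_head.
  have := uw _ (mem_ideal_gen bu).
  apply: ideal_gen_sub; first exact: ideal_gen_ideal.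
  by move=> q qw; apply: mem_ideal_gen; rewrite inE qw orbT.
pose G := flatten [seq t n | n <- iota 0 N.+1].
have tG n p : (n <= N)%N -> p \in t n -> ideal_gen G p.
  move=> nN pt; apply/mem_ideal_gen/flattenP; exists (t n) => //.
  by apply: map_f; rewrite mem_iota.
exists G; apply/seteqP; split; last first.
  by apply: ideal_gen_sub => // p /flattenP [_ /mapP [n _ ->]] /(tP n).1 [].
move=> f Jf; have [n] := ubnP (size f); elim: n f Jf => // n IH f Jf.
rewrite ltnS => sf; have [G0 Ga Gm] := ideal_gen_ideal G.
case: n IH sf => [_|n IH sf]; first by rewrite leqn0 size_poly_eq0 => /eqP ->.
(* Beyond degree [N] the leading coefficient already lies in [L N], and the lifts from degree [N]
   are shifted by a power of 'X. *)
pose r := minn n N.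
have Lf : L r f`_n.
  have Lnf : L n f`_n by exists f.
  rewrite /r; have [//|_] := leqP n N.
  exact: NL Lnf.
have [c cE] := (tP r).2 _ Lf.
pose g := \sum_(i < size (t r)) (c i)%:P * 'X^(n - r) * (t r)`_i.
have Gg : ideal_gen G g.
  apply: ideal_sum; first exact: ideal_gen_ideal.
  by move=> i _; apply/Gm/(tG r); [exact: geq_minr|apply: mem_nth].
have Jg : J g.
  by apply: ideal_sum => // i _; apply/Jm/((tP r).1 _ _).1/mem_nth.
rewrite -(subrK g f); apply: Ga => //; apply: IH; first exact: ideal_sub.
have sg : (size g <= n.+1)%N.
  apply: (leq_trans (size_sum _ _ _)); apply/bigmax_leqP => i _.
  rewrite -mulrA mul_polyC (leq_trans (size_scale_leq _ _)) //.
  have [_ st] := (tP r).1 _ (mem_nth 0 (ltn_ord i)).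
  rewrite mulrC (leq_trans (size_polyMleq _ _)) // size_polyXn addnS /=.
  by apply: (leq_trans (leq_add st (leqnn _))); rewrite addSn subnKC ?geq_minl.
have gn : g`_n = f`_n.
  rewrite cE coef_sum size_map; apply: eq_bigr => i _.
  rewrite -mulrA coefCM coefXnM (nth_map 0) // ltnNge leq_subr /=.
  by rewrite subKn ?geq_minl.
apply/leq_sizeP => j; rewrite leq_eqVlt => /predU1P [<-|lt]; first by rewrite coefB gn subrr.
by rewrite coefB !nth_default ?subr0 //; [apply: leq_trans lt|apply: leq_trans lt].
Qed.

End HilbertBasis.

Section MPolyInduction.
Variables (R : comNzRingType) (n : nat) (P : {mpoly R[n]} -> Prop).

Lemma mpoly_ring_ind :
  (forall c : R, P c%:MP) -> (forall i, P 'X_i) ->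
  (forall p q, P p -> P q -> P (p + q)) -> (forall p q, P p -> P q -> P (p * q)) ->
  forall p, P p.
Proof.
move=> PC PX PD PM p; elim/mpolyind: p => [|c m p _ _ Pp]; first by rewrite -mpolyC0.
apply: PD => //; rewrite -mul_mpolyC; apply/PM => //.
rewrite mpolyXE_id; elim/big_rec: _ => [|i x _ Px]; first by rewrite -mpolyC1.
apply/PM => //; elim: (m i) => [|j IH]; first by rewrite expr0 -mpolyC1.
by rewrite exprS; apply: PM.
Qed.

End MPolyInduction.

Section NoetherianMPoly.
Variable R : comNzRingType.

Lemma noetherian_mpoly n : noetherian R -> noetherian {mpoly R[n]}.
Proof.
move=> nR; elim: n => [|n IH].
  apply: (@noetherian_surj _ _ (@mpolyC 0 R)) => // p; exists (p@_0%MM).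
  apply/mpolyP => m; rewrite mcoeffC.
  have -> : m = 0%MM by apply/mnmP; case.
  by rewrite eqxx mulr1.
pose f : {rmorphism {poly {mpoly R[n]}} -> {mpoly R[n.+1]}} :=
  horner_eval ('X_ord_max : {mpoly R[n.+1]}) \o map_poly (@mwiden n R).
have fE p : f p = (map_poly (@mwiden n R) p).['X_ord_max] by [].
apply: (noetherian_surj (f := f)); last exact: noetherian_poly.
apply: mpoly_ring_ind => [c|i|p q [x <-] [y <-]|p q [x <-] [y <-]].
- by exists (c%:MP)%:P; rewrite fE map_polyC hornerC; apply: mwidenC.
- have [|] := ltnP i n => [lt|ge].
    exists ('X_(Ordinal lt))%:P; rewrite fE map_polyC hornerC [LHS]mwidenX mnmwiden1.
    by congr 'X_[U_(_)]; apply: val_inj.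
  exists 'X; rewrite fE map_polyX hornerX; congr 'X_[U_(_)]; apply: val_inj => /=.
  by apply/eqP; rewrite eqn_leq ge -ltnS ltn_ord.
- by exists (x + y); rewrite rmorphD.
- by exists (x * y); rewrite rmorphM.
Qed.

Variable n : nat.
Local Notation S := {mpoly R[n]}.

Lemma pihomogM_homog (d e : nat) (p q : S) : q \is e.-homog ->
  pihomog mdeg d (p * q) = if (e <= d)%N then pihomog mdeg (d - e) p * q else 0.
Proof.
move=> hq; rewrite [in LHS](pihomog_partitionE (mf := mdeg) (leqnn (msize p))).
rewrite mulr_suml raddf_sum /=.
have hom i : pihomog mdeg i p * q \is (i + e)%N.-homog.
  by apply: dhomogM => //; apply: pihomogP.
case: ifPn => [le|/negbTE lt]; last first.
  rewrite big1 // => i _; rewrite (pihomog_ne0 _ (hom i)) //.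
  by apply: contraFneq lt => <-; rewrite leq_addl.
have [lts|ges] := ltnP (d - e) (msize p).
  rewrite (bigD1 (Ordinal lts)) //= big1 ?addr0.
    by rewrite pihomog_dE //; have := hom (d - e)%N; rewrite subnK.
  move=> i ne; rewrite (pihomog_ne0 _ (hom i)) //.
  apply: contra ne; rewrite -val_eqE /= => /eqP <-; by rewrite addnK.
rewrite big1 => [|i _].
  rewrite pihomogE big_seq_cond big1 ?mul0r // => m /andP [mp /eqP md].
  move: ges; rewrite -md leqNgt => /negP [].
  by move: mp => /mmeasure_mnm_lt.
rewrite (pihomog_ne0 _ (hom i)) //; apply/eqP => ie.
by have := ltn_ord i; rewrite ltnNge => /negP []; apply: leq_trans ges _; rewrite -ie addnK.
Qed.

(** The [W d] are the components of a homogeneous ideal, so the homogeneous parts of finitely many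
    generators suffice, and cofactors can be cut down to the matching degree. It serves for initial
    forms of power series and again for Artin-Rees. *)
Lemma noetherian_homog (W : nat -> set S) : noetherian R ->
  (forall d p, W d p -> p \is d.-homog) ->
  (forall d, W d 0) -> (forall d p q, W d p -> W d q -> W d (p + q)) ->
  (forall d e p q, p \is e.-homog -> W d q -> W (e + d)%N (p * q)) ->
  exists r (h : 'I_r -> S) (e : 'I_r -> nat), (forall i, W (e i) (h i)) /\
    forall d p, W d p -> exists g : 'I_r -> S,
      [/\ forall i, (e i <= d)%N -> g i \is (d - e i)%N.-homog,
          forall i, (d < e i)%N -> g i = 0 & p = \sum_i g i * h i].
Proof.
move=> nR Wh W0 WD WM.
pose I : set S := [set p | forall d, W d (pihomog mdeg d p)].
have Ii : is_ideal I.
  split.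
  - by move=> d; rewrite raddf0; apply: W0.
  - by move=> p q Ip Iq d; rewrite raddfD /=; apply: WD.
  move=> a p Ip d.
  rewrite [p](pihomog_partitionE (mf := mdeg) (leqnn (msize p))).
  rewrite mulr_sumr raddf_sum; elim/big_rec: _ => [|i x _ Wx]; first exact: W0.
  apply: WD => //=; rewrite (@pihomogM_homog _ i) ?pihomogP //; case: ifP => // le.
  by have := WM _ (d - i)%N _ _ (pihomogP _ _ a) (Ip i); rewrite subnK.
have [s sE] := noetherian_mpoly nR Ii.
pose N := (\max_(p <- s) msize p)%N.
pose r := (size s * N)%N.
(* An index encodes a pair: the number of a generator in [s], and a degree below the common bound
   [N]. *)
pose ix (i : 'I_r) := (val i %/ N)%N; pose dx (i : 'I_r) := (val i %% N)%N.
exists r, (fun i => pihomog mdeg (dx i) s`_(ix i)), dx; split.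
  move=> i; have Ns : (0 < N)%N by have := leq_ltn_trans (leq0n i) (ltn_ord i); rewrite muln_gt0 => /andP [].
  suff : I s`_(ix i) by apply.
  rewrite sE; apply/mem_ideal_gen/mem_nth.
  by rewrite ltn_divLR //; apply: ltn_ord.
move=> d p Wp; have : I p.
  move=> e; have [<-|ne] := eqVneq d e.
    by rewrite pihomog_dE //; apply: Wh.
  by rewrite (pihomog_ne0 ne) //; apply: Wh.
rewrite sE => -[c pE].
exists (fun i => if (dx i <= d)%N then pihomog mdeg (d - dx i) (c (ix i)) else 0); split.
- by move=> i le; rewrite le pihomogP.
- by move=> i lt; rewrite leqNgt lt.
rewrite -(pihomog_dE (Wh _ _ Wp)) {1}pE raddf_sum /=.
transitivity (\sum_(i < size s) \sum_(j < N) if (j <= d)%N then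
   pihomog mdeg (d - j) (c i) * pihomog mdeg j s`_i else 0).
  apply: eq_bigr => i _.
  have le : (msize s`_i <= N)%N.
    by apply: (leq_bigmax_seq s`_i) => //; apply: mem_nth.
  rewrite {1}(pihomog_partitionE (mf := mdeg) le) mulr_sumr raddf_sum /=.
  by apply: eq_bigr => j _; rewrite (@pihomogM_homog _ j) ?pihomogP.
rewrite pair_bigA /=.
have ltij (x : 'I_(size s) * 'I_N) : (x.1 * N + x.2 < r)%N.
  case: x => i j /=; apply: (@leq_trans (i.+1 * N)%N); last by rewrite leq_mul2r ltn_ord orbT.
  by rewrite mulSn addnC ltn_add2r.
pose F x := Ordinal (ltij x).
have Ns (j : 'I_N) : (0 < N)%N by apply: leq_ltn_trans (ltn_ord j).
have FK x : ((val (F x) %/ N)%N, (val (F x) %% N)%N) = (val x.1, val x.2).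
  by rewrite /= divnMDl ?(Ns x.2) // modnMDl divn_small ?modn_small // addn0.
have Fbij : bijective F.
  apply: inj_card_bij; last by rewrite card_prod !card_ord.
  move=> [i j] [i' j'] /(congr1 (fun t => ((val t %/ N)%N, (val t %% N)%N))).
  by rewrite !FK /= => -[/val_inj -> /val_inj ->].
rewrite [RHS](reindex F) /=; last exact: onW_bij.
apply: eq_bigr => x _; rewrite /ix /dx.
have [-> ->] : (val (F x) %/ N)%N = x.1 /\ (val (F x) %% N)%N = x.2 by have [] := FK x.
by case: ifP => // _; rewrite mul0r.
Qed.

End NoetherianMPoly.

Section NoetherianPSeries.
Variables (k : fieldType) (n : nat).
Local Notation A := (pseries n k).

Definition psord d (g : A) := forall m, (mdeg m < d)%N -> pscoef g m = 0.

Definition ps_of_mpoly (p : {mpoly k[n]}) : A := PSeries (fun m => p@_m).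

Lemma pscoefM (f g : A) m : pscoef (f * g) m =
  \sum_(l : 'X_{1..n < (mdeg m).+1, (mdeg m).+1} | m == (l.1 + l.2)%MM)
     pscoef f l.1 * pscoef g l.2.
Proof. by []. Qed.

Lemma mdeg_addr (m m1 m2 : 'X_{1..n}) a b :
  m = (m1 + m2)%MM -> mdeg m = (a + b)%N -> mdeg m1 = a -> mdeg m2 = b.
Proof.
by move=> ->; rewrite mdegD => + m1a; rewrite m1a => /eqP; rewrite eqn_add2l => /eqP.
Qed.

Lemma psordM d e (f g : A) : psord d f -> psord e g -> psord (d + e) (f * g).
Proof.
move=> of_ og m mde; rewrite pscoefM big1 // => l /eqP mE.
have [lt|ge] := ltnP (mdeg l.1) d; first by rewrite of_ ?mul0r.
have := congr1 (@mdeg n) mE; rewrite mdegD => mD.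
rewrite og ?mulr0 // -(ltn_add2l (mdeg l.1)) -mD.
by apply: leq_trans mde _; rewrite leq_add2r.
Qed.

Lemma pscoef_sum (T : Type) (r : seq T) (P : pred T) (F : T -> A) m :
  pscoef (\sum_(i <- r | P i) F i) m = \sum_(i <- r | P i) pscoef (F i) m.
Proof. by elim/big_rec2: _ => // i x y _ <-; rewrite pscoefD. Qed.

Lemma noetherian_field : noetherian k.
Proof.
move=> I [I0 Ia Im]; have [[x [Ix x0]]|nI] := pselect (exists x, I x /\ x != 0).
  exists [:: 1]; apply/seteqP; split => y _; last first.
    by rewrite -[y]mulr1 -(mulVf x0) mulrA; apply: Im.
  by exists (fun=> y); rewrite big_ord1 mulr1.
exists [::]; apply/seteqP; split=> y.
  by move=> Iy; exists (fun=> 0); rewrite big_ord0; apply: contrapT => /eqP y0; apply: nI; exists y.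
by case=> c ->; rewrite big_ord0.
Qed.

(** The initial forms of members of [I] make up a homogeneous ideal of the polynomial ring. Members
    [G i] of [I] whose initial forms generate it generate [I]: division proceeds degree by degree,
    and the quotients add up to power series. *)
Lemma noetherian_pseries : noetherian A.
Proof.
move=> I Ii; case: (Ii) => I0 Ia Im.
pose W d : set {mpoly k[n]} := [set p | p \is d.-homog /\
  exists g, [/\ I g, psord d g & forall m, mdeg m = d -> pscoef g m = p@_m]].
have [r [h [e [Wh Wg]]]] : exists r (h : 'I_r -> {mpoly k[n]}) (e : 'I_r -> nat),
    (forall i, W (e i) (h i)) /\
    forall d p, W d p -> exists g : 'I_r -> {mpoly k[n]},
      [/\ forall i, (e i <= d)%N -> g i \is (d - e i)%N.-homog,
          forall i, (d < e i)%N -> g i = 0 & p = \sum_i g i * h i].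
  apply: noetherian_homog; first exact: noetherian_field.
  - by move=> d p [].
  - move=> d; split; first exact: dhomog0.
    by exists 0; split => // m _; rewrite mcoeff0.
  - move=> d p q [hp [f [If of_ fp]]] [hq [g [Ig og gq]]]; split; first exact: dhomogD.
    exists (f + g); split; first exact: Ia.
      by move=> m md; rewrite pscoefD of_ // og // addr0.
    by move=> m md; rewrite pscoefD mcoeffD fp // gq.
  move=> d d' p q hp [hq [g [Ig og gq]]]; split; first exact: dhomogM.
  exists (ps_of_mpoly p * g); split; first exact: Im.
    apply: psordM => // m md; apply: (dhomog_nemf_coeff hp).
    by rewrite /= neq_ltn md.
  move=> m md; rewrite mcoeffM pscoefM; apply: eq_bigr => l /eqP mE /=.
  have [l1|l1] := eqVneq (mdeg l.1) d'; last by rewrite (dhomog_nemf_coeff hp) // !mul0r.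
  by rewrite gq //; apply: mdeg_addr mE md l1.
have /choice [G GP] := fun i => (Wh i).2.
(* One division step: for [g] of order [d], forms whose combination of the [G i] cancels the part of
   degree [d]. *)
have /choice [F FP] : forall x : nat * A, exists c : 'I_r -> {mpoly k[n]},
    I x.2 -> psord x.1 x.2 ->
    (forall i, psord (x.1 - e i) (ps_of_mpoly (c i))
       /\ forall m, (x.1 != mdeg m + e i)%N -> (c i)@_m = 0) /\
    psord x.1.+1 (x.2 - \sum_i ps_of_mpoly (c i) * G i).
  move=> [d g] /=; have [[Ig og]|nI] := pselect (I g /\ psord d g); last first.
    by exists (fun=> 0) => Ig og; case: nI.
  pose p : {mpoly k[n]} := \sum_(m : 'X_{1..n < d.+1} | mdeg m == d) pscoef g m *: 'X_[m].
  have pE m : mdeg m = d -> p@_m = pscoef g m.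
    move=> md; have lt : (mdeg m < d.+1)%N by rewrite md.
    rewrite raddf_sum /= (bigD1 (BMultinom lt)) /= ?md // big1 ?addr0.
      by rewrite mcoeffZ mcoeffX eqxx mulr1.
    move=> l /andP [_ ne]; rewrite mcoeffZ mcoeffX; case: eqP => [lm|]; last by rewrite mulr0.
    by case/eqP: ne; apply: val_inj.
  have Wp : W d p.
    split; last by exists g; split => // m /pE.
    by apply: rpred_sum => m /eqP md; apply: dhomogZ; rewrite dhomogX; apply/eqP.
  have [c [c1 c0 pc]] := Wg _ _ Wp; exists c => _ _.
  have cz i m : (d != mdeg m + e i)%N -> (c i)@_m = 0.
    move=> ne; have [le|lt] := leqP (e i) d; last by rewrite c0 ?mcoeff0.
    apply: (dhomog_nemf_coeff (c1 i le)); apply: contra ne => /= /eqP ->.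
    by rewrite subnK.
  have co i : psord (d - e i) (ps_of_mpoly (c i)).
    move=> m; rewrite ltn_subRL addnC => lt /=; apply: cz.
    by rewrite neq_ltn lt orbT.
  split=> [i|m]; first by split=> [|m]; [exact: co|exact: cz].
  rewrite ltnS leq_eqVlt => /predU1P [md|lt].
    rewrite pscoefD -pE // pc raddf_sum /= pscoef_sum -sumrB big1 // => i _.
    rewrite mcoeffM pscoefM -sumrB big1 // => l /eqP mE /=.
    have [dE|/cz ->] := eqVneq d (mdeg l.1 + e i)%N; last by rewrite !mul0r subrr.
    have [_ _ ->] := GP i; first by rewrite subrr.
    by apply: mdeg_addr mE (etrans md dE) (erefl _).
  rewrite pscoefD og // add0r /= pscoef_sum big1 ?oppr0 // => i _.
  apply: (@psordM (d - e i) (e i)) => //; first by have [] := GP i.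
  by apply: leq_trans lt _; rewrite addnC -leq_subLR.
exists [seq G i | i <- enum 'I_r]; apply/seteqP; split; last first.
  by apply: ideal_gen_sub => // _ /mapP [i _ ->]; have [] := GP i.
move=> g Ig.
pose st := fix st d := if d is d'.+1 then
   st d' - \sum_i ps_of_mpoly (F (d', st d') i) * G i else g.
have stP d : I (st d) /\ psord d (st d).
  elim: d => [|d [Id od]]; first by split.
  split; last by case: (FP (d, st d)).
  by apply: ideal_sub => //; apply: ideal_sum => // i _; apply: Im; have [] := GP i.
(* The quotient by [G i] found at stage [d] is a form of degree d - e i, so a monomial [m] receives
   its coefficient from the single stage mdeg m + e i. *)
pose c i : A := PSeries (fun m => (F (mdeg m + e i, st (mdeg m + e i))%N i)@_m).
have Fz d i m : (d != mdeg m + e i)%N -> (F (d, st d) i)@_m = 0.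
  by have [Id od] := stP d; have [/(_ i) [_ /(_ m)] + _] := FP (d, st d) Id od.
pose cd d i := \sum_(j < d) ps_of_mpoly (F (val j, st j) i).
have stE d : st d = g - \sum_i cd d i * G i.
  elim: d => [|d IH] /=.
    by rewrite big1 ?subr0 // => i _; rewrite /cd big_ord0 mul0r.
  rewrite {1}IH -addrA -opprD -big_split; congr (_ - _); apply: eq_bigr => i _ /=.
  by rewrite /cd big_ord_recr /= mulrDl.
have ccd d i : psord (d - e i) (c i - cd d i).
  move=> m; rewrite ltn_subRL addnC => lt.
  rewrite pscoefD /= /cd pscoef_sum (bigD1 (Ordinal lt)) //= big1 ?addr0 ?subrr // => j ne.
  by apply: Fz; apply: contra ne => /eqP jE; rewrite -val_eqE /= jE.
suff -> : g = \sum_i c i * G i.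
  apply: ideal_sum => [|i _]; first exact: ideal_gen_ideal.
  have [_ _ Gm] := ideal_gen_ideal [seq G i | i <- enum 'I_r].
  by apply: Gm; apply: mem_ideal_gen; apply: map_f; rewrite mem_enum.
apply/eqP; rewrite -subr_eq0; apply/eqP/pseriesP => m.
pose d := (mdeg m).+1.
have -> : g - \sum_i c i * G i = st d - \sum_i (c i - cd d i) * G i.
  rewrite stE -addrA -opprD -big_split; congr (_ - _); apply: eq_bigr => i _ /=.
  by rewrite -mulrDl addrC subrK.
rewrite pscoefD (stP d).2 // add0r /= pscoef_sum big1 ?oppr0 // => i _.
apply: (@psordM (d - e i) (e i)) => //; first by have [] := GP i.
by rewrite -/d addnC -leq_subLR.
Qed.

End NoetherianPSeries.

(** * Koszul complexes *)

Section Koszul.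
Variables (W : comNzRingType) (q : nat -> W).

(* The pair (x, y) stands for x + y /\ e_n. *)
Fixpoint kz n : lmodType W :=
  if n is n'.+1 then (kz n' * kz n')%type : lmodType W else W^o.

(** Adding an element makes the complex the mapping cone of multiplication by that element; the sign
    makes the square of the differential zero. *)
Fixpoint kd n : kz n -> kz n :=
  if n is n'.+1 return kz n -> kz n
  then fun x => (kd x.1 + q n' *: x.2, - kd x.2) else fun=> 0.

(** [kz n] is the whole exterior algebra; its elements of exterior degree [t] are singled out by a
    predicate instead of by a family of types. *)
Fixpoint kdeg n : nat -> kz n -> Prop :=
  if n is n'.+1 return nat -> kz n -> Prop
  then fun t x => kdeg t x.1 /\ (if t is t'.+1 then kdeg t' x.2 else x.2 = 0)
  else fun t x => (0 < t)%N -> x = 0.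

Fixpoint kin (L : set W) n : kz n -> Prop :=
  if n is n'.+1 return kz n -> Prop then fun x => kin L x.1 /\ kin L x.2 else L.

Lemma kdP n : linear (@kd n).
Proof.
elim: n => [|n IH] a x y /=; first by rewrite scaler0 addr0.
congr (_, _) => /=.
  by rewrite IH !scalerDr !scalerA [q n * a]mulrC addrACA.
by rewrite IH opprD scalerN.
Qed.

Lemma kd0 n : kd (0 : kz n) = 0.
Proof. by have := @kdP n (-1) 0 0; rewrite scaler0 addr0 scaleN1r addNr. Qed.
Lemma kdD n (x y : kz n) : kd (x + y) = kd x + kd y.
Proof. by have := @kdP n 1 x y; rewrite !scale1r. Qed.
Lemma kdZ n a (x : kz n) : kd (a *: x) = a *: kd x.
Proof. by have := @kdP n a x 0; rewrite kd0 !addr0. Qed.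
Lemma kdN n (x : kz n) : kd (- x) = - kd x.
Proof. by rewrite -scaleN1r kdZ scaleN1r. Qed.

Lemma kdeg0 n t : kdeg t (0 : kz n).
Proof. by elim: n t => [|n IH] [|t] //=. Qed.

Lemma kdegD n t (x y : kz n) : kdeg t x -> kdeg t y -> kdeg t (x + y).
Proof.
elim: n t x y => [|n IH] t x y /=; first by move=> hx hy lt; rewrite hx // hy // addr0.
case=> hx hx' [hy hy']; split; first exact: IH.
by case: t hx' hy' {hx hy} => [-> ->|t]; [rewrite addr0|apply: IH].
Qed.

Lemma kdegZ n t a (x : kz n) : kdeg t x -> kdeg t (a *: x).
Proof.
elim: n t x => [|n IH] t x /=; first by move=> hx lt; rewrite hx // scaler0.
case=> hx hx'; split; first exact: IH.
by case: t hx' {hx} => [->|t]; [rewrite scaler0|apply: IH].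
Qed.

Lemma kd_kdeg0 n (x : kz n) : kdeg 0 x -> kd x = 0.
Proof.
elim: n x => [|n IH] //= [x y] /= [tx ->].
by rewrite IH // scaler0 addr0 kd0 oppr0.
Qed.

Lemma kd_kd n (x : kz n) : kd (kd x) = 0.
Proof.
elim: n x => [|n IH] //= [x y] /=; congr (_, _); last by rewrite kdN IH !oppr0.
by rewrite kdD IH add0r kdZ scalerN subrr.
Qed.

Lemma kdeg_gt n t (x : kz n) : (n < t)%N -> kdeg t x -> x = 0.
Proof.
elim: n t x => [|n IH] t x /=; first by move=> ? ->.
by case: t => // t lt [h1 h2]; case: x h1 h2 => x y /= /IH -> //; [move/IH => ->|apply: ltnW].
Qed.

Lemma kdegN n t (x : kz n) : kdeg t x -> kdeg t (- x).
Proof. by rewrite -scaleN1r; apply: kdegZ. Qed.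

Lemma kdeg_kd n t (x : kz n) : kdeg t.+1 x -> kdeg t (kd x).
Proof.
elim: n t x => [//|n IH] t [x y] /= [tx ty]; split.
  by apply: kdegD; [apply: IH|apply: kdegZ].
by case: t ty {tx} => [|t] ty; [rewrite (kd_kdeg0 ty) oppr0|apply/kdegN/IH].
Qed.

Variable L : set W.
Hypothesis Li : is_ideal L.

Lemma kin0 n : kin L (0 : kz n).
Proof. by elim: n => [|n IH] //=; case: Li. Qed.

Lemma kinD n (x y : kz n) : kin L x -> kin L y -> kin L (x + y).
Proof.
elim: n x y => [|n IH] x y /=; first by case: Li => _ + _; apply.
by case=> ? ? [? ?]; split; apply: IH.
Qed.

Lemma kinZ n a (x : kz n) : kin L x -> kin L (a *: x).
Proof.
elim: n x => [|n IH] x /=; first by case: Li => _ _; apply.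
by case=> ? ?; split; apply: IH.
Qed.

Lemma kinN n (x : kz n) : kin L x -> kin L (- x).
Proof. by rewrite -scaleN1r; apply: kinZ. Qed.

Lemma kin_kd n (x : kz n) : kin L x -> kin L (kd x).
Proof.
elim: n x => [|n IH] x /=; first by case: Li.
case=> h1 h2; split; first by apply: kinD; [apply: IH|apply: kinZ].
by apply/kinN/IH.
Qed.

(** The homotopy is the exterior product with e_i. Hence each [q i] annihilates Koszul homology,
    also modulo [L]. *)
Lemma koszul_homotopy n i : (i < n)%N -> exists s : kz n -> kz n,
  [/\ linear s, forall x, q i *: x = kd (s x) + s (kd x), forall x, kin L x -> kin L (s x)
    & forall t x, kdeg t x -> kdeg t.+1 (s x)].
Proof.
elim: n => // n IH; rewrite ltnS leq_eqVlt => /predU1P [->|/IH [s [sl sE sL st]]].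
  exists (fun x => (0, x.1) : kz n.+1); split.
  - by move=> a x y; congr (_, _) => /=; rewrite scaler0 addr0.
  - move=> [x y]; congr (_, _) => /=; first by rewrite kd0 add0r addr0.
    by rewrite addrA addNr add0r.
  - by move=> x [h1 h2]; split => //; apply: kin0.
  by move=> t x [h1 h2]; split => //; apply: kdeg0.
have s0 : s 0 = 0 by have := sl (-1) 0 0; rewrite scaler0 addr0 scaleN1r addNr.
have sD x y : s (x + y) = s x + s y by have := sl 1 x y; rewrite !scale1r.
have sZ a x : s (a *: x) = a *: s x by have := sl a x 0; rewrite s0 !addr0.
have sN x : s (- x) = - s x by rewrite -scaleN1r sZ scaleN1r.
exists (fun x => (s x.1, - s x.2) : kz n.+1); split.
- by move=> a x y; congr (_, _) => /=; rewrite sl // opprD scalerN.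
- move=> [x y]; congr (_, _) => /=.
    by rewrite sE sD sZ scalerN addrACA addNr addr0.
  by rewrite sE sN kdN !opprK.
- by move=> x [h1 h2]; split; [apply: sL|apply/kinN/sL].
move=> t x [h1 h2]; split; first exact: st.
by case: t h2 {h1} => [->|t h2]; rewrite ?s0 ?oppr0 -?scaleN1r; [apply: kdeg0|apply/kdegZ/st].
Qed.

End Koszul.

(** Vanishing, in degrees at least [j], of the Koszul homology of [q] with coefficients in W / L,
    phrased by congruences so that no quotient ring is formed. *)
Definition kz_acyclic (W : comNzRingType) (q : nat -> W) n (L : set W) j :=
  forall t (x : kz W n), (j <= t)%N -> kdeg t x -> kin L (kd q x) ->
    exists y : kz W n, kdeg t.+1 y /\ kin L (x - kd q y).

Section DepthSensitivity.
Variables (W : comNzRingType) (q : nat -> W) (n : nat).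

Lemma kin_reg (L : set W) p m (u : kz W m) :
  (forall w, L (p * w) -> L w) -> kin L (p *: u) -> kin L u.
Proof.
by move=> preg; elim: m u => [|m IH] u; [apply: preg|case=> /= /IH ? /IH].
Qed.

(** By the long exact sequence of multiplication by [p] on W / L, vanishing over W / (L + pW) in
    degree t + 1 makes [p] injective on homology in degree t. But a power of [p] lies in (q), which
    annihilates homology. *)
Lemma kz_acyclic_step (L : set W) p N (c : nat -> W) j : is_ideal L ->
  (forall w, L (p * w) -> L w) -> p ^+ N = \sum_(i < n) c i * q i ->
  kz_acyclic q n [set x | exists w l, L l /\ x = l + p * w] j.+1 -> kz_acyclic q n L j.
Proof.
move=> Li preg pN ac t x jt tx Ldx.
pose B x := exists y : kz W n, kdeg t.+1 y /\ kin L (x - kd q y).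
have kin_split t' u : kin [set x | exists w l, L l /\ x = l + p * w] u -> kdeg t' u ->
    exists v l : kz W n, [/\ kin L l, kdeg t' v & u = l + p *: v].
  elim: (n) t' u => [|m IH] t' u /=.
    case=> w [l [Ll uE]]; case: t' => [|t'] tu; first by exists w, l.
    by exists 0, 0; split => //; [case: Li|rewrite tu // add0r scaler0].
  case=> u1 u2 [d1 d2]; have [v [l [Ll tv uE]]] := IH _ _ u1 d1.
  have [v' [l' [Ll' tv' uE']]] : exists v l : kz W m, [/\ kin L l,
      (if t' is t''.+1 then kdeg t'' v else v = 0) & u.2 = l + p *: v].
    case: t' d2 {d1 tv} => [u0|t' d2]; last exact: IH.
    by exists 0, 0; split => //; [apply: kin0|rewrite u0 scaler0 addr0].
  exists (v, v'), (l, l'); split => //.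
  by rewrite [u]surjective_pairing uE uE'.
(* A chain [y] bounding p u is a cycle modulo L + pW, hence congruent modulo [L] to a boundary plus
   some p v; then [v] bounds [u], because [p] is regular. *)
have Bstep u : kdeg t u -> kin L (kd q u) -> B (p *: u) -> B u.
  move=> tu Lu [y [ty Ly]].
  have [|y' [ty' Ly']] := ac t.+1 y jt ty.
    have -> : kd q y = - (p *: u - kd q y) + p *: u by rewrite opprB subrK.
    move: (kinN Li Ly); set l := - _; move: l.
    elim: (n) u {tu Lu y ty Ly} => [|m IH] u l /=; first by move=> Ll; exists u, l.
    by case=> h1 h2; split; apply: IH.
  have [|v [l [Ll tv yE]]] := kin_split t.+1 _ Ly'.
    by apply: kdegD => //; apply/kdegN/kdeg_kd.
  have {}yE : kd q y = kd q l + p *: kd q v.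
    by rewrite -[y](subrK (kd q y')) yE !kdD kd_kd addr0 kdZ.
  exists v; split => //; apply: (kin_reg preg).
  have -> : p *: (u - kd q v) = (p *: u - kd q y) + kd q l.
    by rewrite yE opprD scalerBr addrA addrAC subrK.
  by apply: kinD => //; apply: kin_kd.
have Bpow u : kdeg t u -> kin L (kd q u) -> B (p ^+ N *: u) -> B u.
  move=> tu Lu; elim: (N) => [|N' IH]; first by rewrite scale1r.
  rewrite exprS -scalerA => /Bstep BN; apply/IH/BN; first exact: kdegZ.
  by rewrite kdZ; apply: kinZ.
apply: Bpow => //; rewrite pN scaler_suml.
pose P (z : kz W n) := exists y : kz W n, kdeg t.+1 y /\ kin L (z - kd q y).
rewrite /B -/(P _); elim/big_rec: _ => [|i z _ [y [ty Ly]]].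
  by exists 0; split; [apply: kdeg0|rewrite kd0 subr0; apply: kin0].
have [s [sl sE sL st]] := koszul_homotopy q Li (ltn_ord i).
exists (c i *: s x + y); split.
  by apply: kdegD => //; apply/kdegZ/st.
rewrite -scalerA sE kdD kdZ scalerDr opprD addrACA.
apply: kinD => //; rewrite addrAC subrr add0r.
by apply/kinZ/sL.
Qed.

Lemma kz_acyclic_top (L : set W) : is_ideal L -> kz_acyclic q n L n.+1.
Proof.
move=> Li t x lt tx _; exists 0; split; first exact: kdeg0.
by rewrite (kdeg_gt lt tx) kd0 subr0; apply: kin0.
Qed.

End DepthSensitivity.

Section KoszulSyzygies.
Variables (W : comNzRingType) (q : nat -> W).

(** The embedding of scalars in exterior degree 0; [kvec] is that of vectors in degree 1. *)
Fixpoint kone n (a : W) : kz W n :=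
  if n is n'.+1 return kz W n then (kone n' a, 0) else a.

Fixpoint kvec n (w : nat -> W) : kz W n :=
  if n is n'.+1 return kz W n then (kvec n' w, kone n' (w n')) else 0.

Lemma kdeg_kone n a : kdeg 0 (kone n a).
Proof. by elim: n => [|n IH]. Qed.

Lemma koneZ n c a : c *: kone n a = kone n (c * a).
Proof. by elim: n => [|n IH] //=; rewrite -IH; congr (_, _); rewrite scaler0. Qed.

Lemma koneD n a b : kone n a + kone n b = kone n (a + b).
Proof. by elim: n => [|n IH] //=; rewrite -IH; congr (_, _); rewrite addr0. Qed.

Lemma kone_inj n a b : kone n a = kone n b -> a = b.
Proof. by elim: n => [|n IH] //= [/IH]. Qed.

Lemma kdeg0_kone n x : kdeg 0 x -> exists a, x = kone n a.
Proof.
elim: n x => [|n IH] x /=; first by exists x.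
by case: x => x y /= [/IH [a ->] ->]; exists a.
Qed.

Lemma kdeg_kvec n w : kdeg 1 (kvec n w).
Proof. by elim: n => [|n IH] //=; split => //; apply: kdeg_kone. Qed.

Lemma eq_kvec n u w : (forall i, (i < n)%N -> u i = w i) -> kvec n u = kvec n w.
Proof.
elim: n => [|n IH] //= uw; rewrite uw // IH // => i lt.
by apply: uw; apply: ltnW.
Qed.

Lemma kdeg1_kvec n x : kdeg 1 x -> exists w, x = kvec n w.
Proof.
elim: n x => [|n IH] x /=; first by move=> /(_ isT) ->; exists (fun=> 0).
case: x => x y /= [/IH [w ->] /kdeg0_kone [a ->]].
exists (fun i => if i == n then a else w i); rewrite eqxx; congr (_, _).
by apply: eq_kvec => i lt; rewrite ltn_eqF.
Qed.

Lemma kvec_inj n u w : kvec n u = kvec n w -> forall i, (i < n)%N -> u i = w i.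
Proof.
elim: n => [|n IH] //= [/IH h /kone_inj h'] i.
by rewrite ltnS leq_eqVlt => /predU1P [->|/h].
Qed.

Lemma kvecZ n c w : c *: kvec n w = kvec n (fun i => c * w i).
Proof.
by elim: n => [|n IH] //=; [rewrite scaler0|rewrite -IH -koneZ].
Qed.

Lemma kvecD n u w : kvec n u + kvec n w = kvec n (fun i => u i + w i).
Proof.
by elim: n => [|n IH] //=; [rewrite addr0|rewrite -IH -koneD].
Qed.

Lemma kd_kvec n w : kd q (kvec n w) = kone n (\sum_(i < n) q i * w i).
Proof.
elim: n => [|n IH] /=; first by rewrite big_ord0.
by rewrite IH koneZ koneD big_ord_recr kd_kdeg0 ?oppr0 //; apply: kdeg_kone.
Qed.

Lemma kd_kdeg2 n x : kdeg 2 x -> exists v : nat -> nat -> W,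
  [/\ forall i, v i i = 0, forall i j, v i j = - v j i
    & kd q x = kvec n (fun i => \sum_(j < n) v i j * q j)].
Proof.
elim: n x => [|n IH] x /=; first by exists (fun _ _ => 0); split => // *; rewrite ?oppr0.
case: x => x y /= [/IH [v [v0 va ->]] /kdeg1_kvec [u ->]].
exists (fun i j => if (i < n)%N then (if (j < n)%N then v i j else if j == n then u i else 0)
  else if (i == n) && (j < n)%N then - u j else 0); split.
- by move=> i; case: (ltngtP i n) => h /=.
- move=> i j; case: (ltngtP i n) => hi; case: (ltngtP j n) => hj /=;
    by rewrite ?oppr0 ?opprK // va.
congr (_, _).
  rewrite kvecZ kvecD; apply: eq_kvec => i lt; rewrite lt big_ord_recr /= ltnn eqxx.
  congr (_ + _); last by rewrite mulrC.
  by apply: eq_bigr => j _; rewrite ltn_ord.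
rewrite kd_kvec -scaleN1r koneZ mulN1r ltnn eqxx big_ord_recr /= ltnn mul0r addr0 -sumrN.
by congr kone; apply: eq_bigr => i _; rewrite ltn_ord mulNr mulrC.
Qed.

(** The generators are an initial segment of a sequence, so that all the ideals (p_0, ..., p_(i-1))
    met in regularity come from one [p]. *)
Definition pre_ideal (p : nat -> W) i : set W :=
  [set x | exists c : nat -> W, x = \sum_(j < i) c j * p j].

Lemma pre_ideal_ideal p i : is_ideal (pre_ideal p i).
Proof.
split.
- by exists (fun=> 0); rewrite big1 // => j _; rewrite mul0r.
- move=> x y [c ->] [d ->]; exists (fun i => c i + d i).
  by rewrite -big_split; apply: eq_bigr => j _; rewrite mulrDl.
- move=> a x [c ->]; exists (fun i => a * c i).
  by rewrite big_distrr /=; apply: eq_bigr => j _; rewrite mulrA.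
Qed.

Lemma pre_ideal_mem (p : nat -> W) n i : (i < n)%N -> pre_ideal p n (p i).
Proof.
move=> lt; exists (fun j => (j == i)%:R).
rewrite (bigD1 (Ordinal lt)) //= eqxx mul1r big1 ?addr0 // => j.
by rewrite -val_eqE /= => /negbTE ->; rewrite mul0r.
Qed.

Lemma pre_idealS p i :
  pre_ideal p i.+1 = [set x | exists w l, pre_ideal p i l /\ x = l + p i * w].
Proof.
apply/seteqP; split => x.
  case=> c ->; rewrite big_ord_recr /=; exists (c i), (\sum_(j < i) c j * p j).
  by split; [exists c|rewrite [p i * _]mulrC].
case=> w [_ [[c ->] ->]]; exists (fun j => if j == i then w else c j).
rewrite big_ord_recr /= eqxx mulrC; congr (_ + _); apply: eq_bigr => j _.
by rewrite ltn_eqF.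
Qed.

(** Depth sensitivity. Modulo the whole sequence [p] only the degrees above [n], where the complex
    is zero, are claimed to be exact; giving back one element of [p] gains one degree, and after [n]
    steps H_1 of [q] on W itself vanishes. *)
Lemma koszul_syzygy n (p w : nat -> W) :
  (forall i x, (i < n)%N -> pre_ideal p i (p i * x) -> pre_ideal p i x) ->
  (forall i, (i < n)%N -> exists N, pre_ideal q n (p i ^+ N)) ->
  \sum_(i < n) q i * w i = 0 ->
  exists v : nat -> nat -> W,
  [/\ forall i, v i i = 0, forall i j, v i j = - v j i
    & forall i, (i < n)%N -> w i = \sum_(j < n) v i j * q j].
Proof.
move=> preg pq qw.
have ac i : (i <= n)%N -> kz_acyclic q n (pre_ideal p (n - i)) (n - i).+1.
  elim: i => [|i IH] lei; first by rewrite subn0; apply/kz_acyclic_top/pre_ideal_ideal.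
  have lt : (n - i.+1 < n)%N by rewrite ltn_subrL (leq_trans _ lei).
  have [N [c pN]] := pq _ lt.
  apply: (kz_acyclic_step (pre_ideal_ideal _ _) _ pN) => [x|]; first exact: preg.
  by rewrite -pre_idealS; have := IH (ltnW lei); rewrite subnSK.
have {ac} ac := ac n (leqnn n); rewrite subnn in ac.
have [|y [y2 yE]] := ac 1%N (kvec n w) (leqnn _) (@kdeg_kvec n w).
  by rewrite kd_kvec qw -[0](mul0r 0) -koneZ scale0r; apply/kin0/pre_ideal_ideal.
have [v [v0 va vE]] := kd_kdeg2 y2; exists v; split => //.
apply: kvec_inj; rewrite -vE; apply/eqP; rewrite -subr_eq0; apply/eqP.
move: yE; elim: (n) (_ - _) => [|m IH] x /=; first by case=> c ->; rewrite big_ord0.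
by case: x => x1 x2 /= [/IH -> /IH ->].
Qed.

End KoszulSyzygies.

(** * Quasi-regular sequences *)

Section QuasiRegular.
Variables (W : comNzRingType) (n : nat).
Local Notation S := {mpoly W[n]}.
Implicit Types (f g : S) (d : nat).

Lemma homog_split d f : f \is d.+1.-homog ->
  exists g : 'I_n -> S, (forall i, g i \is d.-homog) /\ f = \sum_i 'X_i * g i.
Proof.
move=> /dhomogP hf.
have mi (m : 'X_{1..n}) : m \in msupp f -> exists i, (0 < m i)%N.
  move=> mf; apply: contrapT => nex; have /= md := hf m mf.
  have : mdeg m = 0%N by rewrite mdegE big1 // => i _; apply/eqP; rewrite -leqn0 leqNgt;
    apply/negP => lt; apply: nex; exists i.
  by rewrite md.
have {}mi (m : 'X_{1..n}) : exists o : option 'I_n,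
    m \in msupp f -> exists2 i, o = Some i & (0 < m i)%N.
  case: (boolP (m \in msupp f)) => [/mi [i lt]|_]; last by exists None.
  by exists (Some i) => _; exists i.
have /choice [o oP] := mi.
exists (fun i => \sum_(m <- msupp f | o m == Some i) f@_m *: 'X_[m - U_(i)]); split.
  move=> i; rewrite big_seq_cond; apply: rpred_sum => m /andP [mf /eqP om].
  have [j] := oP m mf; rewrite om => -[<-] lt; apply: dhomogZ; rewrite dhomogX /=.
  have /= md := hf m mf.
  have mE : (m - U_(i) + U_(i) = m)%MM.
    apply/mnmP => k; rewrite mnmDE mnmBE mnm1E.
    by case: eqP => [<-|]; rewrite ?subnK // addn0 subn0.
  by have := congr1 (@mdeg n) mE; rewrite mdegD mdeg1 md addn1 => -[->].
rewrite {1}[f]mpolyE; under [RHS]eq_bigr do rewrite mulr_sumr.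
rewrite (exchange_big_dep xpredT) //= big_seq [RHS]big_seq.
apply: eq_bigr => m mf; have [j om lt] := oP m mf.
rewrite (big_pred1 j) => [|i]; last by rewrite om /= eq_sym; apply/eqP/eqP => [[]|->].
rewrite -scalerAr -mpolyXD; congr (_ *: 'X_[_]); apply/mnmP => k.
by rewrite mnmDE mnmBE mnm1E; case: eqP => [<-|]; rewrite ?subnKC // add0n subn0.
Qed.

Lemma sum_alternating (T : comNzRingType) N (v : nat -> nat -> T) (x : nat -> T) :
  (forall i, v i i = 0) -> (forall i j, v i j = - v j i) ->
  \sum_(i < N) \sum_(j < N) v i j * (x i * x j) = 0.
Proof.
move=> v0 va; elim: N => [|N IH]; first by rewrite big_ord0.
rewrite big_ord_recr /= big_ord_recr /= v0 mul0r addr0.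
under eq_bigr do rewrite big_ord_recr /=.
rewrite big_split /= IH add0r -big_split /= big1 // => i _.
by rewrite va mulNr [x N * _]mulrC addNr.
Qed.

Variable q : nat -> W.
Local Notation ev f := (f.@[fun i : 'I_n => q i]).

Hypothesis syz : forall w : nat -> W, \sum_(i < n) q i * w i = 0 ->
  exists v : nat -> nat -> W,
  [/\ forall i, v i i = 0, forall i j, v i j = - v j i
    & forall i, (i < n)%N -> w i = \sum_(j < n) v i j * q j].

Lemma mpoly_syzygy (w : nat -> S) : \sum_(i < n) (q i)%:MP * w i = 0 ->
  exists v : nat -> nat -> S,
  [/\ forall i, v i i = 0, forall i j, v i j = - v j i
    & forall i, (i < n)%N -> w i = \sum_(j < n) v i j * (q j)%:MP].
Proof.
move=> qw.
have /choice [u uP] : forall m : 'X_{1..n}, exists v : nat -> nat -> W,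
    [/\ forall i, v i i = 0, forall i j, v i j = - v j i
    & forall i, (i < n)%N -> (w i)@_m = \sum_(j < n) v i j * q j].
  move=> m; apply: (syz (w := fun i => (w i)@_m)).
  have := congr1 (mcoeff m) qw; rewrite mcoeff0 raddf_sum /= => E; rewrite -[RHS]E.
  by apply: eq_bigr => i _; rewrite mcoeffCM.
pose D := (\max_(i < n) msize (w i))%N.
exists (fun i j => \sum_(m : 'X_{1..n < D}) u m i j *: 'X_[m]); split.
- by move=> i; rewrite big1 // => m _; case: (uP m) => -> _ _; rewrite scale0r.
- move=> i j; rewrite -sumrN; apply: eq_bigr => m _.
  by case: (uP m) => _ -> _; rewrite scaleNr.
move=> i lt; under [RHS]eq_bigr do rewrite mulr_suml.
rewrite exchange_big /= {1}[w i](@mpolywE _ _ D); last first.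
  by rewrite (leq_bigmax (Ordinal lt)).
apply: eq_bigr => m _; have [_ _ ->] := uP m => //.
rewrite scaler_suml; apply: eq_bigr => j _.
by rewrite -scalerAl ['X_[m] * _]mulrC mul_mpolyC scalerA.
Qed.

(** Write f as the sum of X_i g_i. Evaluating only these factors X_i gives a form of lower degree
    that still vanishes at [q]; the induction hypothesis turns it into a syzygy of the q_i over the
    polynomial ring, which determines the g_i. The alternating [v] cancels against the symmetric
    products X_i X_j. *)
Lemma form_relation d f : f \is d.-homog -> ev f = 0 ->
  exists u : nat -> nat -> S,
  [/\ forall i, u i i = 0, forall i j, u i j = - u j i
    & f = \sum_(i < n) \sum_(j < n) u i j * ((q i)%:MP * 'X_j)].
Proof.
elim: d f => [|d IH] f hf f0.
  have fE : f = (f@_0%MM)%:MP.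
    apply/mpolyP => m; rewrite mcoeffC; have [->|m0] := eqVneq m 0%MM; first by rewrite mulr1.
    by rewrite mulr0; apply: (dhomog_nemf_coeff hf); rewrite /= mdeg_eq0.
  exists (fun _ _ => 0); split => [||]; rewrite ?oppr0 // big1.
    by rewrite fE mevalC in f0 *; rewrite f0 mpolyC0.
  by move=> i _; rewrite big1 // => j _; rewrite mul0r.
have [g [hg fE]] := homog_split hf.
pose gn i : S := if insub i is Some j then g j else 0.
have gnE (i : 'I_n) : gn i = g i by rewrite /gn valK.
have [|| v [v0 va vE]] := IH (\sum_(i < n) (q i)%:MP * gn i).
- apply: rpred_sum => i _; rewrite mul_mpolyC; apply: dhomogZ.
  by rewrite gnE.
- rewrite -[RHS]f0 fE !raddf_sum /=; apply: eq_bigr => i _.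
  by rewrite !mevalM mevalC mevalXU gnE.
pose Xn i : S := if insub i is Some j then 'X_j else 0.
have XnE (i : 'I_n) : Xn i = 'X_i by rewrite /Xn valK.
have [|u [u0 ua uE]] := @mpoly_syzygy (fun i => gn i - \sum_(j < n) v i j * Xn j).
  under eq_bigr do rewrite mulrBr; rewrite sumrB vE; apply/eqP; rewrite subr_eq0; apply/eqP.
  apply: eq_bigr => i _; rewrite mulr_sumr; apply: eq_bigr => j _.
  by rewrite XnE mulrCA.
exists (fun i j => u j i); split; first by [].
  by move=> i j; rewrite ua.
rewrite exchange_big fE /=.
have -> : \sum_i 'X_i * g i = \sum_(i < n) 'X_i * (gn i - \sum_(j < n) v i j * Xn j).
  under [RHS]eq_bigr do rewrite mulrBr; rewrite sumrB.
  have := sum_alternating n Xn v0 va => s0.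
  rewrite [X in _ - X](_ : _ = 0) ?subr0; first by apply: eq_bigr => i _; rewrite gnE.
  rewrite -[RHS]s0; apply: eq_bigr => i _; rewrite mulr_sumr; apply: eq_bigr => j _.
  by rewrite -(XnE i) mulrCA.
apply: eq_bigr => i _; rewrite uE // mulr_sumr; apply: eq_bigr => j _.
by rewrite mulrCA [_ * 'X_i]mulrC mulrA.
Qed.

(** Replacing one factor X_i in each term of [g] by q_i gives a form of degree [d] with the same
    value and coefficients in (q). Its difference from [f] vanishes at [q], so [form_relation] puts
    those coefficients in (q) too. *)
Lemma quasi_regular d f g : f \is d.-homog -> g \is d.+1.-homog -> ev f = ev g ->
  forall m, pre_ideal q n f@_m.
Proof.
move=> hf hg fg m; have [h [hh gE]] := homog_split hg.
have Qi := pre_ideal_ideal q n; have [_ Qa Qm] := Qi.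
have Qq (i : 'I_n) := pre_ideal_mem q (ltn_ord i).
pose f' := f - \sum_(i < n) (q i)%:MP * h i.
have [||u [_ _ f'E]] := @form_relation d f'.
- apply: rpredB => //; apply: rpred_sum => i _; rewrite mul_mpolyC.
  exact: dhomogZ.
- rewrite mevalB fg gE (raddf_sum (meval (fun i : 'I_n => q i))) [X in _ - X]raddf_sum /= -sumrB big1 // => i _.
  by rewrite !mevalM mevalC mevalXU subrr.
rewrite -(subrK (\sum_(i < n) (q i)%:MP * h i) f) -/f' mcoeffD; apply: Qa.
  rewrite f'E raddf_sum; apply: ideal_sum => // i _.
  rewrite raddf_sum; apply: ideal_sum => // j _ /=.
  by rewrite mulrCA mcoeffCM mulrC; apply: Qm.
rewrite raddf_sum; apply: ideal_sum => // i _ /=.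
by rewrite mcoeffCM mulrC; apply: Qm.
Qed.

End QuasiRegular.

Section IdealPowers.
Variables (R : comNzRingType) (n : nat) (q : nat -> R).
Local Notation ev f := (f.@[fun i : 'I_n => q i]).
Local Notation Q := (pre_ideal q n).

Lemma ideal_pow_form d x :
  ideal_pow Q d x <-> exists2 f : {mpoly R[n]}, f \is d.-homog & x = ev f.
Proof.
elim: d x => [|d IH] x /=.
  split=> // _; exists x%:MP; last by rewrite mevalC.
  by rewrite -[x%:MP]mulr1 mul_mpolyC; apply: dhomogZ; apply: dhomog1.
split=> [[r [a [b [ab ->]]]]|[f /homog_split [g [hg ->]] ->]].
  have /choice [c cE] : forall i : 'I_r, exists c : nat -> R, a i = \sum_(j < n) c j * q j.
    by move=> i; case: (ab i).
  have /choice [f fE] : forall i : 'I_r, exists f : {mpoly R[n]}, f \is d.-homog /\ b i = ev f.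
    by move=> i; have [_ /IH [f]] := ab i; exists f.
  exists (\sum_i (\sum_(j < n) (c i j)%:MP * 'X_j) * f i).
    apply: rpred_sum => i _; rewrite -[d.+1]add1n; apply: dhomogM; last by case: (fE i).
    apply: rpred_sum => j _; rewrite mul_mpolyC; apply: dhomogZ.
    by rewrite dhomogX /= mdeg1.
  rewrite raddf_sum /=; apply: eq_bigr => i _; rewrite mevalM cE (fE i).2; congr (_ * _).
  by rewrite raddf_sum /=; apply: eq_bigr => j _; rewrite mevalM mevalC mevalXU.
exists n, (fun i => q i), (fun i => ev (g i)); split.
  move=> i; split; last by apply/IH; exists (g i).
  exact: pre_ideal_mem.
by rewrite raddf_sum /=; apply: eq_bigr => i _; rewrite mevalM mevalXU.
Qed.

End IdealPowers.

(** * Dimensions of subquotients *)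

Section Codimension.
Variables (k : fieldType) (V : lmodType k).
Implicit Types (I J H : set V) (n m : nat).

Definition free_mod I n (e : 'I_n -> V) :=
  forall c : 'I_n -> k, I (\sum_i c i *: e i) -> forall i, c i = 0.

Definition span_mod I J n (e : 'I_n -> V) :=
  forall x, J x -> exists c : 'I_n -> k, I (x - \sum_i c i *: e i).

(* J / I has dimension n over k. *)
Definition codim I J n :=
  exists e : 'I_n -> V, [/\ forall i, J (e i), free_mod I e & span_mod I J e].

Lemma submodule_sum J (T : Type) (r : seq T) (P : pred T) (F : T -> V) :
  is_submodule J -> (forall i, P i -> J (F i)) -> J (\sum_(i <- r | P i) F i).
Proof. by case=> J0 Ja _ JF; elim/big_rec: _ => // i x Pi; apply: Ja; apply: JF. Qed.

Lemma submoduleN J x : is_submodule J -> J x -> J (- x).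
Proof. by case=> _ _ Jm Jx; rewrite -scaleN1r; apply: Jm. Qed.

Lemma submoduleB J x y : is_submodule J -> J x -> J y -> J (x - y).
Proof. by move=> Js Jx Jy; case: (Js) => _ Ja _; apply/Ja => //; apply: submoduleN. Qed.

Lemma submodule_lin J n (e : 'I_n -> V) (c : 'I_n -> k) :
  is_submodule J -> (forall i, J (e i)) -> J (\sum_i c i *: e i).
Proof. by move=> Js Je; apply: submodule_sum => // i _; case: Js => _ _; apply. Qed.

(** With fewer spanning than free vectors the matrix of coordinates has a nonzero left kernel, and a
    row of it is a relation modulo [I]. *)
Lemma free_le_span I J n m (e : 'I_n -> V) (f : 'I_m -> V) : is_submodule I ->
  (forall i, J (e i)) -> free_mod I e -> span_mod I J f -> (n <= m)%N.
Proof.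
move=> Is Je fe sf; rewrite leqNgt; apply/negP => lt.
have /choice [A AP] : forall i, exists c : 'I_m -> k, I (e i - \sum_j c j *: f j).
  by move=> i; apply: sf.
pose M : 'M[k]_(n, m) := \matrix_(i, j) A i j.
have : (\rank M < n)%N by apply: leq_ltn_trans (rank_leq_col _) lt.
have [/eqP|[i /negP ri]] : kermx M = 0 \/ exists i, ~ (row i (kermx M) == 0).
    have [->|/rowV0Pn [v /submxP [u vE] v0]] := eqVneq (kermx M) 0; first by left.
    right; apply: contrapT => nex; case/eqP: v0; rewrite vE mulmx_sum_row.
    rewrite big1 // => i _; have [->|ne] := eqVneq (row i (kermx M)) 0; first by rewrite scaler0.
    by case: nex; exists i; apply/negP.
  by rewrite kermx_eq0 /row_free => /eqP ->; rewrite ltnn.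
move=> _; case/eqP: ri; apply/rowP => l; rewrite [RHS]mxE.
move: l; apply: (fe (fun l => row i (kermx M) 0 l)).
set v := row i (kermx M).
have vM : v *m M = 0 by rewrite -row_mul mulmx_ker row0.
have -> : \sum_l v 0 l *: e l = \sum_l v 0 l *: (e l - \sum_j A l j *: f j).
  under [RHS]eq_bigr do rewrite scalerBr scaler_sumr.
  rewrite sumrB exchange_big /= [X in _ - X]big1 ?subr0 // => j _.
  have := congr1 (fun B : 'rV_m => B 0 j) vM; rewrite !mxE => vj.
  under eq_bigr do rewrite scalerA; rewrite -scaler_suml -[RHS](scale0r (f j)).
  by congr (_ *: _); rewrite -[RHS]vj; apply: eq_bigr => l' _; rewrite !mxE.
by apply: submodule_sum => // j _; case: Is => _ _; apply; apply: AP.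
Qed.

Lemma codim_uniq I J n m : is_submodule I -> codim I J n -> codim I J m -> n = m.
Proof.
move=> Is [e [Je fe se]] [f [Jf ff sf]]; apply/eqP; rewrite eqn_leq.
by rewrite (free_le_span Is Je fe sf) (free_le_span Is Jf ff se).
Qed.

Lemma codim_refl I : is_submodule I -> codim I I 0.
Proof.
move=> Is; exists (fun=> 0); split; [by case: Is|by move=> c _ []|].
by move=> x Ix; exists (fun=> 0); rewrite big_ord0 subr0.
Qed.

Lemma free_cat I J n m (e : 'I_n -> V) (f : 'I_m -> V) : is_submodule J -> I `<=` J ->
  (forall i, J (e i)) -> free_mod I e -> free_mod J f ->
  free_mod I (fun i : 'I_(n + m) => match split i with inl j => e j | inr j => f j end).
Proof.
move=> Js IJ Je fe ff c; rewrite big_split_ord /=.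
under eq_bigr do rewrite (unsplitK (inl _)).
under [X in _ + X]eq_bigr do rewrite (unsplitK (inr _)).
move=> Ic; have cf : forall i, c (rshift n i) = 0.
  apply: ff; have := submoduleB Js (IJ _ Ic) (submodule_lin (fun i => c (lshift m i)) Js Je).
  by rewrite addrAC subrr add0r.
rewrite [X in _ + X]big1 ?addr0 in Ic; last by move=> i _; rewrite cf scale0r.
by move=> i; case: (split_ordP i) => j ->; [apply: (fe (fun i => c (lshift m i)))|apply: cf].
Qed.

Lemma codim_add I J H n m : is_submodule J -> I `<=` J -> J `<=` H ->
  codim I J n -> codim J H m -> codim I H (n + m).
Proof.
move=> Js IJ JH [e [Je fe se]] [f [Hf ff sf]].
exists (fun i : 'I_(n + m) => match split i with inl j => e j | inr j => f j end).
split; first by move=> i; case: splitP => j _; [apply: JH|].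
  exact: (free_cat Js).
move=> x /sf [d Jx]; have [c Ix] := se _ Jx.
exists (fun i => match split i with inl j => c j | inr j => d j end).
rewrite big_split_ord /=; under eq_bigr do rewrite (unsplitK (inl _)).
under [X in _ - (_ + X)]eq_bigr do rewrite (unsplitK (inr _)).
by rewrite opprD addrA addrAC.
Qed.

(** A free family of maximal size spans; the spanning family of the larger module bounds the
    sizes. *)
Lemma codim_exists I H m (f : 'I_m -> V) :
  is_submodule I -> is_submodule H -> span_mod I H f -> exists2 h, (h <= m)%N & codim I H h.
Proof.
move=> Is Hs sf.
pose P h := `[< exists e : 'I_h -> V, (forall i, H (e i)) /\ free_mod I e >].
have P0 : exists h, P h by exists 0%N; apply/asboolP; exists (fun=> 0); split; [case|move=> c _ []].
have Pm h : P h -> (h <= m)%N.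
  by move=> /asboolP [e [He fe]]; apply: free_le_span He fe sf.
case: (ex_maxnP P0 Pm) => h /asboolP [e [He fe]] hmax.
exists h; first by apply: Pm; apply/asboolP; exists e.
exists e; split => // x Hx; apply: contrapT => nex.
have : P (h + 1)%N; last by move/hmax; rewrite addn1 ltnn.
pose g (i : 'I_(h + 1)) := match split i with inl j => e j | inr _ => x end.
apply/asboolP; exists g; split; first by rewrite /g => i; case: splitP.
move=> c; rewrite big_split_ord /= big_ord1 /g.
under eq_bigr do rewrite (unsplitK (inl _)); rewrite (unsplitK (inr _)) => Ic.
have c0 : c (rshift h 0) = 0.
  apply: contrapT => /eqP c0; apply: nex.
  exists (fun i => - (c (rshift h 0))^-1 * c (lshift 1 i)).
  case: (Is) => _ _ /(_ (c (rshift h 0))^-1 _ Ic).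
  rewrite scalerDr scalerA mulVf // scale1r scaler_sumr addrC.
  by congr (I _); congr (_ + _); rewrite -sumrN; apply: eq_bigr => i _;
    rewrite mulNr scaleNr opprK scalerA.
rewrite c0 scale0r addr0 in Ic.
move=> i; case: (split_ordP i) => j ->; first by apply: (fe (fun i => c (lshift 1 i))).
by rewrite [j]ord1.
Qed.

Lemma codim_split I H J n : is_submodule I -> is_submodule H -> is_submodule J ->
  I `<=` H -> H `<=` J -> codim I J n ->
  exists h, [/\ (h <= n)%N, codim I H h & codim H J (n - h)].
Proof.
move=> Is Hs Js IH HJ cn; have [e [Je fe se]] := cn.
have [h hn ch] : exists2 h, (h <= n)%N & codim I H h.
  by apply: (codim_exists Is Hs (f := e)) => x /HJ; apply: se.
have [h' hn' ch'] : exists2 h, (h <= n)%N & codim H J h.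
  by apply: (codim_exists Hs Js (f := e)) => x /se [c Ic]; exists c; apply: IH.
exists h; split => //; suff <- : (h + h')%N = n by rewrite addKn.
by apply: (codim_uniq Is) cn; apply: codim_add ch ch'.
Qed.

Lemma codim_strict I H h : is_submodule H -> I `<` H -> codim I H h -> (0 < h)%N.
Proof.
move=> Hs [IH nHI]; case: h => // -[e [_ _ se]]; case: nHI => x /se [c].
by rewrite big_ord0 subr0.
Qed.

End Codimension.

(** * Powers of ideals, monomials, and length as dimension over the residue field *)

Section IdealProducts.
Variable R : comNzRingType.
Implicit Types I J K : set R.

Lemma ideal_mul_sub I J K : is_ideal K ->
  (forall a b, I a -> J b -> K (a * b)) -> ideal_mul I J `<=` K.
Proof.
by move=> Ki IJ _ [r [a [b [ab ->]]]]; apply: ideal_sum => // i _; apply: IJ; case: (ab i).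
Qed.

Lemma mem_ideal_mul I J a b : I a -> J b -> ideal_mul I J (a * b).
Proof. by move=> Ia Jb; exists 1%N, (fun=> a), (fun=> b); rewrite big_ord1. Qed.

Lemma ideal_mul_ideal I J : is_ideal J -> is_ideal (ideal_mul I J).
Proof.
case=> J0 Ja Jm; split.
- by exists 0%N, (fun=> 0), (fun=> 0); split; [case|rewrite big_ord0].
- move=> _ _ [r [a [b [ab ->]]]] [r' [a' [b' [ab' ->]]]].
  exists (r + r')%N, (fun i => match split i with inl j => a j | inr j => a' j end),
    (fun i => match split i with inl j => b j | inr j => b' j end).
  split; first by move=> i; case: splitP => j _; [apply: ab|apply: ab'].
  rewrite big_split_ord /=; under [in RHS]eq_bigr do rewrite (unsplitK (inl _)).
  by under [X in _ = _ + X]eq_bigr do rewrite (unsplitK (inr _)).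
move=> c _ [r [a [b [ab ->]]]]; exists r, a, (fun i => c * b i); split.
  by move=> i; case: (ab i) => ? ?; split=> //; apply: Jm.
by rewrite mulr_sumr; apply: eq_bigr => i _; rewrite mulrCA.
Qed.

Lemma ideal_mulS I I' J J' : I `<=` I' -> J `<=` J' -> ideal_mul I J `<=` ideal_mul I' J'.
Proof.
move=> II JJ _ [r [a [b [ab ->]]]]; exists r, a, b; split => // i.
by have [? ?] := ab i; split; [apply: II|apply: JJ].
Qed.

Lemma ideal_pow_ideal I n : is_ideal (ideal_pow I n).
Proof. by elim: n => [|n IH]; [apply: ideal_setT|apply: ideal_mul_ideal]. Qed.

Lemma ideal_powS I J n : I `<=` J -> ideal_pow I n `<=` ideal_pow J n.
Proof. by move=> IJ; elim: n => // n IH; apply: ideal_mulS. Qed.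

Lemma ideal_pow_add I a b : ideal_pow I (a + b) `<=` ideal_mul (ideal_pow I a) (ideal_pow I b).
Proof.
have Ii n := ideal_pow_ideal I n.
elim: a => [|a IH] x; first by move=> Ix; rewrite -[x]mul1r; apply: mem_ideal_mul.
apply: ideal_mul_sub; first exact: ideal_mul_ideal.
move=> u v Iu /IH [r [c [d [cd ->]]]].
rewrite mulr_sumr; apply: ideal_sum => [|i _]; first exact: ideal_mul_ideal.
have [? ?] := cd i; rewrite mulrA; apply: mem_ideal_mul => //.
exact: mem_ideal_mul.
Qed.

Lemma ideal_pow_dec I a b : (a <= b)%N -> ideal_pow I b `<=` ideal_pow I a.
Proof.
move=> /subnK <- x /ideal_pow_add; apply: ideal_mul_sub; first exact: ideal_pow_ideal.
by move=> u v _ Iv; have [_ _] := ideal_pow_ideal I a; apply.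
Qed.

Lemma ideal_pow_mul I J N n : ideal_pow I N `<=` J -> ideal_pow I (n * N) `<=` ideal_pow J n.
Proof.
move=> IJ; elim: n => // n IH; rewrite mulSn => x /ideal_pow_add.
exact: ideal_mulS.
Qed.

Lemma ideal_addP I J : is_ideal I -> is_ideal J ->
  is_ideal [set x | exists a b, [/\ I a, J b & x = a + b]].
Proof.
case=> I0 Ia Im [J0 Ja Jm]; split.
- by exists 0, 0; rewrite addr0.
- move=> _ _ [a [b [? ? ->]]] [c [d [? ? ->]]]; exists (a + c), (b + d).
  by split; [apply: Ia|apply: Ja|rewrite addrACA].
by move=> c _ [a [b [? ? ->]]]; exists (c * a), (c * b); split; [apply: Im|apply: Jm|rewrite mulrDr].
Qed.

End IdealProducts.

Section Monomials.
Variable n : nat.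

Definition mons d : finType := {m : 'X_{1..n < d.+1} | mdeg m == d}.
Definition mon d (t : mons d) : 'X_{1..n} := val (val t).

Lemma mdeg_mon d (t : mons d) : mdeg (mon t) = d.
Proof. exact/eqP/(valP t). Qed.

Lemma mon_inj d : injective (@mon d).
Proof. by move=> s t st; apply/val_inj/val_inj. Qed.

Lemma mon_ex d (m : 'X_{1..n}) : mdeg m = d -> exists t : mons d, mon t = m.
Proof.
move=> md; have lt : (mdeg m < d.+1)%N by rewrite md.
have md' : mdeg (BMultinom lt) == d by rewrite /= md.
by exists (Sub (BMultinom lt) md').
Qed.

Lemma homog_mons (R : comNzRingType) d (f : {mpoly R[n]}) :
  f \is d.-homog -> f = \sum_(t : mons d) f@_(mon t) *: 'X_[mon t].
Proof.
move=> hf; apply/mpolyP => m; rewrite raddf_sum /=.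
have [[t tm]|nex] := pselect (exists t : mons d, mon t = m).
  rewrite (bigD1 t) //= big1 ?addr0; first by rewrite mcoeffZ mcoeffX tm eqxx mulr1.
  move=> s st; rewrite mcoeffZ mcoeffX; case: eqP => [sm|]; last by rewrite mulr0.
  by case/eqP: st; apply: mon_inj; rewrite sm.
rewrite big1.
  by apply: (dhomog_nemf_coeff hf); apply/eqP => /= md; apply: nex; apply: mon_ex.
move=> s _; rewrite mcoeffZ mcoeffX; case: eqP => [sm|]; last by rewrite mulr0.
by case: nex; exists s.
Qed.

End Monomials.

Lemma card_mons n d : #|mons n.+1 d| = 'C(d + n, d).
Proof.
rewrite -size_basis cardE -(size_map (@mon n.+1 d)); apply/perm_size/uniq_perm.
- by rewrite map_inj_uniq ?enum_uniq //; apply: mon_inj.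
- exact: uniq_basis.
move=> m; rewrite -basis_cover; apply/mapP/eqP => [[t _ ->]|/mon_ex [t <-]]; first exact: mdeg_mon.
by exists t => //; rewrite mem_enum.
Qed.

Section FiniteFamilies.
Variables (k : fieldType) (V : lmodType k) (I J : set V) (T : finType) (e : T -> V).

Lemma span_mod_fin : (forall x, J x -> exists c : T -> k, I (x - \sum_t c t *: e t)) ->
  span_mod I J (fun i : 'I_#|T| => e (enum_val i)).
Proof.
move=> se x /se [c Ix]; exists (fun i => c (enum_val i)).
by rewrite (reindex _ (onW_bij _ (@enum_val_bij T))) /= in Ix.
Qed.

Lemma codim_fin : (forall t, J (e t)) ->
  (forall c : T -> k, I (\sum_t c t *: e t) -> forall t, c t = 0) ->
  (forall x, J x -> exists c : T -> k, I (x - \sum_t c t *: e t)) -> codim I J #|T|.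
Proof.
move=> Je fe se; exists (fun i => e (enum_val i)); split => //; last exact: span_mod_fin.
move=> c Ic i; rewrite -[i]enum_valK; apply: (fe (fun t => c (enum_rank t))).
rewrite (reindex _ (onW_bij _ (@enum_val_bij T))) /=.
by under eq_bigr do rewrite enum_valK.
Qed.

End FiniteFamilies.

(** A copy of [R] that remembers [i], to carry the structure of vector space over [k]. *)
Definition kmod (k : fieldType) (R : comNzRingType) (i : {rmorphism k -> R}) : Type := R.

Section KModule.
Variables (k : fieldType) (R : comNzRingType) (i : {rmorphism k -> R}).

HB.instance Definition _ := GRing.Zmodule.on (kmod i).

Definition kscale (a : k) (x : kmod i) : kmod i := i a * (x : R).

Fact kscaleA a b x : kscale a (kscale b x) = kscale (a * b) x.
Proof. by rewrite /kscale rmorphM mulrA. Qed.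
Fact kscale1 : left_id 1 kscale.
Proof. by move=> x; rewrite /kscale rmorph1 mul1r. Qed.
Fact kscaleDr : right_distributive kscale +%R.
Proof. by move=> a x y; rewrite /kscale mulrDr. Qed.
Fact kscaleDl x : {morph kscale^~ x : a b / a + b}.
Proof. by move=> a b; rewrite /kscale rmorphD mulrDl. Qed.

HB.instance Definition _ := GRing.Zmodule_isLmodule.Build k (kmod i)
  kscaleA kscale1 kscaleDr kscaleDl.

Lemma kscaleE a (x : kmod i) : a *: x = (i a * (x : R) : R).
Proof. by []. Qed.

Definition kcodim (I J : set R) n := @codim k (kmod i) I J n.

Lemma ideal_submodule (I : set R) : is_ideal I -> @is_submodule k (kmod i) I.
Proof. by case=> I0 Ia Im; split => // a x; apply: Im. Qed.

End KModule.

Section KLocalLength.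
Variables (k : fieldType) (R : comNzRingType) (i : {rmorphism k -> R}) (m : set R).
Hypotheses (mi : is_ideal m) (mk : forall x, exists a, m (x - i a)).

(** For the least t with m^t inside I, an x in m^(t-1) outside I is killed by m modulo I. As R = k +
    m, already I + k x is an ideal. *)
Lemma quotient_length_socle (I : set R) N : is_ideal I -> ideal_pow m N `<=` I ->
  I <> setT -> exists J, [/\ is_ideal J, I `<` J & kcodim i I J 1].
Proof.
move=> Ii mI IT; have [I0 Ia Im] := Ii.
have Pex : exists t, `[< ideal_pow m t `<=` I >] by exists N; apply/asboolP.
case: (ex_minnP Pex) => t /asboolP tI tmin.
case: t tI tmin => [|t] tI tmin.
  by case: IT; apply/seteqP; split => // x _; apply: tI.
have [x mx nIx] : exists2 x, ideal_pow m t x & ~ I x.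
  apply: contrapT => nex; suff /tmin : `[< ideal_pow m t `<=` I >] by rewrite ltnn.
  by apply/asboolP => x mx; apply: contrapT => nIx; apply: nex; exists x.
have mxI a : m a -> I (a * x) by move=> ma; apply/tI/mem_ideal_mul.
exists [set y | exists a, I (y - i a * x)]; split.
- split.
  + by exists 0; rewrite rmorph0 mul0r subr0.
  + move=> y z [a Iy] [b Iz]; exists (a + b).
    by rewrite rmorphD mulrDl opprD addrACA; apply: Ia.
  move=> c y [a Iy]; have [b mb] := mk c; exists (b * a).
  have -> : c * y - i (b * a) * x = c * (y - i a * x) + i a * ((c - i b) * x).
    by rewrite rmorphM mulrBr mulrBl mulrBr; rewrite [i a * (c * x)]mulrCA addrA subrK
      [i a * (i b * x)]mulrA [i a * i b]mulrC.
  by apply: Ia; [apply: Im|apply/Im/mxI].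
- split; first by move=> y Iy; exists 0; rewrite rmorph0 mul0r subr0.
  by move=> JI; apply/nIx/JI; exists 1; rewrite rmorph1 mul1r subrr.
exists (fun=> x); split.
- by move=> _; exists 1; rewrite rmorph1 mul1r subrr.
- move=> c; rewrite big_ord1 kscaleE => Ic j; rewrite [j]ord1.
  apply: contrapT => /eqP c0; apply: nIx.
  by rewrite -[x]mul1r -(rmorph1 i) -(mulVf c0) rmorphM -mulrA; apply: Im.
by move=> y [a Iy]; exists (fun=> a); rewrite big_ord1.
Qed.

(** Each strict inclusion costs at least one dimension over [k], and socle elements build a chain
    whose steps cost exactly one. *)
Lemma quotient_length_kcodim (I : set R) N l : is_ideal I -> ideal_pow m N `<=` I ->
  kcodim i I setT l -> quotient_length I l.
Proof.
move=> Ii mI cl; split; last first.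
  move=> n' C [CP Cs].
  have hP j h : (j <= n')%N -> kcodim i I (C j) h -> (j <= h)%N.
    elim: j h => // j IH h lt ch.
    have [Cji Ij] := CP _ (ltnW lt); have [Cji' Ij'] := CP _ lt.
    have [h' [hh c1 c2]] := codim_split (ideal_submodule i Ii) (ideal_submodule i Cji)
      (ideal_submodule i Cji') Ij (proj1 (Cs _ lt)) ch.
    have := codim_strict (ideal_submodule i Cji') (Cs _ lt) c2; rewrite subn_gt0.
    by apply: leq_ltn_trans; apply: IH c1; apply: ltnW.
  have [Cni In] := CP _ (leqnn n').
  have [h [hl ch _]] := codim_split (ideal_submodule i Ii) (ideal_submodule i Cni)
      (ideal_submodule i (ideal_setT R)) In (@subsetT _ _) cl.
  by apply: leq_trans hl; apply: hP ch.
elim: l I Ii mI cl => [|l IH] I Ii mI cl.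
  by exists (fun=> I); split => // j _; split.
have IT : I <> setT.
  move=> IT; suff : l.+1 = 0%N by [].
  apply: (codim_uniq (ideal_submodule i Ii) cl).
  by rewrite IT; apply/codim_refl/ideal_submodule/ideal_setT.
have [J [Ji IJ cJ]] := quotient_length_socle Ii mI IT.
have [|h [hl c1 c2]] := codim_split (ideal_submodule i Ii) (ideal_submodule i Ji)
  (ideal_submodule i (ideal_setT R)) (proj1 IJ) _ cl; first exact: subsetT.
have h1 : h = 1%N by apply: codim_uniq (ideal_submodule i Ii) c1 cJ.
rewrite h1 subn1 in c2.
have [C [CP Cs]] := IH _ Ji (subset_trans mI (proj1 IJ)) c2.
exists (fun j => if j is j'.+1 then C j' else I); split.
  move=> [|j] lt; first by split.
  by have [? ?] := CP _ lt; split => //; apply: subset_trans (proj1 IJ) _.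
move=> [|j] lt; last exact: Cs.
have [_ JC] := CP 0%N (leq0n l); case: IJ => IJ nJI; split; first exact: subset_trans JC.
by move=> CI; apply/nJI/(subset_trans JC).
Qed.

(** The monomials of degree d in the generators span m^d / m^(d+1) over [k], since coefficients only
    matter modulo m. *)
Lemma kcodim_ideal_pow r (q : nat -> R) d : m = pre_ideal q r ->
  exists l, kcodim i (ideal_pow m d) setT l.
Proof.
move=> mq; elim: d => [|d [l cl]].
  by exists 0%N; apply/codim_refl/ideal_submodule/ideal_setT.
have Ii n := ideal_pow_ideal m n.
pose g (t : mons r d) : kmod i := ('X_[mon t] : {mpoly R[r]}).@[fun i : 'I_r => q i].
have sp : @span_mod k (kmod i) (ideal_pow m d.+1) (ideal_pow m d) _
    (fun j : 'I_#|mons r d| => g (enum_val j)).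
  apply: span_mod_fin => x.
  rewrite {1}mq => /ideal_pow_form [f hf ->].
  have /choice [c cP] : forall t : mons r d, exists a, m (f@_(mon t) - i a) by [].
  exists c; rewrite {1}(homog_mons hf) raddf_sum /= -sumrB.
  apply: (@submodule_sum k (kmod i) _ _ _ _ _ (ideal_submodule i (Ii d.+1))) => t _.
  rewrite mevalZ kscaleE -mulrBl; apply: mem_ideal_mul => //.
  rewrite mq; apply/ideal_pow_form; exists 'X_[mon t] => //.
  by rewrite dhomogX; apply/eqP/mdeg_mon.
have [h _ ch] := codim_exists (ideal_submodule i (Ii d.+1)) (ideal_submodule i (Ii d)) sp.
exists (h + l)%N; apply: codim_add ch cl => //; first exact/ideal_submodule.
exact: ideal_pow_dec.
Qed.

Lemma kcodim_primary r (q : nat -> R) (I : set R) N : m = pre_ideal q r ->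
  is_ideal I -> ideal_pow m N `<=` I -> exists l, kcodim i I setT l.
Proof.
move=> mq Ii mI; have [l cl] := kcodim_ideal_pow N mq.
have [|h [hl c1 c2]] := codim_split (ideal_submodule i (ideal_pow_ideal m N))
  (ideal_submodule i Ii) (ideal_submodule i (ideal_setT R)) mI _ cl; first exact: subsetT.
by exists (l - h)%N.
Qed.

End KLocalLength.

(** * Hilbert functions *)

(* R has codimension 1 in the overring W = R + k z, and m z is contained in m. *)
Section HilbertFunction.
Variables (k : fieldType) (R W : comNzRingType) (i : {rmorphism k -> R}).
Variables (v : {rmorphism R -> W}) (m : set R) (z : W).
Hypotheses (v_inj : injective v) (mi : is_ideal m) (mk : forall x, exists a, m (x - i a)).
Hypothesis Wz : forall w, exists x a, w = v x + v (i a) * z.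
Hypothesis mz : forall x, m x -> exists2 y, m y & v x * z = v y.
Hypothesis zR : forall x, z <> v x.
Variables (n : nat) (q : nat -> R).
Hypothesis qm : forall j, (j < n.+1)%N -> m (q j).
Let qW j := v (q j).
Hypothesis syz : forall w : nat -> W, \sum_(j < n.+1) qW j * w j = 0 ->
  exists u : nat -> nat -> W,
  [/\ forall i, u i i = 0, forall i j, u i j = - u j i
    & forall i, (i < n.+1)%N -> w i = \sum_(j < n.+1) u i j * qW j].

Local Notation Q := (pre_ideal q n.+1).
Local Notation QW := (pre_ideal qW n.+1).
Local Notation ev f := (f.@[fun j : 'I_n.+1 => qW j]).
Local Notation evR f := (f.@[fun j : 'I_n.+1 => q j]).
Let iW : {rmorphism k -> W} := v \o i.
Local Notation dimW := (kcodim iW).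
Local Notation vim I := [set w | exists2 x, (I : set R) x & w = v x].

Let QWi d := ideal_pow_ideal QW d.

Lemma meval_mon_pow d (t : mons n.+1 d) : ideal_pow QW d (ev ('X_[mon t] : {mpoly W[n.+1]})).
Proof.
apply/ideal_pow_form; exists 'X_[mon t] => //.
by rewrite dhomogX; apply/eqP/mdeg_mon.
Qed.

Lemma dhomog_mons (T : comNzRingType) d (c : mons n.+1 d -> T) :
  \sum_t c t *: 'X_[mon t] \is d.-homog.
Proof.
apply: rpred_sum => t _; apply: dhomogZ; rewrite dhomogX; exact/eqP/mdeg_mon.
Qed.

Lemma mcoeff_mons (T : comNzRingType) d (c : mons n.+1 d -> T) s :
  (\sum_t c t *: 'X_[mon t])@_(mon s) = c s.
Proof.
rewrite raddf_sum /= (bigD1 s) //= mcoeffZ mcoeffX eqxx mulr1 big1 ?addr0 // => t ts.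
rewrite mcoeffZ mcoeffX; case: eqP => [/mon_inj tsE|]; last by rewrite mulr0.
by rewrite tsE eqxx in ts.
Qed.

Lemma meval_mons (T : comNzRingType) (x : 'I_n.+1 -> T) d (c : mons n.+1 d -> T) :
  (\sum_t c t *: 'X_[mon t]).@[x] = \sum_t c t * ('X_[mon t] : {mpoly T[n.+1]}).@[x].
Proof. by rewrite raddf_sum; apply: eq_bigr => t _; rewrite /= mevalZ. Qed.

Lemma vim_submodule (I : set R) : is_ideal I -> @is_submodule k (kmod iW) (vim I).
Proof.
case=> I0 Ia Im; split.
- by exists 0; rewrite ?rmorph0.
- by move=> _ _ [x Ix ->] [y Iy ->]; exists (x + y); rewrite ?rmorphD //; apply: Ia.
by move=> a _ [x Ix ->]; exists (i a * x); rewrite ?rmorphM //; apply: Im.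
Qed.

Lemma vim_kcodim (I : set R) l : kcodim i I setT l -> dimW (vim I) (vim setT) l.
Proof.
have lin (e : 'I_l -> R) (c : 'I_l -> k) :
    \sum_j c j *: (v (e j) : kmod iW) = v (\sum_j c j *: (e j : kmod i)).
  rewrite (rmorph_sum v); apply: eq_bigr => j _.
  by rewrite kscaleE [in RHS]kscaleE rmorphM.
case=> e [_ fe se]; exists (fun j => v (e j)); split.
- by move=> j; exists (e j).
- move=> c; rewrite lin => -[x Ix /v_inj xE]; apply: fe.
  by rewrite xE.
move=> _ [x _ ->]; have [c Ix] := se x Logic.I; exists c; rewrite lin.
by exists (x - \sum_j c j *: (e j : kmod i)) => //; rewrite rmorphB.
Qed.

Lemma kcodim_overring : dimW (vim setT) setT 1.
Proof.
exists (fun=> z); split => //.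
- move=> c; rewrite big_ord1 kscaleE => -[x _ cE] j; rewrite [j]ord1.
  apply: contrapT => /eqP c0; apply: (zR (x := i (c ord0)^-1 * x)).
  by rewrite rmorphM -cE mulrA -(rmorphM iW) mulVf // rmorph1 mul1r.
move=> w _; have [x [a ->]] := Wz w; exists (fun=> a).
by rewrite big_ord1 kscaleE addrK; exists x.
Qed.

(** Coefficients from W = R + k z do not lead out of m, because m z lies in m. *)
Lemma ideal_powW_m : QW `<=` vim m.
Proof.
move=> _ [c ->]; have Mi := vim_submodule mi.
apply: (submodule_sum (V := kmod iW) (J := vim m)) => // j _.
have [x [a ->]] := Wz (c j); have mq := qm (ltn_ord j).
have [y my yE] := mz mq.
exists (x * q j + i a * y); first by case: mi => _ Ma Mm; apply: Ma; apply: Mm.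
by rewrite mulrDl rmorphD !rmorphM -mulrA [z * _]mulrC yE.
Qed.

(** Quasi-regularity: the products of a monomial of degree d in [q] with a member of a basis of W /
    QW are a basis of Q^d W / Q^(d+1) W. *)
Lemma kcodim_powS e d : dimW QW setT e ->
  dimW (ideal_pow QW d.+1) (ideal_pow QW d) ('C(d + n, d) * e).
Proof.
case=> w [_ fw sw]; rewrite -card_mons -[e in (_ * e)%N]card_ord -card_prod.
pose b (t : mons n.+1 d * 'I_e) : kmod iW := ev ('X_[mon t.1] : {mpoly W[n.+1]}) * w t.2.
have bE (c : mons n.+1 d * 'I_e -> k) :
    \sum_t c t *: b t = ev (\sum_t (\sum_j c (t, j) *: w j : W) *: 'X_[mon t]).
  transitivity (\sum_t \sum_j c (t, j) *: b (t, j)).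
    by rewrite pair_bigA; apply: eq_bigr => -[].
  rewrite meval_mons.
  apply: eq_bigr => t _; rewrite mulr_suml; apply: eq_bigr => j _.
  by rewrite !kscaleE /b /= -mulrA; congr (_ * _); rewrite mulrC.
apply: (codim_fin (e := b)).
- by move=> t; rewrite /b mulrC; case: (QWi d) => _ _; apply; apply: meval_mon_pow.
- move=> c; rewrite bE => /ideal_pow_form [g hg gE] [t j].
  have := quasi_regular syz (dhomog_mons _) hg gE (mon t).
  by rewrite mcoeff_mons => /fw /(_ j).
move=> _ /ideal_pow_form [f hf ->].
have /choice [c cP] : forall t : mons n.+1 d, exists c : 'I_e -> k,
    QW (f@_(mon t) - (\sum_j c j *: w j : W)) by move=> t; apply: sw.
exists (fun t => c t.1 t.2); rewrite bE /= (homog_mons hf) !meval_mons -sumrB.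
apply: (@submodule_sum k (kmod iW) _ _ _ _ _ (ideal_submodule iW (QWi d.+1))) => t _.
rewrite -mulrBl.
by apply: mem_ideal_mul => //; apply: meval_mon_pow.
Qed.

Lemma kcodim_pow e d : dimW QW setT e ->
  dimW (ideal_pow QW d) setT (\sum_(j < d) 'C(j + n, j) * e)%N.
Proof.
move=> ce; elim: d => [|d IH].
  by rewrite big_ord0; apply/codim_refl/ideal_submodule/ideal_setT.
rewrite big_ord_recr /= [X in dimW _ _ X]addnC; apply: codim_add (kcodim_powS d ce) IH => //.
  exact: (ideal_submodule iW (ideal_pow_ideal QW d)).
exact: (ideal_pow_dec (a := d) (b := d.+1)).
Qed.

(** A basis is given by z times the monomials in [q]. A relation is a form with coefficients c_t z -
    r_t, r_t in R, vanishing at [q]; quasi-regularity puts them in QW, hence in m, and a nonzero c_t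
    would put z in R. *)
Lemma kcodim_vim_pow d :
  dimW (vim (ideal_pow Q d)) (ideal_pow QW d) 'C(d + n, d).
Proof.
rewrite -card_mons.
pose b (t : mons n.+1 d) : kmod iW := ev ('X_[mon t] : {mpoly W[n.+1]}) * z.
have bE (c : mons n.+1 d -> k) :
    \sum_t c t *: b t = ev (\sum_t (v (i (c t)) * z) *: 'X_[mon t]).
  rewrite meval_mons; apply: eq_bigr => t _.
  by rewrite kscaleE /b -mulrA; congr (_ * _); rewrite mulrC.
have evv (x : mons n.+1 d -> R) :
    v (evR (\sum_t x t *: 'X_[mon t])) = ev (\sum_t v (x t) *: 'X_[mon t]).
  rewrite !meval_mons rmorph_sum; apply: eq_bigr => t _ /=.
  rewrite rmorphM !mevalX rmorph_prod; congr (_ * _); apply: eq_bigr => j _.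
  by rewrite rmorphXn.
apply: (codim_fin (e := b)).
- by move=> t; rewrite /b mulrC; case: (QWi d) => _ _; apply; apply: meval_mon_pow.
- move=> c; rewrite bE => -[_ /ideal_pow_form [f hf ->]].
  rewrite (homog_mons hf) evv => fE t.
  have [y _] : vim m (v (i (c t)) * z - v f@_(mon t)).
    have := quasi_regular syz (dhomog_mons (fun t => v (i (c t)) * z - v f@_(mon t)))
      (dhomog0 _ _ _) _ (mon t); rewrite mcoeff_mons => h; apply/ideal_powW_m/h.
    rewrite meval0 meval_mons; under eq_bigr do rewrite mulrBl.
    by rewrite sumrB -!meval_mons fE subrr.
  move=> /(canRL (subrK _)); rewrite -rmorphD => cE.
  apply: contrapT => /eqP c0; apply: (zR (x := i (c t)^-1 * (y + f@_(mon t)))).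
  by rewrite rmorphM -cE mulrA -(rmorphM iW) mulVf // rmorph1 mul1r.
move=> _ /ideal_pow_form [f hf ->].
have /choice [x xP] : forall t : mons n.+1 d, exists x : R * k,
    f@_(mon t) = v x.1 + v (i x.2) * z.
  by move=> t; have [x [a E]] := Wz f@_(mon t); exists (x, a).
exists (fun t => (x t).2); rewrite bE (homog_mons hf) !meval_mons -sumrB.
exists (evR (\sum_t (x t).1 *: 'X_[mon t])).
  by apply/ideal_pow_form; exists (\sum_t (x t).1 *: 'X_[mon t]) => //; apply: dhomog_mons.
rewrite evv meval_mons; apply: eq_bigr => t _.
by rewrite -mulrBl xP addrK.
Qed.

(** The dimension of W / Q^(d+1) is counted through R and through Q^(d+1) W. The 1 on the left is
    the dimension of W / R, and [e] is that of W / QW. *)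
Lemma hilbert_function r (g : nat -> R) N : m = pre_ideal g r -> ideal_pow m N `<=` Q ->
  exists e, forall d, exists2 l, kcodim i (ideal_pow Q d.+1) setT l &
    (l + 1)%N = ('C(d.+1 + n, d.+1) + \sum_(j < d.+1) 'C(j + n, j) * e)%N.
Proof.
move=> mg mQ; have Ti := ideal_setT W.
have [e ce] : exists e, dimW QW setT e.
  have [l cl] := kcodim_primary mk mg (pre_ideal_ideal q n.+1) mQ.
  have c1 : dimW (vim Q) setT (l + 1).
    apply: codim_add (vim_kcodim cl) kcodim_overring => //.
      exact/vim_submodule/ideal_setT.
    by move=> _ [x _ ->]; exists x.
  have [||h [_ _ ch]] := codim_split (vim_submodule (pre_ideal_ideal q n.+1))
     (ideal_submodule iW (pre_ideal_ideal qW n.+1)) (ideal_submodule iW Ti) _ _ c1 => //.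
    move=> _ [_ [c ->] ->]; exists (fun j => v (c j)).
    by rewrite rmorph_sum; apply: eq_bigr => j _; rewrite rmorphM.
  by exists (l + 1 - h)%N.
exists e => d; have Qd := ideal_pow_ideal Q d.+1.
have [l cl] := kcodim_primary mk mg Qd (ideal_pow_mul (n := d.+1) mQ).
exists l => //; apply: (codim_uniq (vim_submodule Qd)).
  apply: codim_add (vim_kcodim cl) kcodim_overring => //.
    exact/vim_submodule/ideal_setT.
  by move=> _ [x _ ->]; exists x.
apply: codim_add (kcodim_vim_pow d.+1) (kcodim_pow d.+1 ce) => //.
  exact/ideal_submodule/ideal_pow_ideal.
move=> _ [_ /ideal_pow_form [f hf ->] ->]; apply/ideal_pow_form.
exists (map_mpoly v f).
  apply/dhomogP => u; rewrite mcoeff_msupp mcoeff_map_mpoly => vu.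
  move/dhomogP: hf; apply; rewrite mcoeff_msupp.
  by apply: contra vu => /eqP ->; rewrite raddf0.
rewrite (homog_mons hf) meval_mons (raddf_sum v) (raddf_sum (map_mpoly v)) raddf_sum.
apply: eq_bigr => t _ /=; rewrite rmorphM map_mpolyZ map_mpolyX mevalZ !mevalX rmorph_prod.
by congr (_ * _); apply: eq_bigr => j _; rewrite rmorphXn.
Qed.

End HilbertFunction.

(** * Krull dimension *)

Section ArtinRees.
Variables (R : comNzRingType) (r : nat) (g : nat -> R).
Hypothesis nR : noetherian R.
Local Notation m := (pre_ideal g r).
Local Notation ev f := (f.@[fun j : 'I_r => g j]).

Definition ideal_plus (I J : set R) : set R := [set x | exists a b, [/\ I a, J b & x = a + b]].

(** Artin-Rees for the principal ideal of x in the domain R / P: the forms whose value at the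
    generators of m lies in xR + P make up a homogeneous ideal, and [c] is the largest degree among
    its generators. *)
Lemma artin_rees_prime (P : set R) x : prime_ideal P -> ~ P x ->
  exists c, forall n y, ideal_plus P (ideal_pow m n) (x * y) ->
    ideal_plus P (ideal_pow m (n - c)) y.
Proof.
move=> [Pi P1 Pp] nPx; have [P0 Pa Pm] := Pi.
pose W d : set {mpoly R[r]} :=
  [set f | f \is d.-homog /\ exists w p, P p /\ ev f = x * w + p].
have [s [h [e [Wh Wg]]]] : exists s (h : 'I_s -> {mpoly R[r]}) (e : 'I_s -> nat),
    (forall i, W (e i) (h i)) /\
    forall d p, W d p -> exists g : 'I_s -> {mpoly R[r]},
      [/\ forall i, (e i <= d)%N -> g i \is (d - e i)%N.-homog,
          forall i, (d < e i)%N -> g i = 0 & p = \sum_i g i * h i].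
  apply: (noetherian_homog nR).
  - by move=> d p [].
  - by move=> d; split; [exact: dhomog0|exists 0, 0; rewrite meval0 mulr0 addr0].
  - move=> d p q [hp [w [a [Pa' pE]]]] [hq [w' [a' [Pa'' qE]]]].
    split; first exact: dhomogD.
    exists (w + w'), (a + a'); split; first exact: Pa.
    by rewrite mevalD pE qE mulrDr addrACA.
  move=> d d' p q hp [hq [w [a [Pa' qE]]]]; split; first exact: dhomogM.
  exists (ev p * w), (ev p * a); split; first exact: Pm.
  by rewrite mevalM qE mulrDr mulrCA.
exists (\max_(i < s) e i)%N => n y [p [u [Pp' mu xyE]]].
have [f hf uE] : exists2 f : {mpoly R[r]}, f \is n.-homog & u = ev f by apply/ideal_pow_form.
have Wf : W n f.
  by split => //; exists y, (- p); split; [exact: ideal_opp|rewrite -uE xyE addrC addKr].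
have [c [c1 c0 fE]] := Wg _ _ Wf.
have /choice [w wP] : forall i, exists w, P (ev (h i) - x * w).
  by move=> i; have [_ [w [a [? ->]]]] := Wh i; exists w; rewrite addrC addKr.
(* The generators [h i] evaluate to x w_i modulo P, so x y and x y' agree modulo P and x cancels. *)
pose y' := \sum_i ev (c i) * w i.
exists (y - y'), y'; split; last by rewrite subrK.
  have /Pp [] // : P (x * (y - y')).
  rewrite mulrBr xyE uE fE -addrA; apply: Pa => //.
  rewrite !raddf_sum /= mulr_sumr -sumrB; apply: ideal_sum => // i _.
  by rewrite mevalM mulrCA -mulrBr; apply: Pm.
have mi := ideal_pow_ideal m (n - \max_(i < s) e i)%N.
apply: ideal_sum => // i _; rewrite mulrC; case: (mi) => _ _; apply.
have [le|lt] := leqP (e i) n; last by rewrite c0 // meval0; case: mi.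
apply: (@ideal_pow_dec _ _ _ (n - e i)%N); first exact/leq_sub2l/leq_bigmax.
by apply/ideal_pow_form; exists (c i) => //; apply: c1.
Qed.

Section PrimeChains.
Variables (k : fieldType) (i : {rmorphism k -> R}).
Local Notation kfree I e := (@free_mod k (kmod i) I _ e).

(** The vectors x e_j vanish modulo P' and stay independent modulo P + m^n by the cancellation
    hypothesis, so the two families combine. *)
Lemma free_mod_prime (P P' : set R) c n h h' :
  prime_ideal P -> is_ideal P' -> P `<=` P' ->
  forall x, P' x ->
  (forall y, ideal_plus P (ideal_pow m n) (x * y) -> ideal_plus P (ideal_pow m c) y) ->
  (exists e : 'I_h -> kmod i, kfree (ideal_plus P (ideal_pow m c)) e) ->
  (exists e : 'I_h' -> kmod i, kfree (ideal_plus P' (ideal_pow m n)) e) ->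
  exists e : 'I_(h + h') -> kmod i, kfree (ideal_plus P (ideal_pow m n)) e.
Proof.
move=> [Pi _ _] Pi' PP x Px xP [e fe] [f ff].
exists (fun l : 'I_(h + h') => match split l with inl j => (x * e j : R) | inr j => f j end).
have mi := ideal_pow_ideal m n.
apply: (@free_cat k (kmod i) _ (ideal_plus P' (ideal_pow m n)) _ _ _ _ _ _ _ _ ff).
- exact/ideal_submodule/ideal_addP.
- by move=> _ [a [b [Pa mb ->]]]; exists a, b; split => //; apply: PP.
- move=> j; exists (x * e j), 0; split; rewrite ?addr0 //; last by case: mi.
  exact: ideal_mulr.
move=> d dP; apply: fe; apply: xP; rewrite mulr_sumr.
by under eq_bigr do rewrite [d _ *: e _]kscaleE mulrCA.
Qed.

(* Artin-Rees makes the dimension of R / (P_j + m^(c n)) grow like n^(s - j)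
   for a chain P_0 < ... < P_s. *)
Lemma prime_chain_growth s (C : nat -> set R) : strict_chain (@prime_ideal R) s C ->
  (C s `<=` m) -> ~ m 1 -> exists c, forall j n, (j <= s)%N ->
    exists e : 'I_(if n is n'.+1 then 'C(n' + j, j) else 0) -> kmod i,
      kfree (ideal_plus (C (s - j)%N) (ideal_pow m (n * c))) e.
Proof.
move=> [Cp Cs] Cm m1.
have /choice [x xP] : forall l, exists x, (l < s)%N -> C l.+1 x /\ ~ C l x.
  move=> l; have [lt|_] := ltnP l s; last by exists 0.
  have [_ nCC] := Cs _ lt; apply: contrapT => nex; apply: nCC => y Cy.
  by apply: contrapT => nCy; apply: nex; exists y.
have /choice [c cP] : forall l, exists c, (l < s)%N ->
    forall n y, ideal_plus (C l) (ideal_pow m n) (x l * y) ->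
    ideal_plus (C l) (ideal_pow m (n - c)) y.
  move=> l; have [lt|_] := ltnP l s; last by exists 0%N.
  have [_ nC] := xP _ lt.
  by have [c cP] := artin_rees_prime (Cp _ (ltnW lt)) nC; exists c.
(* [M] absorbs every Artin-Rees shift, and the successor keeps it positive, so that a positive power
   of m^M lies in m. *)
pose M := (\max_(l < s) c l)%N.+1; exists M.
have IHx I h h' (e : 'I_h' -> kmod i) : h = h' -> kfree I e ->
    exists e : 'I_h -> kmod i, kfree I e by move=> ->; exists e.
elim=> [|j IHj] n le.
  case: n => [|n]; first by exists (fun=> 0) => d _ [].
  apply: (IHx _ _ 1%N (fun=> 1)); first by rewrite bin0.
  move=> d; rewrite big_ord1 kscaleE mulr1 => -[a [b [Pa mb dE]]] l; rewrite [l]ord1.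
  apply: contrapT => /eqP d0; apply: m1.
  have mi := pre_ideal_ideal g r.
  rewrite -(rmorph1 i) -(mulVf d0) rmorphM dE; have [_ Ma Mm] := mi.
  apply/Mm/Ma; first by apply: Cm; rewrite subn0 in Pa.
  rewrite mulSn in mb; apply: (ideal_mul_sub mi) mb => u v mu _.
  exact: ideal_mulr.
(* Pascal's rule: the family for this prime at index [n] and the one for the next larger prime at
   index n + 1 are put together. *)
elim: n => [|n IHn]; first by exists (fun=> 0) => d _ [].
have lt : (s - j.+1 < s)%N by rewrite ltn_subrL (leq_trans _ le).
have [Cx nCx] := xP _ lt; have [Pi _ _] := Cp (s - j.+1)%N (ltnW lt).
have sj : (s - j.+1).+1 = (s - j)%N by rewrite subnSK.
rewrite sj in Cx; have [e fe] := IHn.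
have [f ff] := IHj n.+1 (ltnW le).
have [|||b fb] := free_mod_prime (c := (n * M)%N) (Cp _ (ltnW lt)) _ _ Cx _
    (ex_intro _ e fe) (ex_intro _ f ff).
- by have [] := Cp (s - j)%N (leq_subr _ _).
- by rewrite -sj; case: (Cs _ lt).
- move=> y /(cP _ lt) [a [u [Pa mu ->]]]; exists a, u; split => //.
  apply: ideal_pow_dec mu; rewrite mulSn addnC -addnBA ?leq_addr //.
  by apply: leq_trans (leqnSn _); rewrite (leq_bigmax (Ordinal lt)).
apply: IHx fb; case: n {e fe IHn f ff b} => [|n]; first by rewrite !add0n !binn.
by rewrite [in LHS]addSn binS [(n.+1 + j)%N]addSnnS.
Qed.

(** A chain of length d + 1 forces growth of degree d + 1 in n, against the bound of degree d. *)
Lemma prime_chain_bound d K : ~ m 1 -> (forall P, prime_ideal P -> P `<=` m) ->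
  (forall n h (e : 'I_h -> kmod i), kfree (ideal_pow m n) e -> (h <= K * n.+1 ^ d)%N) ->
  forall s C, strict_chain (@prime_ideal R) s C -> (s <= d)%N.
Proof.
move=> m1 Pm hK s C [Cp Cs]; rewrite leqNgt; apply/negP => lt.
have [||c cP] := @prime_chain_growth d.+1 C _ _ m1.
- by split => j le; [apply: Cp|apply: Cs]; apply: leq_trans lt.
- by apply/Pm/Cp.
have bound n : ('C(n + d.+1, d.+1) <= K * (n.+1 * c).+1 ^ d)%N.
  have [e fe] := cP d.+1 n.+1 (leqnn _).
  apply: (hK _ _ e) => b mb; apply: fe; exists 0, (\sum_i b i *: e i); split => //.
    by rewrite subnn; case: (Cp 0%N) => // -[].
  by rewrite add0r.
have ffact_ge n t : (n.+1 ^ t <= (n + t) ^_ t)%N.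
  elim: t => // t IH; rewrite addnS ffactnS expnS /= leq_mul //.
  by rewrite ltnS leq_addr.
(* With this [n] the upper bound times (d+1)! is at most n (n+1)^d, which is less than
   (n+1)^(d+1). *)
pose n := (K * (c.+1) ^ d * (d.+1)`!)%N.
have := bound n; rewrite leqNgt => /negP; apply.
rewrite -(ltn_pmul2r (fact_gt0 d.+1)) bin_ffact.
apply: leq_trans (ffact_ge n d.+1); rewrite expnS.
have le : ((n.+1 * c).+1 ^ d <= (c.+1 * n.+1) ^ d)%N.
  by case: (d) => // d'; rewrite leq_exp2r // [(n.+1 * c)%N]mulnC mulSn -add1n leq_add2r.
apply: (@leq_ltn_trans (n * n.+1 ^ d)); last by rewrite ltn_pmul2r // expn_gt0.
have aux b a f N X : (X <= a * N -> b * X * f <= b * a * f * N)%N.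
  move=> XN; rewrite -!mulnA leq_mul2l; apply/orP; right.
  by rewrite [(f * N)%N]mulnC mulnA leq_mul2r XN orbT.
by apply: aux; rewrite -expnMn.
Qed.

End PrimeChains.
End ArtinRees.

(** * The Hilbert polynomial and a criterion for the Buchsbaum property *)

Section BinomialSums.

Lemma sum_bin3 d : (\sum_(j < d) 'C(j + 3, j) = 'C(d + 3, 4))%N.
Proof.
elim: d => [|d IH]; first by rewrite big_ord0.
rewrite big_ord_recr /= IH addSn binS; congr (_ + _)%N.
by rewrite -{2}[d](addnK 3) bin_sub ?leq_addl.
Qed.

Lemma bin3_ffact d : ('C(d + 4, 3) * 6 = (d + 4) * (d + 3) * (d + 2))%N.
Proof.
by rewrite (bin_ffact (d + 4) 3) !ffactnS ffactn0 muln1 !addnS !addn0 /= mulnA.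
Qed.

Lemma bin4_ffact d : ('C(d + 4, 4) * 24 = (d + 4) * (d + 3) * (d + 2) * (d + 1))%N.
Proof.
by rewrite (bin_ffact (d + 4) 4) !ffactnS ffactn0 muln1 !addnS !addn0 /= !mulnA.
Qed.

End BinomialSums.

Section HilbertPolynomial.
Variable e : nat.
Local Notation lin a := ('X + (a%:R)%:P : {poly rat}).

(** The polynomial e binomial(X + 4, 4) + binomial(X + 4, 3) - 1. *)
Definition hilbert_poly : {poly rat} :=
  (e%:R / 24%:R) *: (lin 1 * lin 2 * lin 3 * lin 4)
  + 6%:R^-1 *: (lin 2 * lin 3 * lin 4) - 1.

Lemma size_lin a : size (lin a) = 2%N.
Proof. exact: size_XaddC. Qed.

Lemma monic_lin a : lin a \is monic.
Proof. exact: monicXaddC. Qed.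

Lemma hilbert_poly_size : (size hilbert_poly <= 5)%N /\ hilbert_poly`_4 = e%:R / (4`!)%:R.
Proof.
have s3 : size (lin 2 * lin 3 * lin 4) = 4%N.
  by rewrite !size_monicM ?monicMl ?monic_lin ?rpredM ?monic_lin -?size_poly_eq0 ?size_lin.
have s4 : size (lin 1 * lin 2 * lin 3 * lin 4) = 5%N.
  by rewrite !size_monicM ?monicMl ?monic_lin ?rpredM ?monic_lin -?size_poly_eq0 ?size_lin.
have m4 : lin 1 * lin 2 * lin 3 * lin 4 \is monic by rewrite !rpredM ?monic_lin.
split.
  rewrite /hilbert_poly (leq_trans (size_polyD _ _)) // size_polyN size_poly1 geq_max andbT.
  rewrite (leq_trans (size_polyD _ _)) // geq_max.
  by rewrite !(leq_trans (size_scale_leq _ _)) ?s3 ?s4.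
rewrite /hilbert_poly !coefB !coefD !coefZ coef1 subr0.
have -> : (lin 1 * lin 2 * lin 3 * lin 4 : {poly rat})`_4 = 1 by move/monicP: m4; rewrite /lead_coef s4.
by rewrite mulr1 [X in _ + _ * X]nth_default ?s3 // mulr0 addr0.
Qed.

Lemma hilbert_polyE d l : (l + 1 = 'C(d + 4, 3) + 'C(d + 4, 4) * e)%N ->
  hilbert_poly.[d%:R] = l%:R.
Proof.
move=> lE; rewrite /hilbert_poly !hornerE.
have h3 := congr1 (fun t => t%:R : rat) (bin3_ffact d).
have h4 := congr1 (fun t => t%:R : rat) (bin4_ffact d).
rewrite /= !natrM !natrD in h3 h4.
have /= := congr1 (fun t => t%:R : rat) lE; rewrite !natrD natrM => lE'.
have -> : l%:R = 'C(d + 4, 3)%:R + 'C(d + 4, 4)%:R * e%:R - 1 :> rat by rewrite -lE' addrK.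
have -> : 'C(d + 4, 3)%:R = 6%:R^-1 * ('C(d + 4, 3)%:R * 6%:R) :> rat.
  by rewrite mulrC mulfK.
have -> : 'C(d + 4, 4)%:R = 24%:R^-1 * ('C(d + 4, 4)%:R * 24%:R) :> rat.
  by rewrite mulrC mulfK.
rewrite h3 h4; ring.
Qed.

End HilbertPolynomial.

Section LocalRing.
Variables (R : comNzRingType) (m : set R).
Hypotheses (mi : is_ideal m) (m1 : ~ m 1).
Hypothesis mu : forall x, ~ m x -> exists y, x * y = 1.

Lemma proper_ideal_sub P : is_ideal P -> ~ P 1 -> P `<=` m.
Proof.
move=> Pi P1 x Px; apply: contrapT => /mu [y xy]; apply: P1.
by rewrite -xy; apply: ideal_mulr.
Qed.

Lemma local_at_units : local_at m.
Proof.
split.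
  split=> // J Ji mJ; have [J1|nJ1] := pselect (J 1).
    right; apply/seteqP; split => // x _; rewrite -[x]mulr1.
    by case: Ji => _ _; apply.
  by left; apply/seteqP; split => //; apply: proper_ideal_sub.
move=> P [Pi P1 Pmax]; have [//|mT] := Pmax _ mi (proper_ideal_sub Pi P1).
by case: m1; rewrite mT.
Qed.

End LocalRing.

Section BuchsbaumCriterion.
Variables (k : fieldType) (R W : comNzRingType) (i : {rmorphism k -> R}).
Variables (v : {rmorphism R -> W}) (m : set R) (z : W).
Hypotheses (v_inj : injective v) (nR : noetherian R) (mi : is_ideal m) (m1 : ~ m 1).
Hypothesis mu : forall x, ~ m x -> exists y, x * y = 1.
Hypothesis mk : forall x, exists a, m (x - i a).
Hypothesis Wz : forall w, exists x a, w = v x + v (i a) * z.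
Hypothesis mz : forall x, m x -> exists2 y, m y & v x * z = v y.
Hypothesis zR : forall x, z <> v x.
Variables (p : nat -> R) (N : nat) (C : nat -> set R).
Hypothesis pm : forall j, (j < 4)%N -> m (p j).
Hypothesis preg : forall j x, (j < 4)%N ->
  pre_ideal (v \o p) j (v (p j) * x) -> pre_ideal (v \o p) j x.
Hypothesis mp : ideal_pow m N `<=` pre_ideal p 4.
Hypothesis chC : strict_chain (@prime_ideal R) 4 C.

(** Each p_j is in m, so its power of exponent [n'] lies in (q); this is all that depth sensitivity
    asks for in passing from [p] to [q]. *)
Lemma parameter_hilbert (q : nat -> R) n' : (forall j, (j < 4)%N -> m (q j)) ->
  ideal_pow m n' `<=` pre_ideal q 4 ->
  exists e, forall d, exists2 l, kcodim i (ideal_pow (pre_ideal q 4) d.+1) setT l &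
    (l + 1 = 'C(d + 4, 3) + 'C(d + 4, 4) * e)%N.
Proof.
move=> qm mq; have [s ms] := nR mi.
have [w qw|e eP] := hilbert_function v_inj mi mk Wz mz zR qm _ (ms : m = pre_ideal (nth 0 s) _) mq.
  apply: (@koszul_syzygy W (v \o q) 4 (v \o p) w _ _ qw) => [j x|j lt]; first exact: preg.
  have : pre_ideal q 4 (p j ^+ n').
    apply: mq; elim: (n') => // t IH; rewrite exprS.
    by apply: mem_ideal_mul => //; apply: pm.
  case=> c cE; exists n', (fun j => v (c j)); rewrite -rmorphXn cE rmorph_sum.
  by apply: eq_bigr => j' _; rewrite rmorphM.
exists e => d; have [l cl lE] := eP d; exists l => //; rewrite lE.
rewrite -big_distrl /= sum_bin3 !addSnnS; congr (_ + _)%N.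
rewrite -[RHS]bin_sub; last by lia.
by have -> : (d + 4 - 3 = d.+1)%N by lia.
Qed.

(** The chain [C] gives one inequality. For the other, a family free modulo m^n is free modulo
    (p)^n, whose colength grows like n^4. *)
Lemma krull_dim4 : krull_dim R 4.
Proof.
split; first by exists C.
have [e eP] := parameter_hilbert pm mp.
have [s ms] := nR mi; pose g := nth 0 s; have {}ms : m = pre_ideal g (size s) := ms.
move=> n' C' Cc.
(* The constant comes from bounding both binomials of the Hilbert function by 4 (d + 2)^4. *)
apply: (@prime_chain_bound R (size s) g nR k i 4 (4 * (1 + e))%N) Cc; rewrite -?ms //.
  by move=> P [Pi P1 _]; apply: proper_ideal_sub mu _ Pi P1.
have mpi n : is_ideal (ideal_pow (pre_ideal p 4) n) := ideal_pow_ideal _ _.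
have pmm : pre_ideal p 4 `<=` m.
  by move=> _ [c ->]; apply: ideal_sum => // j _; case: mi => _ _; apply; apply: pm.
move=> n h f fm.
have fp : @free_mod k (kmod i) (ideal_pow (pre_ideal p 4) n) _ f.
  by move=> c pc; apply: fm; apply: (ideal_powS pmm).
case: n fm fp => [|d] fm fp.
  have [b [_ _ sb]] : kcodim i [set: R] setT 0.
    exact: (codim_refl (ideal_submodule i (ideal_setT R))).
  by apply: leq_trans (free_le_span (J := [set: kmod i]) (ideal_submodule i (ideal_setT R)) _ fp sb) _.
have [l [b [_ _ sb]] lE] := eP d.
apply: leq_trans (free_le_span (J := [set: kmod i]) (ideal_submodule i (mpi _)) _ fp sb) _ => //.
have h3 := bin3_ffact d; have h4 := bin4_ffact d.
have b3 : ('C(d + 4, 3) <= 4 * d.+2 ^ 4)%N by move: h3; rewrite !expnS expn0; nia.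
have b4 : ('C(d + 4, 4) <= 4 * d.+2 ^ 4)%N by move: h4; rewrite !expnS expn0; nia.
move: lE b3 b4; move: ('C(_, 3)) ('C(_, 4)) (d.+2 ^ 4)%N => x y t; nia.
Qed.

Theorem buchsbaum_criterion : buchsbaum_local R.
Proof.
split => //; exists m, 4%N; split; [exact: local_at_units|exact: krull_dim4|].
(* At d = 0 the Hilbert function reads l + 1 = 4 + e for every Q. *)
exists 3%:Z => Q [a [am QE [n' mQ]]].
pose q := nth 0 (a : seq R).
have {}QE : Q = pre_ideal q 4 by rewrite QE /ideal_gen size_tuple.
have qm j : (j < 4)%N -> m (q j) by move=> lt; apply/am/mem_nth; rewrite size_tuple.
rewrite QE in mQ; have Qi := pre_ideal_ideal q 4.
have [e eP] := parameter_hilbert qm mQ.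
have len d l : kcodim i (ideal_pow (pre_ideal q 4) d.+1) setT l ->
    quotient_length (ideal_pow (pre_ideal q 4) d.+1) l.
  apply: (quotient_length_kcodim mk) (ideal_pow_mul (n := d.+1) mQ).
  exact: ideal_pow_ideal.
have Q1 : ideal_pow (pre_ideal q 4) 1 = Q.
  rewrite QE; apply/seteqP; split => x.
    by apply: ideal_mul_sub => // b c Qb _; apply: ideal_mulr.
  by move=> Qx; rewrite -[x]mulr1; apply: mem_ideal_mul.
have [l cl lE] := eP 0%N; exists l, e; split.
- by rewrite -Q1; apply: len.
- exists (hilbert_poly e); have [? ?] := hilbert_poly_size e; split => //.
  exists 0%N => d _; have [l' cl' lE'] := eP d.
  by rewrite QE; exists l'; [apply: len|apply: hilbert_polyE].
have {}lE : (l = e + 3)%N by move: lE; rewrite (_ : 'C(0 + 4, 3) = 4)%N // (_ : 'C(0 + 4, 4) = 1)%N //; lia.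
by rewrite lE PoszD addrC addrA addNr add0r.
Qed.

End BuchsbaumCriterion.

(** * The integrally closed module *)

Section RingMorphismsMod.
Variables (A T : comNzRingType) (n : nat) (J : set T).
Hypothesis Ji : is_ideal J.

Lemma mpoly_morph_mod (f g : {rmorphism {mpoly A[n]} -> T}) :
  (forall a : A, J (f a%:MP - g a%:MP)) -> (forall i, J (f 'X_i - g 'X_i)) ->
  forall p, J (f p - g p).
Proof.
have [J0 Ja Jm] := Ji.
move=> JC JX; apply: mpoly_ring_ind => // p q Jp Jq.
  by rewrite !rmorphD opprD addrACA; apply: Ja.
have -> : f (p * q) - g (p * q) = f p * (f q - g q) + g q * (f p - g p) by rewrite !rmorphM; ring.
by apply: Ja; apply: Jm.
Qed.

End RingMorphismsMod.

Lemma mpoly_morph_eq (A T : comNzRingType) n (f g : {rmorphism {mpoly A[n]} -> T}) :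
  (forall a : A, f a%:MP = g a%:MP) -> (forall i, f 'X_i = g 'X_i) -> forall p, f p = g p.
Proof.
move=> fC fX p; apply/eqP; rewrite -subr_eq0; apply/eqP.
apply: (@mpoly_morph_mod _ _ _ [set 0]).
- by split=> [|x y -> ->|a x ->]; rewrite ?addr0 ?mulr0.
- by move=> a; rewrite fC subrr.
by move=> i; rewrite fX subrr.
Qed.

Section KillVariable.
Variables (n : nat) (R : comNzRingType) (j : 'I_n).
Local Notation A := (pseries n R).

Definition ps_kill (f : A) : A := PSeries (fun m => if m j == 0%N then pscoef f m else 0).

Fact ps_kill_additive : additive ps_kill.
Proof.
by move=> f g; apply: pseriesP => m /=; case: ifP => //; rewrite subrr.
Qed.
HB.instance Definition _ := GRing.isAdditive.Build A A ps_kill ps_kill_additive.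

Fact ps_kill_multiplicative : multiplicative ps_kill.
Proof.
split=> [f g|]; apply: pseriesP => m /=; last first.
  by case: (m =P 0%MM) => [->|_]; [rewrite mnm0E|case: ifP].
case: ifP => [/eqP mj|mj].
  apply: eq_bigr => l /eqP mE.
  have := congr1 (fun u : 'X_{1..n} => u j) mE; rewrite mj mnmDE => /esym/eqP.
  by rewrite addn_eq0 => /andP [-> ->].
rewrite big1 // => l /eqP mE; have := congr1 (fun u : 'X_{1..n} => u j) mE.
rewrite mnmDE => mjE; case: ifP => [/eqP l1|_]; last by rewrite mul0r.
case: ifP => [/eqP l2|_]; last by rewrite mulr0.
by rewrite mjE l1 l2 in mj.
Qed.
HB.instance Definition _ := GRing.isMultiplicative.Build A A ps_kill ps_kill_multiplicative.

Lemma ps_killK f : exists g, f - ps_kill f = psX R j * g.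
Proof.
exists (PSeries (fun m => pscoef f (m + U_(j))%MM)); apply: pseriesP => m.
rewrite pscoefXM pscoefD /=; case: (posnP (m j)) => [_|mj]; first by rewrite subrr.
rewrite subr0; congr pscoef; apply/mnmP => i.
by rewrite mnmDE mnmBE mnm1E; case: eqP => [<-|]; rewrite ?subnK // addn0 subn0.
Qed.

Lemma ps_kill_idem f : ps_kill (ps_kill f) = ps_kill f.
Proof. by apply: pseriesP => m /=; case: ifP => // ->. Qed.

Lemma ps_killX i : ps_kill (psX R i) = if i == j then 0 else psX R i.
Proof.
apply: pseriesP => m; have [->|ne] := eqVneq i j; rewrite /=.
  by case: (m =P U_(j)%MM) => [->|_]; [rewrite mnm1E eqxx|case: ifP].
case: (m =P U_(i)%MM) => [->|_]; last by case: ifP.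
by rewrite mnm1E (negbTE ne).
Qed.

End KillVariable.

Section RowSpan.
Variables (B : idomainType) (n : nat) (Phi : 'M[B]_n).

(** Quotients of B are represented by endomorphisms [th], congruence being equality of images; these
    images lie in the domain B, which allows cancellation. *)
Definition in_rowspan_mod (th : {rmorphism B -> B}) (w : 'rV[B]_n) :=
  exists v : 'rV[B]_n, map_mx th w = map_mx th (v *m Phi).

(** Here ker sg is ker th enlarged by y. If y w = v Phi modulo ker th, then v Phi vanishes modulo
    ker sg, hence so does v by injectivity; thus v is a multiple of y modulo ker th, and y
    cancels. *)
Lemma rowspan_regular (th sg : {rmorphism B -> B}) y w :
  (forall v : 'rV[B]_n, v *m map_mx sg Phi = 0 -> v = 0) ->
  (forall f, th f = 0 -> sg f = 0) -> sg y = 0 -> th y != 0 ->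
  (forall f, sg f = 0 -> exists g, th f = th (y * g)) ->
  in_rowspan_mod th (y *: w) -> in_rowspan_mod th w.
Proof.
move=> inj ths sy ty kers [v vE].
have sv : map_mx sg v = 0.
  apply: inj; rewrite -map_mxM /=; apply/rowP => j.
  have /rowP /(_ j) := vE; rewrite [in X in _ -> _ = X]mxE !mxE => /eqP.
  rewrite -subr_eq0 -rmorphB => /eqP /ths /eqP.
  by rewrite rmorphB subr_eq0 rmorphM sy mul0r => /eqP <-.
have /choice [u uP] : forall j, exists g, th (v 0 j) = th (y * g).
  by move=> j; apply: kers; move/rowP: sv => /(_ j); rewrite !mxE.
exists (\row_j u j); apply/rowP => j; apply: (mulfI ty); rewrite !mxE.
have /rowP /(_ j) := vE; rewrite !mxE rmorphM => ->.
rewrite !rmorph_sum mulr_sumr; apply: eq_bigr => l _.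
by rewrite !rmorphM uP !mxE rmorphM mulrA.
Qed.

End RowSpan.

Section Substitution.
Variables (A T : comNzRingType) (n : nat) (s : {rmorphism A -> T}) (t : 'I_n -> T).

(* Opaque, so that unification never unfolds the evaluation. *)
Lemma mpoly_morph_exists : {f : {rmorphism {mpoly A[n]} -> T} |
  (forall a : A, f a%:MP = s a) /\ (forall i, f 'X_i = t i)}.
Proof. by exists (mmap s t : {rmorphism _ -> _}); split => *; rewrite /= ?mmapC // mmapX mmap1U. Qed.

Definition mpoly_morph := sval mpoly_morph_exists.

Lemma mpoly_morphC a : mpoly_morph a%:MP = s a.
Proof. exact: (svalP mpoly_morph_exists).1. Qed.

Lemma mpoly_morphX i : mpoly_morph 'X_i = t i.
Proof. exact: (svalP mpoly_morph_exists).2. Qed.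

End Substitution.

Lemma sum_nat6 (V : nmodType) (F : nat -> V) :
  \sum_(0 <= l < 6) F l = F 0%N + F 1%N + F 2%N + F 3%N + F 4%N + F 5%N.
Proof. by rewrite 5?big_nat_recr //= big_nat1. Qed.

(** * The relation matrix and its cokernel *)

Section RelationMatrix.
Variables (B : comNzRingType) (x y T1 T2 T3 : B).
Local Notation co v l := (v 0 (inord l%N)).

(* Columns: 1, X^3 t1, X^2Y^2 t1, XY^4 t1, X^2Y^2 t2, XY^4 t2. *)
Definition rel_rows : seq (seq B) :=
  [:: [:: 0;            y ^+ 2; - x;    0;   0;      0  ];
      [:: 0;            0;      y ^+ 2; - x; 0;      0  ];
      [:: - (x * T1);   x;      0;      y;   0;      0  ];
      [:: - (y ^+ 2 * T2); 0;   0;      y;   x;      0  ];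
      [:: 0;            0;      0;      0;   y ^+ 2; - x];
      [:: - (x * T3);   0;      0;      0;   0;      y  ]].

Definition rel_mx : 'M[B]_6 := \matrix_(i < 6, j < 6) nth 0 (nth [::] rel_rows i) j.

Lemma row6P (v w : 'rV[B]_6) :
  [/\ co v 0 = co w 0, co v 1 = co w 1 & co v 2 = co w 2] ->
  [/\ co v 3 = co w 3, co v 4 = co w 4 & co v 5 = co w 5] -> v = w.
Proof.
move=> [h0 h1 h2] [h3 h4 h5]; apply/rowP => i; rewrite -[i]inord_val.
by case: i => [[|[|[|[|[|[|//]]]]]] lt].
Qed.

Lemma mul_rel_mx (v : 'rV[B]_6) (w := v *m rel_mx) :
  [/\ co w 0 = - (x * T1 * co v 2) - y ^+ 2 * T2 * co v 3 - x * T3 * co v 5,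
      co w 1 = y ^+ 2 * co v 0 + x * co v 2
    & co w 2 = - (x * co v 0) + y ^+ 2 * co v 1] /\
  [/\ co w 3 = - (x * co v 1) + y * co v 2 + y * co v 3,
      co w 4 = x * co v 3 + y ^+ 2 * co v 4
    & co w 5 = - (x * co v 4) + y * co v 5].
Proof.
have E j : (j < 6)%N -> co w j = \sum_(0 <= l < 6) co v l * nth 0 (nth [::] rel_rows l) j.
  move=> lt; rewrite big_mkord /w mxE; apply: eq_bigr => l _.
  by rewrite !mxE inord_val inordK.
by split; split; rewrite E // sum_nat6 /=; ring.
Qed.

Definition in_rel (w : 'rV[B]_6) := exists v : 'rV[B]_6, w = v *m rel_mx.

Lemma in_rel0 : in_rel 0.
Proof. by exists 0; rewrite mul0mx. Qed.

Lemma in_relD u w : in_rel u -> in_rel w -> in_rel (u + w).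
Proof. by move=> [a ->] [b ->]; exists (a + b); rewrite mulmxDl. Qed.

Lemma in_relZ b w : in_rel w -> in_rel (b *: w).
Proof. by move=> [a ->]; exists (b *: a); rewrite -scalemxAl. Qed.

Definition e6 (l : nat) : 'rV[B]_6 := delta_mx 0 (inord l).

Lemma coe6 l j : (l < 6)%N -> (j < 6)%N -> co (e6 l) j = (j == l)%:R.
Proof.
by move=> ll lj; rewrite mxE eqxx -val_eqE /= !inordK.
Qed.

Lemma row6_sum (w : 'rV[B]_6) : w = \sum_(0 <= l < 6) co w l *: e6 l.
Proof.
rewrite big_mkord {1}[w]row_sum_delta; apply: eq_bigr => i _.
by rewrite /e6 inord_val.
Qed.

Definition eqr (u w : 'rV[B]_6) := in_rel (u - w).

Lemma eqr_trans u v w : eqr u v -> eqr v w -> eqr u w.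
Proof. by move=> uv vw; rewrite /eqr -(subrK v u) -addrA; apply: in_relD. Qed.

Lemma eqrZ b u v : eqr u v -> eqr (b *: u) (b *: v).
Proof. by rewrite /eqr -scalerBr; apply: in_relZ. Qed.

Lemma eqrD u v u' v' : eqr u v -> eqr u' v' -> eqr (u + u') (v + v').
Proof. by rewrite /eqr opprD addrACA; apply: in_relD. Qed.

Lemma eqr_row l (u w : 'rV[B]_6) : (l < 6)%N -> u - w = row (inord l) rel_mx -> eqr u w.
Proof. by move=> _ E; exists (delta_mx 0 (inord l)); rewrite E rowE. Qed.

Lemma row_rel_mx l : (l < 6)%N ->
  row (inord l) rel_mx = \sum_(0 <= j < 6) nth 0 (nth [::] (rel_rows) l) j *: e6 j.
Proof.
move=> ll; rewrite [LHS]row6_sum !big_mkord; apply: eq_bigr => j _.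
by rewrite !mxE !inordK.
Qed.

(** Chaining the rows of the matrix: in the cokernel a power of y turns each of e_1, ..., e_5 into a
    multiple of e_0 with coefficient free of T1. The last relation trades x T1 e_0 for e_1 and
    e_3. *)
Lemma eqr_gens :
  [/\ eqr (y ^+ 8 *: e6 1) ((x ^+ 2 * (y ^+ 5 * T2 - x ^+ 3 * T3)) *: e6 0),
      eqr (y ^+ 6 *: e6 2) ((x * (y ^+ 5 * T2 - x ^+ 3 * T3)) *: e6 0)
    & eqr (y ^+ 4 *: e6 3) ((y ^+ 5 * T2 - x ^+ 3 * T3) *: e6 0)] /\
  [/\ eqr (y ^+ 3 *: e6 4) ((x ^+ 2 * T3) *: e6 0),
      eqr (y *: e6 5) ((x * T3) *: e6 0)
    & eqr ((x * T1) *: e6 0) (x *: e6 1 + y *: e6 3)].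
Proof.
have f5 : eqr (y *: e6 5) ((x * T3) *: e6 0).
  by apply: (@eqr_row 5) => //; rewrite row_rel_mx // sum_nat6 /= !(scale0r, add0r, addr0, scaleNr) addrC.
have f4 : eqr (y ^+ 3 *: e6 4) ((x ^+ 2 * T3) *: e6 0).
  have h : eqr (y ^+ 2 *: e6 4) (x *: e6 5).
    by apply: (@eqr_row 4) => //; rewrite row_rel_mx // sum_nat6 /= !(scale0r, add0r, addr0, scaleNr).
  move: (eqrZ y h) (eqrZ x f5); rewrite !scalerA -exprS [y * x]mulrC mulrA.
  exact: eqr_trans.
have f3 : eqr (y ^+ 4 *: e6 3) ((y ^+ 5 * T2 - x ^+ 3 * T3) *: e6 0).
  have h : eqr (y *: e6 3) ((y ^+ 2 * T2) *: e6 0 + (- x) *: e6 4).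
    apply: (@eqr_row 3) => //; rewrite row_rel_mx // sum_nat6 /= !(scale0r, add0r, addr0, scaleNr).
    by rewrite opprB [RHS]addrAC [RHS]addrC [- _ + _]addrC.
  have := eqrZ (y ^+ 3) h; rewrite scalerDr !scalerA -exprSr => h'; apply: (eqr_trans h').
  have -> : (y ^+ 5 * T2 - x ^+ 3 * T3) *: e6 0 =
     (y ^+ 3 * (y ^+ 2 * T2)) *: e6 0 + (- x) *: ((x ^+ 2 * T3) *: e6 0).
    by rewrite scalerA -scalerDl; congr (_ *: _); ring.
  apply: eqrD; first by rewrite /eqr subrr; apply: in_rel0.
  rewrite [_ * - x]mulrC -(scalerA (- x)); exact: eqrZ.
have f2 : eqr (y ^+ 6 *: e6 2) ((x * (y ^+ 5 * T2 - x ^+ 3 * T3)) *: e6 0).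
  have h : eqr (y ^+ 2 *: e6 2) (x *: e6 3).
    by apply: (@eqr_row 1) => //; rewrite row_rel_mx // sum_nat6 /= !(scale0r, add0r, addr0, scaleNr).
  move: (eqrZ (y ^+ 4) h) (eqrZ x f3); rewrite !scalerA -exprD [y ^+ 4 * x]mulrC.
  exact: eqr_trans.
have f1 : eqr (y ^+ 8 *: e6 1) ((x ^+ 2 * (y ^+ 5 * T2 - x ^+ 3 * T3)) *: e6 0).
  have h : eqr (y ^+ 2 *: e6 1) (x *: e6 2).
    by apply: (@eqr_row 0) => //; rewrite row_rel_mx // sum_nat6 /= !(scale0r, add0r, addr0, scaleNr).
  move: (eqrZ (y ^+ 6) h) (eqrZ x f2); rewrite !scalerA -exprD [y ^+ 6 * x]mulrC mulrA.
  exact: eqr_trans.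
do 2 split => //.
have h : eqr (x *: e6 1 + y *: e6 3) ((x * T1) *: e6 0).
  by apply: (@eqr_row 2) => //; rewrite row_rel_mx // sum_nat6 /= !(scale0r, add0r, addr0, scaleNr) -[RHS]addrA [RHS]addrC.
by move: (in_relZ (-1) h); rewrite scaleN1r opprB.
Qed.

End RelationMatrix.

Arguments e6 {B} l.

Lemma map_rel_mx (B B' : comNzRingType) (s : {rmorphism B -> B'}) (x y T1 T2 T3 : B) :
  map_mx s (rel_mx x y T1 T2 T3) = rel_mx (s x) (s y) (s T1) (s T2) (s T3).
Proof.
apply/matrixP => i j; rewrite !mxE.
have -> : rel_rows (s x) (s y) (s T1) (s T2) (s T3) = map (map s) (rel_rows x y T1 T2 T3).
  by rewrite /= !rmorph0 !rmorphN !rmorphXn !rmorphM.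
rewrite (nth_map [::]) //; pose r := nth [::] (rel_rows x y T1 T2 T3) i; rewrite -/r.
have [lt|le] := ltnP j (size r); first by rewrite (nth_map 0).
by rewrite !nth_default ?size_map // rmorph0.
Qed.

Section RelationMatrixDomain.
Variables (B : idomainType) (x y T1 T2 T3 : B) (v : 'rV[B]_6).
Local Notation co v l := (v 0 (inord l%N)).

(** This is the matrix modulo y, T1, T2 and T3 - x. Each column then involves a single coordinate of
    [v], multiplied by x or x^2 up to sign. *)
Lemma rel_mx_injx : x != 0 -> v *m rel_mx x 0 0 0 x = 0 -> v = 0.
Proof.
move=> x0 vM; have [[e0 e1 e2] [e3 e4 e5]] := mul_rel_mx x 0 0 0 x v.
rewrite vM !mxE in e0 e1 e2 e3 e4 e5.
have xz (b : B) : x * b = 0 -> b = 0 by move=> /eqP; rewrite mulf_eq0 (negbTE x0) => /eqP.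
apply: row6P; split; rewrite [in RHS]mxE; apply/xz.
- by rewrite -[LHS]opprK -[RHS]oppr0 [in RHS]e2; congr (- _); ring.
- by rewrite -[LHS]opprK -[RHS]oppr0 [in RHS]e3; congr (- _); ring.
- by rewrite [in RHS]e1; ring.
- by rewrite [in RHS]e4; ring.
- by rewrite -[LHS]opprK -[RHS]oppr0 [in RHS]e5; congr (- _); ring.
apply: xz; rewrite -[LHS]opprK -[RHS]oppr0 [in RHS]e0; congr (- _); ring.
Qed.

(** The matrix modulo x. The first column isolates coordinate 3; the others then follow one by
    one. *)
Lemma rel_mx_injy : y != 0 -> T2 != 0 -> v *m rel_mx 0 y T1 T2 T3 = 0 -> v = 0.
Proof.
move=> y0 T0 vM; have [[e0 e1 e2] [e3 e4 e5]] := mul_rel_mx 0 y T1 T2 T3 v.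
rewrite vM !mxE in e0 e1 e2 e3 e4 e5.
have yz (b : B) : y * b = 0 -> b = 0 by move=> /eqP; rewrite mulf_eq0 (negbTE y0) => /eqP.
have y2z (b : B) : y ^+ 2 * b = 0 -> b = 0 by rewrite expr2 -mulrA => /yz/yz.
have Tz (b : B) : T2 * b = 0 -> b = 0 by move=> /eqP; rewrite mulf_eq0 (negbTE T0) => /eqP.
have c3 : co v 3 = 0.
  by apply/Tz/y2z; rewrite -[LHS]opprK -[RHS]oppr0 [in RHS]e0; congr (- _); ring.
apply: row6P; split; rewrite [in RHS]mxE //.
- by apply: y2z; rewrite [in RHS]e1; ring.
- by apply: y2z; rewrite [in RHS]e2; ring.
- by apply: yz; rewrite [in RHS]e3 c3; ring.
- by apply: y2z; rewrite [in RHS]e4; ring.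
by apply: yz; rewrite [in RHS]e5; ring.
Qed.

End RelationMatrixDomain.

Section Reducibility.
Variables (B E : comNzRingType) (x y T1 T2 T3 : B) (mu : {rmorphism E -> B}).
Variables (X2 Y2 U V : E).
Hypotheses (mX : mu X2 = x) (mY : mu Y2 = y) (m2 : mu U = T2) (m3 : mu V = T3).
Hypothesis muT1 : forall P : B -> Prop, (forall a, P (mu a)) -> P T1 ->
  (forall a b, P a -> P b -> P (a + b)) -> (forall a b, P a -> P b -> P (a * b)) ->
  forall b, P b.
Local Notation co v l := (v 0 (inord l%N)).
Local Notation eqr := (eqr x y T1 T2 T3).

(** After a power of x y^8, the vector is a multiple of e_0 over the image of [mu], a subring that
    generates B together with T1. *)
Definition reducible (w : 'rV[B]_6) :=
  exists n h, eqr ((x * y ^+ 8) ^+ n *: w) (mu h *: e6 0).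

(** The point is T1: x y^8 T1 e_0 is again a multiple of e_0 over the image of [mu], so reducible
    vectors are stable under all of B, and [eqr_gens] provides the basis vectors. *)
Lemma reducible_all w : reducible w.
Proof.
have [[f1 f2 f3] [f4 f5 f6]] := eqr_gens x y T1 T2 T3.
have eqr_refl u : eqr u u by rewrite /eqr subrr; apply: in_rel0.
have mXY : mu (X2 * Y2 ^+ 8) = x * y ^+ 8 by rewrite rmorphM rmorphXn mX mY.
pose G := Y2 ^+ 5 * U - X2 ^+ 3 * V.
have mG : mu G = y ^+ 5 * T2 - x ^+ 3 * T3.
  by rewrite /G rmorphB (rmorphM mu _ U) (rmorphM mu _ V) !rmorphXn mX mY m2 m3.
have rD u v : reducible u -> reducible v -> reducible (u + v).
  move=> [n [h uh]] [n' [h' vh']]; exists (n + n')%N.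
  exists ((X2 * Y2 ^+ 8) ^+ n' * h + (X2 * Y2 ^+ 8) ^+ n * h').
  rewrite rmorphD (rmorphM mu _ h) (rmorphM mu _ h') !rmorphXn mXY scalerDr scalerDl.
  apply: eqrD; rewrite -[in X in eqr _ X]scalerA.
    by rewrite exprD mulrC -scalerA; apply: eqrZ.
  by rewrite exprD -scalerA; apply: eqrZ.
have rB b u : reducible u -> reducible (mu b *: u).
  move=> [n [h uh]]; exists n, (b * h); rewrite scalerA mulrC rmorphM -!scalerA.
  exact: eqrZ.
have T1e : exists h, eqr ((x * y ^+ 8) *: (T1 *: e6 0)) (mu h *: e6 0).
  (* The vector is y^8 (x e_1 + y e_3), and y^8 e_1 = x^2 G e_0 while y^4 e_3 = G e_0. *)
  exists (X2 ^+ 3 * G + Y2 ^+ 5 * G).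
  rewrite rmorphD (rmorphM mu _ G) (rmorphM mu _ G) !rmorphXn mX mY mG.
  have -> : (x * y ^+ 8) *: (T1 *: e6 0) = y ^+ 8 *: ((x * T1) *: e6 0).
    by rewrite !scalerA; congr (_ *: _); ring.
  apply: (eqr_trans (eqrZ _ f6)); rewrite scalerDr scalerDl; apply: eqrD.
    have := eqrZ x f1; rewrite !scalerA mulrA -exprS [y ^+ 8 * x]mulrC; apply.
  have := eqrZ (y ^+ 5) f3; rewrite !scalerA.
  by have -> : y ^+ 8 * y = y ^+ 5 * y ^+ 4 by ring.
have rT1 u : reducible u -> reducible (T1 *: u).
  have [h' T1h] := T1e; move=> [n [h uh]]; exists n.+1, (h * h').
  have -> : (x * y ^+ 8) ^+ n.+1 *: (T1 *: u) = ((x * y ^+ 8) * T1) *: ((x * y ^+ 8) ^+ n *: u).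
    by rewrite !scalerA; congr (_ *: _); rewrite exprS; ring.
  apply: (eqr_trans (eqrZ _ uh)).
  have -> : (x * y ^+ 8 * T1) *: (mu h *: e6 0) = mu h *: ((x * y ^+ 8) *: (T1 *: e6 0)).
    by rewrite !scalerA; congr (_ *: _); ring.
  by rewrite rmorphM -(scalerA (mu h)); apply: eqrZ.
have rall (b : B) u : reducible u -> reducible (b *: u).
  move: b u; apply: muT1 => [a u|u|p q IHp IHq u ru|p q IHp IHq u ru].
  - exact: rB.
  - exact: rT1.
  - by rewrite scalerDl; apply: rD; [apply: IHp|apply: IHq].
  by rewrite -scalerA; apply/IHp/IHq.
have re (b c : B) l h : x * y ^+ 8 = c * b -> eqr (b *: e6 l) (mu h *: e6 0) ->
    (exists c', c = mu c') -> reducible (e6 l).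
  move=> xyE bh [c' cE]; exists 1%N, (c' * h); rewrite expr1 xyE cE rmorphM -!(scalerA (mu c')).
  exact: eqrZ.
have mor_e : forall a b : nat, exists c', x ^+ a * y ^+ b = mu c'.
  by move=> a b; exists (X2 ^+ a * Y2 ^+ b); rewrite (rmorphM mu) !rmorphXn mX mY.
rewrite [w]row6_sum sum_nat6 /=; do ?apply/rD; apply/rall.
- by exists 0%N, 1; rewrite rmorph1 expr0; apply: eqr_refl.
- apply: (re (y ^+ 8) (x ^+ 1 * y ^+ 0) _ (X2 ^+ 2 * G)) => //; first by ring.
  by rewrite (rmorphM mu _ G) ?rmorphXn mX mG.
- apply: (re (y ^+ 6) (x ^+ 1 * y ^+ 2) _ (X2 * G)) => //; first by ring.
  by rewrite (rmorphM mu _ G) ?rmorphXn mX mG.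
- apply: (re (y ^+ 4) (x ^+ 1 * y ^+ 4) _ G) => //; first by ring.
  by rewrite mG.
- apply: (re (y ^+ 3) (x ^+ 1 * y ^+ 5) _ (X2 ^+ 2 * V)) => //; first by ring.
  by rewrite (rmorphM mu _ V) rmorphXn mX m3.
apply: (re y (x ^+ 1 * y ^+ 7) _ (X2 * V)) => //; first by ring.
by rewrite (rmorphM mu _ V) mX m3.
Qed.

End Reducibility.

Section Relations.
Variable k : fieldType.
Local Notation A := (Aring k).
Local Notation B := {mpoly A[3]}.
Local Notation x := ((Xvar k)%:MP : B).
Local Notation y := ((Yvar k)%:MP : B).
Local Notation o1 := (ord0 : 'I_3).
Local Notation o2 := (lift ord0 ord0 : 'I_3).
Local Notation o3 := (ord_max : 'I_3).
Local Notation T1 := ('X_o1 : B).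
Local Notation T2 := ('X_o2 : B).
Local Notation T3 := ('X_o3 : B).
Local Notation Phi := (rel_mx x y T1 T2 T3).
Local Notation in_rel := (in_rel x y T1 T2 T3).
Local Notation eqr := (eqr x y T1 T2 T3).
Local Notation co v l := (v 0 (inord l%N)).

Lemma det_neq0 n (M : 'M[B]_n) : (forall v : 'rV[B]_n, v *m M = 0 -> v = 0) -> \det M != 0.
Proof. by move=> inj; apply/det0P => -[v v0 /inj vE]; rewrite vE eqxx in v0. Qed.

Lemma det_inj n (M : 'M[B]_n) (v : 'rV[B]_n) : \det M != 0 -> v *m M = 0 -> v = 0.
Proof. by move=> d0 vM; apply/eqP; apply: contraNT d0 => v0; apply/det0P; exists v. Qed.

Definition red_coef (j : nat) : {rmorphism A -> A} :=
  if j is 0%N then idfun else ps_kill (ord_max : 'I_2).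

Definition red_var (j : nat) (i : 'I_3) : B :=
  if i == o1 then (if (1 < j)%N then 0 else T1)
  else if i == o2 then (if (2 < j)%N then 0 else T2)
  else (if (3 < j)%N then x else T3).

(* Reduction modulo the first j elements of the regular sequence. *)
Definition red j : {rmorphism B -> B} := mpoly_morph (@mpolyC 3 A \o red_coef j) (red_var j).

Definition reg_seq (j : nat) : B := nth 0 [:: y; T1; T2; T3 - x] j.

Lemma redx j : red j x = x.
Proof. by rewrite /red mpoly_morphC /=; case: j => [|j] //=; rewrite [ps_kill _ _]ps_killX. Qed.

Lemma redy j : red j y = if j is 0%N then y else 0.
Proof.
by rewrite /red mpoly_morphC /=; case: j => [|j] //=; rewrite [ps_kill _ _]ps_killX /= mpolyC0.
Qed.

Lemma redT i j : red j 'X_i = red_var j i.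
Proof. exact: mpoly_morphX. Qed.

Lemma red_coefK i j a : (i <= j)%N -> red_coef j (red_coef i a) = red_coef j a.
Proof. by case: i j => [|i] [|j] //= _; rewrite ps_kill_idem. Qed.

Lemma redK i j f : (i <= j)%N -> red j (red i f) = red j f.
Proof.
move=> ij; apply: (@mpoly_morph_eq A B 3 (red j \o red i) (red j)) => [a|l] /=.
  by rewrite /red !mpoly_morphC /= red_coefK.
rewrite !redT /red_var; case: eqP => [_|_]; last case: eqP => [_|_].
- by case: (ltnP 1 i) => h; rewrite ?redT // rmorph0 (leq_trans h).
- by case: (ltnP 2 i) => h; rewrite ?redT // rmorph0 (leq_trans h).
by case: (ltnP 3 i) => h; rewrite ?redT // redx (leq_trans h).
Qed.

Lemma red_reg_seq j : (j < 4)%N -> red j (reg_seq j) = reg_seq j /\ red j.+1 (reg_seq j) = 0.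
Proof.
case: j => [|[|[|[|//]]]] _; rewrite /reg_seq /= ?rmorphB ?redx ?redy ?redT //.
by rewrite subrr.
Qed.

Lemma reg_seq_neq0 j : (j < 4)%N -> reg_seq j != 0.
Proof.
have X0 i : ('X_i : B) != 0 by apply/eqP => /mpolyP /(_ U_(i)%MM) /eqP;
  rewrite mcoeffX eqxx mcoeff0 oner_eq0.
case: j => [|[|[|[|//]]]] _; rewrite /reg_seq /= ?X0 //.
  rewrite mpolyC_eq0; apply/eqP => /(congr1 (fun f => pscoef f U_(ord_max)%MM)) /=.
  by rewrite eqxx => /eqP; rewrite oner_eq0.
apply/eqP => /mpolyP /(_ U_(o3)%MM) /eqP.
rewrite mcoeffB mcoeffX mcoeffC eqxx mcoeff0 mnm1_eq0 mulr0 subr0.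
by rewrite oner_eq0.
Qed.

Lemma red_diff j f : (j < 4)%N -> exists g, red j f - red j.+1 f = reg_seq j * g.
Proof.
move=> lt; apply: (@mpoly_morph_mod _ _ _ [set b | exists g, b = reg_seq j * g]).
- split; first by exists 0; rewrite mulr0.
    by move=> _ _ [a ->] [b ->]; exists (a + b); rewrite mulrDr.
  by move=> c _ [a ->]; exists (c * a); rewrite mulrCA.
- move=> a; rewrite /red !mpoly_morphC /= -mpolyCB; case: j lt => [|j] _ /=.
    by have [g ->] := ps_killK (ord_max : 'I_2) a; exists g%:MP; rewrite mpolyCM.
  by exists 0; rewrite subrr mulr0.
move=> i; rewrite !redT /red_var.
have triv (b : B) : exists g, b - b = reg_seq j * g by exists 0; rewrite subrr mulr0.
case: eqP => [_|_]; last case: eqP => [_|_].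
- by case: j lt triv => [|[|[|[|//]]]] //= _ _; exists 1; rewrite subr0 mulr1.
- by case: j lt triv => [|[|[|[|//]]]] //= _ _; exists 1; rewrite subr0 mulr1.
by case: j lt triv => [|[|[|[|//]]]] //= _ _; exists 1; rewrite mulr1.
Qed.

Lemma x_neq0 : x != 0.
Proof.
rewrite mpolyC_eq0; apply/eqP => /(congr1 (fun f => pscoef f U_(ord0)%MM)) /=.
by rewrite eqxx => /eqP; rewrite oner_eq0.
Qed.

Lemma red4_det : red 4 (\det Phi) != 0.
Proof.
rewrite -det_map_mx map_rel_mx redx redy !redT.
by apply: det_neq0 => v; apply: rel_mx_injx; apply: x_neq0.
Qed.

(** Later reductions factor through earlier ones, so a determinant that vanished at stage j + 1
    would vanish at stage 4; [red4_det] thus gives injectivity at every stage. *)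
Lemma rel_regular j w : (j < 4)%N ->
  in_rowspan_mod Phi (red j) (reg_seq j *: w) -> in_rowspan_mod Phi (red j) w.
Proof.
move=> lt; have [rj rj1] := red_reg_seq lt.
apply: (rowspan_regular (sg := red j.+1)) => //.
- move=> v; apply: det_inj; rewrite det_map_mx; apply: contraNneq red4_det => d0.
  by rewrite -(redK (i := j.+1)) // d0 rmorph0.
- by move=> f f0; rewrite -(redK f (leqnSn j)) f0 rmorph0.
- by rewrite rj; apply: reg_seq_neq0.
move=> f f0; have [g gE] := red_diff f lt; exists g.
by rewrite f0 subr0 in gE; rewrite -gE redK.
Qed.

Lemma red0 b : red 0 b = b.
Proof.
apply: (@mpoly_morph_eq _ _ _ (red 0) idfun) => [a|i]; first by rewrite /red mpoly_morphC /=.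
rewrite redT /red_var /=; case: eqP => [->|n1] //; case: eqP => [->|n2] //.
by congr 'X_[U_(_)]; apply: val_inj; case: i n1 n2 => [[|[|[|//]]]] lt n1 n2 //;
  [case: n1|case: n2]; apply: val_inj.
Qed.

Lemma in_rel_mod0 w : in_rel w <-> in_rowspan_mod Phi (red 0) w.
Proof.
have mred0 (v : 'rV[B]_6) : map_mx (red 0) v = v by apply/rowP => i; rewrite mxE red0.
by split=> -[v vE]; exists v; rewrite !mred0 in vE *.
Qed.

Lemma in_rel_scaley w : in_rel (y *: w) -> in_rel w.
Proof. by move=> /in_rel_mod0 h; apply/in_rel_mod0/(@rel_regular 0). Qed.

(** x is outside the regular sequence, so the argument is repeated with the reduction [sg] that sets
    x to 0 and [rel_mx_injy]. *)
Lemma in_rel_scalex w : in_rel (x *: w) -> in_rel w.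
Proof.
have mid (v : 'rV[B]_6) : map_mx (idfun : {rmorphism B -> B}) v = v by apply/rowP => i; rewrite mxE.
pose sg : {rmorphism B -> B} := mpoly_morph (@mpolyC 3 A \o ps_kill (ord0 : 'I_2)) (fun i => 'X_i).
have sx : sg x = 0 by rewrite /sg mpoly_morphC /= [ps_kill _ _]ps_killX mpolyC0.
have sy : sg y = y by rewrite /sg mpoly_morphC /= [ps_kill _ _]ps_killX.
have sT i : sg 'X_i = 'X_i by rewrite /sg mpoly_morphX.
case=> v vE; have [||||||u] := @rowspan_regular _ _ Phi idfun sg x w.
- move=> u; rewrite map_rel_mx sx sy !sT; apply: rel_mx_injy.
    exact: (@reg_seq_neq0 0).
  exact: (@reg_seq_neq0 2).
- by move=> f /= ->; rewrite rmorph0.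
- by [].
- exact: x_neq0.
- move=> f f0 /=.
  have [g gE] : exists g, f - sg f = x * g.
    apply: (@mpoly_morph_mod _ _ _ [set b | exists g, b = x * g] _ idfun sg) => [|a|i].
    + split; first by exists 0; rewrite mulr0.
        by move=> _ _ [a ->] [b ->]; exists (a + b); rewrite mulrDr.
      by move=> c _ [a ->]; exists (c * a); rewrite mulrCA.
    + have [g gE] := ps_killK (ord0 : 'I_2) a; exists g%:MP.
      by rewrite /sg mpoly_morphC /= -mpolyCB gE mpolyCM.
    by exists 0; rewrite sT subrr mulr0.
  by exists g; rewrite -gE f0 subr0.
- by exists v; rewrite !mid.
by move=> uE; exists u; rewrite -(mid w) uE; apply: mid.
Qed.

(** The inclusion of A[T2, T3] in B; T1 is left out because u_1, u_2, u_3 are algebraically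
    dependent over A. *)
Definition B2_mor : {rmorphism {mpoly A[2]} -> B} :=
  mpoly_morph (@mpolyC 3 A) (fun i : 'I_2 => if i == ord0 then T2 else T3).

Lemma B2_morC a : B2_mor a%:MP = a%:MP.
Proof. exact: mpoly_morphC. Qed.

Lemma B2_morT : B2_mor 'X_ord0 = T2 /\ B2_mor 'X_ord_max = T3.
Proof. by rewrite /B2_mor !mpoly_morphX. Qed.

Lemma B2_mor_gen (P : B -> Prop) : (forall a, P (B2_mor a)) -> P T1 ->
  (forall a b, P a -> P b -> P (a + b)) -> (forall a b, P a -> P b -> P (a * b)) ->
  forall b, P b.
Proof.
move=> Pa P1 PD PM; have [m2 m3] := B2_morT; apply: mpoly_ring_ind => // [a|i].
  by rewrite -B2_morC.
case: (eqVneq i o1) => [-> //|n1]; case: (eqVneq i o2) => [->|n2]; first by rewrite -m2.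
have -> : i = o3; last by rewrite -m3.
by apply: val_inj; case: i n1 n2 => [[|[|[|//]]]] lt n1 n2.
Qed.

Lemma in_rel_reducible w :
  exists n h, in_rel ((x * y ^+ 8) ^+ n *: w - B2_mor h *: e6 0).
Proof.
have [m2 m3] := B2_morT.
exact: (reducible_all (B2_morC _) (B2_morC _) m2 m3 B2_mor_gen w).
Qed.

Lemma in_rel_cancel n w : in_rel ((x * y ^+ 8) ^+ n *: w) -> in_rel w.
Proof.
have hy u j : in_rel (y ^+ j *: u) -> in_rel u.
  elim: j u => [|j IH] u; first by rewrite scale1r.
  by rewrite exprSr -scalerA => /IH /in_rel_scaley.
elim: n w => [|n IH] w; first by rewrite scale1r.
rewrite exprSr -scalerA => /IH; rewrite -scalerA => /in_rel_scalex.
exact: hy.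
Qed.

End Relations.

(** * The multiplication table of the larger Rees algebra *)

Section MultiplicationTable.
Variables (C : comNzRingType) (x y t1 t2 : C).

Definition alg_basis (l : nat) : C :=
  nth 0 [:: 1; x ^+ 3 * t1; x ^+ 2 * y ^+ 2 * t1; x * y ^+ 4 * t1;
            x ^+ 2 * y ^+ 2 * t2; x * y ^+ 4 * t2] l.

(* The u_i generate a minimal reduction of M. *)
Definition red_u1 : C := x ^+ 3 * t1 + y ^+ 5 * t1.
Definition red_u2 : C := x * y ^+ 3 * t1 + x ^+ 3 * t2.
Definition red_u3 : C := y ^+ 5 * t2.

Local Notation w := alg_basis.
Local Notation u1 := red_u1.
Local Notation u2 := red_u2.
Local Notation u3 := red_u3.

(** The tables keep a factor u_1, u_2, u_3 or y in every term. They thus serve both to close the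
    span under products and to place products in the parameter ideal. *)
Lemma alg_table1 :
  [/\ w 1 * w 1 = u1 * w 1 - u2 * w 2 + u1 * w 4 - u3 * w 2,
      w 1 * w 2 = u1 * w 2 - u2 * w 3 + u1 * w 5 - u3 * w 3,
      w 1 * w 3 = u1 * w 3 - y * u2 * u1 + y * u2 * w 1 + y * u3 * w 1,
      w 1 * w 4 = u1 * w 4 - u3 * w 2
    & w 1 * w 5 = u1 * w 5 - u3 * w 3].
Proof. by rewrite /w /= /u1 /u2 /u3; split; ring. Qed.

Lemma alg_table2 :
  [/\ w 2 * w 2 = w 1 * w 3,
      w 2 * w 3 = y * u2 * w 2 - y * u1 * w 4 + y * u3 * w 2,
      w 2 * w 4 = u1 * w 5 - u3 * w 3
    & w 2 * w 5 = y * u3 * w 1].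
Proof. by rewrite /w /= /u1 /u2 /u3; split; ring. Qed.

Lemma alg_table3 :
  [/\ w 3 * w 3 = y * u2 * w 3 - y * u1 * w 5 + y * u3 * w 3,
      w 3 * w 4 = y * u3 * w 1
    & w 3 * w 5 = y * u3 * w 2].
Proof. by rewrite /w /= /u1 /u2 /u3; split; ring. Qed.

Lemma alg_table4 :
  [/\ w 4 * w 4 = u2 * w 5 - u3 * w 2,
      w 4 * w 5 = y * u3 * u2 - u3 * w 3
    & w 5 * w 5 = y * u3 * w 4].
Proof. by rewrite /w /= /u1 /u2 /u3; split; ring. Qed.

(** The last parameter u_3 - x only identifies u_3 with x, so products with x need relations of
    their own. *)
Lemma alg_tablex :
  [/\ x * w 1 = x * u1 - y * w 3, x * w 2 = y ^+ 2 * w 1 & x * w 3 = y ^+ 2 * w 2] /\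
  [/\ x * w 4 = y ^+ 2 * u2 - y * w 3, x * w 5 = y ^+ 2 * w 4 & x * x = y * w 5 - x * (u3 - x)].
Proof. by rewrite /w /= /u1 /u2 /u3; do 2 split; ring. Qed.

Lemma rel_mx_basis (v : 'rV[C]_6) :
  \sum_(0 <= l < 6) (v *m rel_mx x y u1 u2 u3) 0 (inord l) * w l = 0.
Proof.
rewrite sum_nat6; have [[-> -> ->] [-> -> ->]] := mul_rel_mx x y u1 u2 u3 v.
by rewrite /w /= /u1 /u2 /u3; ring.
Qed.

Variables (B : comNzRingType) (phi : {rmorphism B -> C}).
Hypotheses (xB : exists b, phi b = x) (yB : exists b, phi b = y).
Hypotheses (u1B : exists b, phi b = u1) (u2B : exists b, phi b = u2)
  (u3B : exists b, phi b = u3).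

Definition alg_elt (v : 'rV[B]_6) : C := \sum_(0 <= l < 6) phi (v 0 (inord l)) * w l.
Definition span_alg : set C := [set s | exists v, s = alg_elt v].
Local Notation T := span_alg.

Lemma span_alg_elt v : T (alg_elt v).
Proof. exact: (ex_intro _ v erefl). Qed.

Lemma alg_eltD u v : alg_elt (u + v) = alg_elt u + alg_elt v.
Proof. by rewrite -big_split; apply: eq_bigr => l _; rewrite mxE rmorphD mulrDl. Qed.

Lemma alg_eltZ b v : alg_elt (b *: v) = phi b * alg_elt v.
Proof. by rewrite /alg_elt mulr_sumr; apply: eq_bigr => l _; rewrite mxE rmorphM mulrA. Qed.

Lemma alg_elt0 : alg_elt 0 = 0.
Proof. by rewrite -(scale0r (0 : 'rV[B]_6)) alg_eltZ rmorph0 mul0r. Qed.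

Lemma alg_elt_base l : (l < 6)%N -> alg_elt (e6 l) = w l.
Proof.
move=> lt; rewrite /alg_elt big_mkord (bigD1 (Ordinal lt)) //= big1 ?addr0.
  by rewrite coe6 // eqxx rmorph1 mul1r.
move=> i; rewrite -val_eqE /= => /negbTE ne.
by rewrite coe6 // ne rmorph0 mul0r.
Qed.

Lemma span_algD s t : T s -> T t -> T (s + t).
Proof. by move=> [u ->] [v ->]; exists (u + v); rewrite alg_eltD. Qed.

Lemma span_algZ c s : (exists b, phi b = c) -> T s -> T (c * s).
Proof. by move=> [b <-] [v ->]; exists (b *: v); rewrite alg_eltZ. Qed.

Lemma span_alg_base l : (l < 6)%N -> T (w l).
Proof. by move=> lt; exists (e6 l); rewrite alg_elt_base. Qed.

Lemma span_algN s : T s -> T (- s).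
Proof. by move=> Ts; rewrite -mulN1r; apply: span_algZ => //; exists (-1); rewrite rmorphN1. Qed.

Lemma span_algB s t : T s -> T t -> T (s - t).
Proof. by move=> Ts Tt; apply/span_algD/span_algN. Qed.

Lemma phi_mul c d : (exists b, phi b = c) -> (exists b, phi b = d) -> exists b, phi b = c * d.
Proof. by move=> [a <-] [b <-]; exists (a * b); rewrite rmorphM. Qed.

Lemma span_alg_phi c : (exists b, phi b = c) -> T c.
Proof. by move=> cB; rewrite -[c]mulr1; apply: (span_algZ cB (@span_alg_base 0 isT)). Qed.

Lemma span_alg_table i j : (i < 6)%N -> (j < 6)%N -> T (w i * w j).
Proof.
wlog ij : i j / (i <= j)%N.
  move=> W; have [/W //|/ltnW ji] := leqP i j.
  by move=> li lj; rewrite mulrC; apply: W.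
have [p11 p12 p13 p14 p15] := alg_table1; have [p22 p23 p24 p25] := alg_table2.
have [p33 p34 p35] := alg_table3; have [p44 p45 p55] := alg_table4.
have Tb := span_alg_base.
have aux : forall c l, (exists b, phi b = c) -> (l < 6)%N -> T (c * w l).
  by move=> c l cB lt; apply: span_algZ cB (Tb l lt).
case: i ij => [_ _ lj|i ij li lj]; first by rewrite mul1r; apply: Tb.
case: i ij li => [|[|[|[|[|//]]]]]; case: j lj => [|[|[|[|[|[|//]]]]]] // _ _ _;
  rewrite ?p11 ?p12 ?p13 ?p14 ?p15 ?p22 ?p13 ?p23 ?p24 ?p25 ?p33 ?p34 ?p35 ?p44 ?p45 ?p55;
  do ?[apply: span_algB|apply: span_algD]; do ?[by apply/aux => //; do ?[assumption|apply: phi_mul]];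
  by apply: span_alg_phi; do ?[assumption|apply: phi_mul].
Qed.

Lemma span_algM s t : T s -> T t -> T (s * t).
Proof.
have aux F : (forall l, (l < 6)%N -> T (F l)) -> T (\sum_(0 <= l < 6) F l).
  by move=> TF; rewrite sum_nat6; do ?apply: span_algD; apply: TF.
move=> [u ->] [v ->]; rewrite /alg_elt mulr_suml; apply/aux => l ll.
rewrite -mulrA mulr_sumr; apply: span_algZ; first by eexists.
apply: aux => j lj; rewrite mulrCA; apply: span_algZ; first by eexists.
exact: span_alg_table.
Qed.

Definition reg_alg (j : nat) : C := nth 0 [:: y; u1; u2; u3 - x] j.
(** The ideal is taken in the span [T], not in C: the coefficients are confined to [T]. *)
Definition reg_ideal j : set C :=
  [set s | exists t : nat -> C, (forall l, T (t l)) /\ s = \sum_(l < j) reg_alg l * t l].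

Lemma reg_ideal_mulT s t : reg_ideal 4 s -> T t -> reg_ideal 4 (t * s).
Proof.
move=> [c [Tc ->]] Tt; exists (fun l => t * c l); split; first by move=> l; apply: span_algM.
by rewrite mulr_sumr; apply: eq_bigr => l _; rewrite mulrCA.
Qed.

Lemma reg_idealD s t : reg_ideal 4 s -> reg_ideal 4 t -> reg_ideal 4 (s + t).
Proof.
move=> [c [Tc ->]] [d [Td ->]]; exists (fun l => c l + d l).
split; first by move=> l; apply: span_algD.
by rewrite -big_split; apply: eq_bigr => l _; rewrite mulrDr.
Qed.

Lemma reg_ideal_gen j t : (j < 4)%N -> T t -> reg_ideal 4 (reg_alg j * t).
Proof.
move=> lt Tt; exists (fun l => if l == j then t else 0); split.
  move=> l; case: eqP => // _; exists 0; rewrite /alg_elt sum_nat6.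
  by rewrite !mxE !rmorph0 !mul0r !addr0.
rewrite (bigD1 (Ordinal lt)) //= eqxx big1 ?addr0 // => i.
by rewrite -val_eqE /= => /negbTE ->; rewrite mulr0.
Qed.

Definition alg_gens : seq C := [:: x; y; u1; u2; u3; w 1; w 2; w 3; w 4; w 5].

Lemma alg_gens_span g : g \in alg_gens -> T g.
Proof.
rewrite !inE; do ?[case/orP]; move=> /eqP ->; first [exact: span_alg_phi|exact: span_alg_base].
Qed.

(** Modulo the parameters every generator becomes 0, x or a basis element, and the tables dispose of
    products of those. So the square of the maximal ideal of R' lies in the parameter ideal. *)
Lemma alg_gens_mul g h : g \in alg_gens -> h \in alg_gens -> reg_ideal 4 (g * h).
Proof.
have TN1 : T (-1) by apply/span_algN/(@span_alg_base 0).
have iN s : reg_ideal 4 s -> reg_ideal 4 (- s).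
  by move=> Is; rewrite -mulN1r; apply: reg_ideal_mulT.
have iD := reg_idealD.
have iy t : T t -> reg_ideal 4 (y * t) by apply: (@reg_ideal_gen 0).
have iu1 t : T t -> reg_ideal 4 (u1 * t) by apply: (@reg_ideal_gen 1).
have iu2 t : T t -> reg_ideal 4 (u2 * t) by apply: (@reg_ideal_gen 2).
have iu3 t : T t -> reg_ideal 4 ((u3 - x) * t) by apply: (@reg_ideal_gen 3).
have Tw := span_alg_base; have TM := span_algM; have Tp := span_alg_phi.
have [Tx Ty] := (Tp _ xB, Tp _ yB); have [Tu1 Tu2 Tu3] := And3 (Tp _ u1B) (Tp _ u2B) (Tp _ u3B).
have [[x1 x2 x3] [x4 x5 xx]] := alg_tablex.
have Ty2 : T (y * 1) by rewrite mulr1.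
have ixw l : (0 < l < 6)%N -> reg_ideal 4 (x * w l).
  case: l => [//|[|[|[|[|[|//]]]]]] _; rewrite ?x1 ?x2 ?x3 ?x4 ?x5 ?[y ^+ 2]expr2 -?[y * y * _]mulrA.
  - by apply/iD; [rewrite mulrC; apply/iu1|apply/iN/iy/Tw].
  - by apply/iy/TM => //; apply: Tw.
  - by apply/iy/TM => //; apply: Tw.
  - by apply/iD; [apply/iy/TM|apply/iN/iy/Tw].
  - by apply/iy/TM => //; apply: Tw.
have ixx : reg_ideal 4 (x * x).
  by rewrite xx; apply: iD; [apply/iy/Tw|rewrite [x * _]mulrC; apply/iN/iu3].
(* u_3 is not itself a parameter; it is split as (u_3 - x) + x. *)
have iu3w l : (0 < l < 6)%N -> reg_ideal 4 (u3 * w l).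
  move=> lt; rewrite -[u3](subrK x) mulrDl; apply: iD; last exact: ixw.
  by apply/iu3/Tw; case/andP: lt.
have [p11 p12 p13 p14 p15] := alg_table1; have [p22 p23 p24 p25] := alg_table2.
have [p33 p34 p35] := alg_table3; have [p44 p45 p55] := alg_table4.
have iww i j : (0 < i < 6)%N -> (0 < j < 6)%N -> reg_ideal 4 (w i * w j).
  wlog ij : i j / (i <= j)%N.
    move=> W; have [/W //|/ltnW ji] := leqP i j.
    by move=> li lj; rewrite mulrC; apply: W.
  case: i ij => [//|i] ij li lj; case: i ij li => [|[|[|[|[|//]]]]];
    case: j lj => [|[|[|[|[|[|//]]]]]] // _ _ _;
    rewrite ?p11 ?p12 ?p13 ?p14 ?p15 ?p22 ?p13 ?p23 ?p24 ?p25 ?p33 ?p34 ?p35 ?p44 ?p45 ?p55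
      -?[y * _ * _]mulrA;
    do ?apply/iD; do ?apply/iN;
    by [apply/iu1/Tw|apply/iu2/Tw|apply: iu3w|apply/iy/TM => //; apply: Tw|apply/iy/TM].
have i0 : reg_ideal 4 0.
  by rewrite -(subrr (x * x)); apply/iD/iN.
have key a b : a \in [:: 0; x; w 1; w 2; w 3; w 4; w 5] ->
    b \in [:: 0; x; w 1; w 2; w 3; w 4; w 5] -> reg_ideal 4 (a * b).
  rewrite !inE => /predU1P [->|]; first by rewrite mul0r.
  move=> ha /predU1P [->|]; first by rewrite mulr0.
  by move: ha; do ?[case/orP]; move=> /eqP ->; do ?[case/orP]; move=> /eqP ->;
    [apply: ixx|..]; first [apply: ixw|rewrite mulrC; apply: ixw|apply: iww].
have red_gen a : a \in alg_gens -> exists2 b,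
    b \in [:: 0; x; w 1; w 2; w 3; w 4; w 5] & reg_ideal 4 (a - b).
  have T1 : T 1 := @span_alg_base 0 isT.
  rewrite !inE => /predU1P [->|]; first by exists x; rewrite ?inE ?eqxx ?orbT // subrr.
  move=> /predU1P [->|].
    by exists 0; rewrite ?inE ?eqxx // subr0 -[y]mulr1; apply: iy.
  move=> /predU1P [->|].
    by exists 0; rewrite ?inE ?eqxx // subr0 -[u1]mulr1; apply: iu1.
  move=> /predU1P [->|].
    by exists 0; rewrite ?inE ?eqxx // subr0 -[u2]mulr1; apply: iu2.
  move=> /predU1P [->|].
    by exists x; rewrite ?inE ?eqxx ?orbT // -[u3 - x]mulr1; apply: iu3.
  by move=> ha; exists a; rewrite ?subrr // !inE ha !orbT.
have Tb b : b \in [:: 0; x; w 1; w 2; w 3; w 4; w 5] -> T b.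
  rewrite inE => /predU1P [->|hb]; last first.
    by apply: alg_gens_span; move: hb; rewrite !inE => /or4P [|||/or3P []] ->; rewrite ?orbT.
  by rewrite -(subrr x); apply: span_algB.
move=> hg hh; have Th := alg_gens_span hh.
have [b hb gb] := red_gen g hg; have [c hc hc'] := red_gen h hh.
have -> : g * h = h * (g - b) + b * (h - c) + b * c by ring.
by apply/iD; [apply/iD; apply: reg_ideal_mulT => //; apply: Tb|apply: key].
Qed.

End MultiplicationTable.

Section ConstantSeries.
Variables (n : nat) (R : comNzRingType).
Local Notation A := (pseries n R).

Definition psC (c : R) : A := PSeries (fun m => if m == 0%MM then c else 0).

Lemma psCM c (g : A) m : pscoef (psC c * g) m = c * pscoef g m.
Proof.
have lt0 : (mdeg (0%MM : 'X_{1..n}) < (mdeg m).+1)%N by rewrite mdeg0.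
rewrite [LHS](_ : _ = \sum_(l : 'X_{1..n < (mdeg m).+1, (mdeg m).+1} | m == (l.1 + l.2)%MM)
     pscoef (psC c) l.1 * pscoef g l.2) //.
rewrite (bigD1 (BMultinom lt0, BMultinom (ltnSn (mdeg m)))) /=; last by rewrite add0m.
rewrite eqxx big1 ?addr0 // => -[l1 l2] /andP [/eqP mE ne] /=.
case: eqP => [l10|]; last by rewrite mul0r.
case/eqP: ne; rewrite /= l10 add0m in mE.
by congr (_, _); apply: val_inj.
Qed.

Fact psC_additive : additive psC.
Proof. by move=> c d; apply: pseriesP => m /=; case: eqP => // _; rewrite subrr. Qed.
HB.instance Definition _ := GRing.isAdditive.Build R A psC psC_additive.

Fact psC_multiplicative : multiplicative psC.
Proof.
split=> [c d|]; apply: pseriesP => m; last by rewrite /=; case: eqP.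
by rewrite psCM /=; case: eqP => // _; rewrite mulr0.
Qed.
HB.instance Definition _ := GRing.isMultiplicative.Build R A psC psC_multiplicative.

End ConstantSeries.

Section ScaledVariables.
Variables (A : comNzRingType) (n : nat) (d : A).
Local Notation f := (mpoly_morph (@mpolyC n A) (fun i => d%:MP * 'X_i)).

Lemma mcoeff_scaled h m : (f h)@_m = h@_m * d ^+ mdeg m.
Proof.
have fX u : f 'X_[u] = (d ^+ mdeg u) *: 'X_[u].
  rewrite [in LHS]mpolyXE_id rmorph_prod /= mdegE -prodrXr.
  rewrite -mul_mpolyC rmorph_prod [in RHS]mpolyXE_id -big_split /=.
  by apply: eq_bigr => i _; rewrite rmorphXn /= mpoly_morphX exprMn rmorphXn.
elim/mpolyind: h => [|c u p _ _ IH]; first by rewrite rmorph0 !mcoeff0 mul0r.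
rewrite rmorphD !mcoeffD mulrDl IH; congr (_ + _).
rewrite -mul_mpolyC rmorphM mpoly_morphC fX [LHS]mcoeffCM mcoeffCM mcoeffZ !mcoeffX.
by case: eqP => [->|_]; rewrite ?mulr1 // !mulr0 mul0r.
Qed.

End ScaledVariables.

Lemma nth_ord3 (T : Type) (z a b c : T) :
  [/\ nth z [:: a; b; c] (ord0 : 'I_3) = a, nth z [:: a; b; c] (lift ord0 ord0 : 'I_3) = b
    & nth z [:: a; b; c] (ord_max : 'I_3) = c].
Proof. by []. Qed.

Lemma subr_trans (V : zmodType) (a b c : V) : a - c = (a - b) + (b - c).
Proof. by rewrite addrA subrK. Qed.

Lemma nth_ord2 (T : Type) (z a b : T) :
  nth z [:: a; b] (ord0 : 'I_2) = a /\ nth z [:: a; b] (ord_max : 'I_2) = b.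
Proof. by []. Qed.

Section ReductionSubstitution.
Variables (C D : comNzRingType) (f : {rmorphism C -> D}) (x y t1 t2 : C) (s1 s2 : D).
Hypotheses (f1 : f t1 = f y ^+ 5 * s1 - f x ^+ 3 * s2) (f2 : f t2 = f x * f y ^+ 3 * s2).

(** As linear forms in t_1, t_2, the elements u_2 and u_3 have coefficient rows (x y^3, x^3) and (0,
    y^5). The substitution is the adjugate matrix, and x y^8 is the determinant. *)
Lemma red_u2_subst : f (red_u2 x y t1 t2) = f x * f y ^+ 8 * s1.
Proof. by rewrite /red_u2 rmorphD !rmorphM ?rmorphXn f1 f2; ring. Qed.

Lemma red_u3_subst : f (red_u3 y t2) = f x * f y ^+ 8 * s2.
Proof. by rewrite /red_u3 !rmorphM ?rmorphXn f2; ring. Qed.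

End ReductionSubstitution.

(** * The cokernel is the larger Rees algebra, with its regular sequence *)

Section ConcreteAlgebra.
Variable k : fieldType.
Local Notation A := (Aring k).
Local Notation B := {mpoly A[3]}.
Local Notation S := {mpoly A[2]}.
Local Notation x := ((Xvar k)%:MP : S).
Local Notation y := ((Yvar k)%:MP : S).
Local Notation t1 := ('X_ord0 : S).
Local Notation t2 := ('X_ord_max : S).
Local Notation u1 := (red_u1 x y t1).
Local Notation u2 := (red_u2 x y t1 t2).
Local Notation u3 := (red_u3 y t2).
Local Notation w := (alg_basis x y t1 t2).

Definition phi : {rmorphism B -> S} :=
  mpoly_morph (@mpolyC 2 A) (fun i => nth 0 [:: u1; u2; u3] i).

Lemma phiC a : phi a%:MP = a%:MP.
Proof. exact: mpoly_morphC. Qed.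

Lemma phiT : [/\ phi 'X_ord0 = u1, phi 'X_(lift ord0 ord0) = u2 & phi 'X_ord_max = u3].
Proof.
have [h1 h2 h3] := nth_ord3 0 u1 u2 u3.
split; rewrite /phi mpoly_morphX.
- exact: h1.
- exact: h2.
exact: h3.
Qed.

Lemma phi_reg_seq j : (j < 4)%N -> phi (reg_seq k j) = reg_alg x y t1 t2 j.
Proof.
have [h1 h2 h3] := phiT; case: j => [|[|[|[|//]]]] _; rewrite /reg_seq /reg_alg /=.
- exact: phiC.
- exact: h1.
- exact: h2.
by rewrite rmorphB h3 phiC.
Qed.

Local Notation elt := (alg_elt x y t1 t2 phi).
Local Notation T := (span_alg x y t1 t2 phi).
Local Notation in_rel := (in_rel (Xvar k)%:MP (Yvar k)%:MP 'X_ord0 'X_(lift ord0 ord0) 'X_ord_max).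

Lemma in_rel_mul v : in_rel (v *m rel_mx ((Xvar k)%:MP : B) (Yvar k)%:MP
  'X_ord0 'X_(lift ord0 ord0) 'X_ord_max).
Proof. exact: (ex_intro _ v erefl). Qed.

Lemma elt_in_rel v : in_rel v -> elt v = 0.
Proof.
move=> [u ->]; have [h1 h2 h3] := phiT.
rewrite -[RHS](rel_mx_basis x y t1 t2 (map_mx phi u)) /alg_elt; apply: eq_bigr => l _.
congr (_ * _); rewrite -h1 -h2 -h3 -[x]phiC -[y]phiC -map_rel_mx -map_mxM.
by rewrite [RHS]mxE.
Qed.

Lemma A_neq0 : Xvar k != 0 /\ Yvar k != 0.
Proof.
have X0 (i : 'I_2) : psX k i != 0.
  apply/eqP => /(congr1 (fun f => pscoef f U_(i)%MM)) /=.
  by rewrite eqxx => /eqP; rewrite oner_eq0.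
by split; apply: X0.
Qed.

(** Algebraic independence of u_2 and u_3: the adjugate substitution [chi] turns them into x y^8
    times the variables, and scaling variables by a nonzero element of A is injective. *)
Lemma phi_B2_inj h : phi (B2_mor k h) = 0 -> h = 0.
Proof.
pose chi : {rmorphism S -> S} := mpoly_morph (@mpolyC 2 A)
  (fun i => nth 0 [:: y ^+ 5 * t1 - x ^+ 3 * t2; x * y ^+ 3 * t2] i).
pose D := Xvar k * Yvar k ^+ 8.
have chiE p : chi (phi (B2_mor k p)) = mpoly_morph (@mpolyC 2 A) (fun i => D%:MP * 'X_i) p.
  have [m2 m3] := B2_morT k; have [h1 h2 h3] := phiT.
  have cx : chi x = x by apply: mpoly_morphC.
  have cy : chi y = y by apply: mpoly_morphC.
  have [n1 n2] := nth_ord2 0 (y ^+ 5 * t1 - x ^+ 3 * t2) (x * y ^+ 3 * t2).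
  have c1 : chi t1 = chi y ^+ 5 * t1 - chi x ^+ 3 * t2.
    rewrite cx cy /chi mpoly_morphX; exact: n1.
  have c2 : chi t2 = chi x * chi y ^+ 3 * t2.
    rewrite cx cy /chi mpoly_morphX; exact: n2.
  have DE : D%:MP = chi x * chi y ^+ 8 :> S by rewrite cx cy /D mpolyCM rmorphXn.
  apply: (@mpoly_morph_eq A S 2 (chi \o (phi \o B2_mor k))
    (mpoly_morph (@mpolyC 2 A) (fun i => D%:MP * 'X_i))) => [a|i].
    rewrite [RHS]mpoly_morphC; etransitivity; last exact: (mpoly_morphC _ _ a : chi a%:MP = a%:MP).
    by congr (chi _); etransitivity; last exact: phiC; congr (phi _); apply: B2_morC.
  rewrite [RHS]mpoly_morphX DE; case: (eqVneq i ord0) => [->|n0].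
    rewrite -(red_u2_subst c1 c2); congr (chi _); rewrite -h2; congr (phi _); exact: m2.
  have -> : i = ord_max by apply: val_inj; case: i n0 => [[|[|//]]].
  rewrite -(red_u3_subst c2); congr (chi _); rewrite -h3; congr (phi _); exact: m3.
move=> h0; have := chiE h; rewrite h0 rmorph0 => E.
apply/mpolyP => m; have := congr1 (mcoeff m) E; rewrite mcoeff0 mcoeff_scaled => /esym/eqP.
have [X0 Y0] := A_neq0; rewrite mulf_eq0 expf_eq0 mulf_eq0 expf_eq0 (negbTE X0) (negbTE Y0).
by rewrite !andbF orbF => /eqP.
Qed.

(** Modulo the relations, a power of x y^8 turns [v] into h e_0 with h in A[T2, T3]. The image
    h(u_2, u_3) is zero, so h = 0, and x y^8 cancels on the cokernel. *)
Lemma elt_eq0 v : elt v = 0 -> in_rel v.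
Proof.
move=> v0; have [n [h vh]] := in_rel_reducible v.
suff h0 : h = 0 by move: vh; rewrite h0 rmorph0 scale0r subr0; apply: in_rel_cancel.
apply: phi_B2_inj; have := elt_in_rel vh.
rewrite alg_eltD alg_eltZ v0 mulr0 add0r -scaleN1r scalerA alg_eltZ alg_elt_base // mulr1.
by rewrite mulN1r rmorphN => /eqP; rewrite oppr_eq0 => /eqP.
Qed.

Lemma ker_red j f : (j <= 4)%N -> red k j f = 0 ->
  exists g : nat -> B, f = \sum_(l < j) reg_seq k l * g l.
Proof.
move=> lej f0.
have [g gE] : exists g : nat -> B, f - red k j f = \sum_(l < j) reg_seq k l * g l.
  elim: j lej {f0} => [|j IH] lej.
    by exists (fun=> 0); rewrite big_ord0 red0 subrr.
  have [g gE] := IH (ltnW lej); have [b bE] := red_diff f lej.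
  exists (fun l => if l == j then b else g l); rewrite big_ord_recr /= eqxx -bE.
  etransitivity; first exact: (@subr_trans B f (red k j f) (red k j.+1 f)).
  congr (_ + _); etransitivity; first exact: gE.
  by apply: eq_bigr => l _; rewrite ltn_eqF.
by exists g; rewrite -gE f0 subr0.
Qed.

Lemma elt_sum j (c : nat -> 'rV[B]_6) : (j <= 4)%N ->
  elt (\sum_(l < j) reg_seq k l *: c l) = \sum_(l < j) reg_alg x y t1 t2 l * elt (c l).
Proof.
elim: j => [|j IH] lej; first by rewrite !big_ord0 alg_elt0.
by rewrite !big_ord_recr /= alg_eltD IH ?(ltnW lej) // alg_eltZ phi_reg_seq.
Qed.

(** The regularity of the sequence on the cokernel, carried over to the span; [ker_red] turns
    vanishing under the j-th reduction into a combination of the first j parameters. *)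
Lemma reg_alg_regular j s : (j < 4)%N -> T s ->
  reg_ideal x y t1 t2 phi j (reg_alg x y t1 t2 j * s) -> reg_ideal x y t1 t2 phi j s.
Proof.
move=> lt [v ->] [t [Tt ptE]]; have /choice [c cE] := Tt.
have : in_rel (reg_seq k j *: v - \sum_(l < j) reg_seq k l *: c l).
  apply: elt_eq0.
  have eltN z : elt (- z) = - elt z by rewrite -scaleN1r alg_eltZ rmorphN1 mulN1r.
  rewrite alg_eltD eltN elt_sum ?(ltnW lt) // alg_eltZ phi_reg_seq // ptE.
  by rewrite -sumrB big1 // => l _; rewrite cE subrr.
case=> u uE.
have [|v' v'E] := @rel_regular k j v lt.
  exists u; rewrite -uE; set a := reg_seq k j *: v; set b := \sum_(l < j) _.
  apply/rowP => i; rewrite [LHS]mxE [RHS]mxE.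
  have -> : (a - b) 0 i = a 0 i - b 0 i by rewrite mxE [X in _ + X]mxE.
  rewrite (rmorphB (red k j)).
  suff -> : red k j (b 0 i) = 0 by rewrite subr0.
  rewrite /b summxE (rmorph_sum (red k j)) big1 // => l _.
  rewrite mxE (rmorphM (red k j)); have [_ r0] := red_reg_seq k (ltn_trans (ltn_ord l) lt).
  by rewrite -(redK _ (ltn_ord l)) r0 rmorph0 mul0r.
pose v0 := v - v' *m rel_mx (Xvar k)%:MP (Yvar k)%:MP 'X_ord0 'X_(lift ord0 ord0) 'X_ord_max.
have elt0 : elt v = elt v0.
  rewrite -[v in LHS](subrK (v' *m rel_mx (Xvar k)%:MP (Yvar k)%:MP 'X_ord0
     'X_(lift ord0 ord0) 'X_ord_max)) alg_eltD -/v0.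
  have -> : elt (v' *m rel_mx (Xvar k)%:MP (Yvar k)%:MP 'X_ord0 'X_(lift ord0 ord0) 'X_ord_max) = 0.
    by apply: elt_in_rel; apply: in_rel_mul.
  exact: addr0.
have /choice [g gE] : forall i : 'I_6, exists g : nat -> B,
    v0 0 i = \sum_(l < j) reg_seq k l * g l.
  move=> i; apply: ker_red; first exact: ltnW.
  move/rowP: v'E => /(_ i); rewrite ![map_mx _ _ _ _]mxE => E.
  by rewrite /v0 mxE rmorphD E [X in _ + red k j X]mxE rmorphN subrr.
exists (fun l => elt (\row_i g i l)); split; first by move=> l; apply: span_alg_elt.
have v0E : v0 = \sum_(l < j) reg_seq k l *: \row_i g i l.
  apply/rowP => i; rewrite gE summxE; apply: eq_bigr => l _.
  by rewrite !mxE.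
rewrite elt0 v0E; exact: (elt_sum (fun l => \row_i g i l) (ltnW lt)).
Qed.

End ConcreteAlgebra.

Section MatrixRows.
Variables (C : comNzRingType) (X Y : C).

Definition Mmat_row1 : seq C :=
  [:: X ^+ 3; X ^+ 2 * Y ^+ 2; X * Y ^+ 3; Y ^+ 5; 0; 0; 0].
Definition Mmat_row2 : seq C :=
  [:: 0; 0; X ^+ 3; 0; X ^+ 2 * Y ^+ 2; X * Y ^+ 4; Y ^+ 5].

Lemma sum_Mmat_rows (s1 s2 : C) i : (i < 7)%N ->
  Mmat_row1`_i * s1 + Mmat_row2`_i * s2 =
  nth 0 [:: alg_basis X Y s1 s2 1; alg_basis X Y s1 s2 2; red_u2 X Y s1 s2;
      red_u1 X Y s1 - alg_basis X Y s1 s2 1; alg_basis X Y s1 s2 4; alg_basis X Y s1 s2 5;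
      red_u3 Y s2] i.
Proof.
by case: i => [|[|[|[|[|[|[|//]]]]]]] _ /=;
  rewrite /alg_basis /red_u1 /red_u2 /red_u3 /=; ring.
Qed.

End MatrixRows.

Lemma map_Mmat_rows (C D : comNzRingType) (f : {rmorphism C -> D}) (X Y : C) :
  map f (Mmat_row1 X Y) = Mmat_row1 (f X) (f Y) /\ map f (Mmat_row2 X Y) = Mmat_row2 (f X) (f Y).
Proof. by rewrite /Mmat_row1 /Mmat_row2 /= !rmorph0 !rmorphM. Qed.

Section ClosedPredicate.
Variables (C : comNzRingType) (X Y s1 s2 : C) (P : C -> Prop).
Local Notation W := (alg_basis X Y s1 s2).
Local Notation U1 := (red_u1 X Y s1).
Local Notation U2 := (red_u2 X Y s1 s2).
Local Notation U3 := (red_u3 Y s2).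
Local Notation d := (U1 - W 1).
Hypotheses (PD : forall a b, P a -> P b -> P (a + b)) (PM : forall a b, P a -> P b -> P (a * b)).
Hypotheses (PN : forall a, P a -> P (- a)) (PX : P X) (PY : P Y).
Hypothesis PW : [/\ P (W 1), P (W 2), P (W 4) & P (W 5)].
Hypothesis PU : [/\ P U1, P U2, P U3 & P d].

(** One monomial identity per generator writes its product with z = [W 3] through elements other
    than z. [P] will be membership in R(M). *)
Lemma closed_zmul j : (j < 7)%N ->
  P (nth 0 [:: W 1; W 2; U2; d; W 4; W 5; U3] j * W 3).
Proof.
have [[p1 p2 p4 p5] [pu1 pu2 pu3 pd]] := (PW, PU).
have e1 : W 1 * W 3 = W 2 * W 2 by rewrite /alg_basis /=; ring.
have e2 : W 2 * W 3 = Y * (W 1 * d) by rewrite /alg_basis /red_u1 /=; ring.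
have e3 : U2 * W 3 = W 2 * d + W 2 * W 4 by rewrite /alg_basis /red_u1 /red_u2 /=; ring.
have e4 : d * W 3 = Y * (U2 * d) + - (Y * (W 1 * U3)).
  by rewrite /alg_basis /red_u1 /red_u2 /red_u3 /=; ring.
have e5 : W 4 * W 3 = Y * (W 1 * U3) by rewrite /alg_basis /red_u3 /=; ring.
have e6 : W 5 * W 3 = Y * (d * W 4) by rewrite /alg_basis /red_u1 /=; ring.
have e7 : U3 * W 3 = d * W 5 by rewrite /alg_basis /red_u1 /red_u3 /=; ring.
have q := PM PY (PM p1 pu3).
case: j => [|[|[|[|[|[|[|//]]]]]]] _; rewrite [nth _ _ _]/=.
- by rewrite e1; exact: (PM p2 p2).
- by rewrite e2; exact: (PM PY (PM p1 pd)).
- by rewrite e3; exact: (PD (PM p2 pd) (PM p2 p4)).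
- by rewrite e4; exact: (PD (PM PY (PM pu2 pd)) (PN q)).
- by rewrite e5.
- by rewrite e6; exact: (PM PY (PM pd p4)).
by rewrite e7; exact: (PM pd p5).
Qed.

Lemma closed_zz : P (W 3 * W 3).
Proof.
have [[p1 p2 p4 p5] [pu1 pu2 pu3 pd]] := (PW, PU).
have -> : W 3 * W 3 = Y * (W 2 * d) by rewrite /alg_basis /red_u1 /=; ring.
exact: (PM PY (PM p2 pd)).
Qed.

(** X z = Y^2 (X^2 Y^2 t_1) and Y z = X (Y^5 t_1). *)
Lemma closed_zmax g h : P g -> P h -> P ((X * g + Y * h) * W 3).
Proof.
have [[p1 p2 p4 p5] [pu1 pu2 pu3 pd]] := (PW, PU).
have -> : (X * g + Y * h) * W 3 = g * (Y * (Y * W 2)) + h * (X * d).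
  by rewrite /alg_basis /red_u1 /=; ring.
by move=> Pg Ph; exact: (PD (PM Pg (PM PY (PM PY p2))) (PM Ph (PM PX pd))).
Qed.

End ClosedPredicate.

Section AlgebraGenerators.
Variables (C : comNzRingType) (X Y s1 s2 : C).
Local Notation G := (alg_gens X Y s1 s2).

Lemma alg_gens_all (P : C -> Prop) : P X -> P Y ->
  [/\ P (red_u1 X Y s1), P (red_u2 X Y s1 s2) & P (red_u3 Y s2)] ->
  (forall l, (0 < l < 6)%N -> P (alg_basis X Y s1 s2 l)) -> forall g, g \in G -> P g.
Proof.
move=> PX PY [P1 P2 P3] Pw g; rewrite !inE; do ?[case/orP]; move=> /eqP -> //; exact: Pw.
Qed.

Lemma alg_gens_mem : [/\ X \in G, Y \in G, red_u1 X Y s1 \in G, red_u2 X Y s1 s2 \in G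
  & red_u3 Y s2 \in G].
Proof. by split; rewrite !inE eqxx ?orbT. Qed.

Lemma alg_basis_mem l : (0 < l < 6)%N -> alg_basis X Y s1 s2 l \in G.
Proof. by case: l => [//|[|[|[|[|[|//]]]]]] _; rewrite !inE eqxx ?orbT. Qed.

End AlgebraGenerators.

Section IdealPredicate.
Variables (C : comNzRingType) (X Y s1 s2 : C) (P : C -> Prop).
Hypotheses (PD : forall a b, P a -> P b -> P (a + b)) (PM : forall a b, P b -> P (a * b)).
Hypotheses (P1 : P s1) (P2 : P s2).

Lemma ideal_alg_basis l : (0 < l < 6)%N -> P (alg_basis X Y s1 s2 l).
Proof.
by case: l => [//|[|[|[|[|[|//]]]]]] _; rewrite /alg_basis /=; apply: PM.
Qed.

Lemma ideal_red : [/\ P (red_u1 X Y s1), P (red_u2 X Y s1 s2) & P (red_u3 Y s2)].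
Proof. by split; rewrite /red_u1 /red_u2 /red_u3; do ?apply: PD; apply: PM. Qed.

End IdealPredicate.

Section SplitProduct.
Variables (C : comNzRingType) (r r' a b al be z : C).

Lemma split_mul_sub : r * r' - al * be = r * (r' - be) + be * (r - al).
Proof. by ring. Qed.

Lemma split_mul_z : (r * r' - al * be) * z = r * ((r' - be) * z) + be * ((r - al) * z).
Proof. by ring. Qed.

Lemma split_add_z : (r + r' - (al + be)) * z = (r - al) * z + (r' - be) * z.
Proof. by ring. Qed.

Lemma split_mul_overring : (r + a * z) * (r' + b * z) =
  (r * r' + (b * ((r - al) * z) + (a * ((r' - be) * z) + a * b * (z * z)))) +
  (b * al + a * be) * z.
Proof. by ring. Qed.

End SplitProduct.

Lemma mulmx_sum_col (C : comNzRingType) m n (M : 'M[C]_(m, n)) (u : 'cV_n) :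
  M *m u = \sum_j u j 0 *: col j M.
Proof.
by apply/colP => i; rewrite mxE summxE; apply: eq_bigr => j _; rewrite !mxE mulrC.
Qed.

(** * The Rees algebras of M and M' and their comparison *)

Section ReesModules.
Variable k : fieldType.
Local Notation A := (Aring k).
Local Notation S := {mpoly A[2]}.
Local Notation x := ((Xvar k)%:MP : S).
Local Notation y := ((Yvar k)%:MP : S).
Local Notation t1 := ('X_ord0 : S).
Local Notation t2 := ('X_ord_max : S).
Local Notation u1 := (red_u1 x y t1).
Local Notation u2 := (red_u2 x y t1 t2).
Local Notation u3 := (red_u3 y t2).
Local Notation w := (alg_basis x y t1 t2).
Local Notation T := (span_alg x y t1 t2 (phi k)).
Implicit Types (M : set (Fmod k)) (s : S).

Lemma sym1E (v : 'cV[A]_2) : sym1 v = (v ord0 0)%:MP * t1 + (v ord_max 0)%:MP * t2.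
Proof.
rewrite /sym1 big_ord_recl big_ord1 !mul_mpolyC.
by have -> : lift ord0 ord0 = ord_max :> 'I_2 by apply: val_inj.
Qed.

Lemma sym1D (u v : 'cV[A]_2) : sym1 (u + v) = sym1 u + sym1 v.
Proof. by rewrite /sym1 -big_split; apply: eq_bigr => i _; rewrite mxE scalerDl. Qed.

Lemma sym1Z a (v : 'cV[A]_2) : sym1 (a *: v) = a%:MP * sym1 v.
Proof. by rewrite mul_mpolyC /sym1 scaler_sumr; apply: eq_bigr => i _; rewrite mxE scalerA. Qed.

Lemma sym1_0 : sym1 (0 : 'cV[A]_2) = 0.
Proof. by rewrite /sym1 big1 // => i _; rewrite mxE scale0r. Qed.

Lemma const_coef_sym1 v : const_coef (sym1 v) = 0 :> k.
Proof. by rewrite /const_coef (dhomog_nemf_coeff (sym1_homog v)) //= mdeg0. Qed.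

Definition sgen (j : 'I_7) : S := sym1 (col j (Mmat k)).

Definition sgens : seq S := [:: w 1; w 2; u2; u1 - w 1; w 4; w 5; u3].

Lemma sgenE j : sgen j = sgens`_j.
Proof.
rewrite -[RHS](sum_Mmat_rows x y t1 t2 (ltn_ord j)) /sgen sym1E.
have mC (f : seq A) i : (f`_i)%:MP = (map (@mpolyC 2 A) f)`_i :> S.
  have [lt|le] := ltnP i (size f); first by rewrite (nth_map 0).
  by rewrite !nth_default ?size_map // mpolyC0.
have e1 : col j (Mmat k) ord0 0 = (Mmat_row1 (Xvar k) (Yvar k))`_j by rewrite !mxE.
have e2 : col j (Mmat k) ord_max 0 = (Mmat_row2 (Xvar k) (Yvar k))`_j by rewrite !mxE.
have [m1 m2] := map_Mmat_rows (@mpolyC 2 A) (Xvar k) (Yvar k).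
by rewrite e1 e2 !mC m1 m2.
Qed.

Lemma rees_sub M M' : M `<=` M' -> rees M `<=` rees M'.
Proof.
move=> MM; apply: rees_ind => [a|v /MM|p q _ + _|p q _ + _].
- exact: rees_const.
- exact: rees_gen.
- exact: rees_add.
exact: rees_mul.
Qed.

Lemma rees_sumr M (I : finType) (F : I -> S) : (forall i, rees M (F i)) -> rees M (\sum_i F i).
Proof. by move=> h; apply: rees_sum. Qed.

Lemma Msub_sym1 v : Msub k v -> exists c : 'I_7 -> A, sym1 v = \sum_j (c j)%:MP * sgen j.
Proof.
move=> [u ->]; exists (fun j => u j 0); rewrite mulmx_sum_col.
rewrite (big_morph (@sym1 k) sym1D sym1_0); apply: eq_bigr => j _.
exact: sym1Z.
Qed.

Lemma rees_sgen j : rees (Msub k) (sgen j).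
Proof.
by apply: rees_gen; exists (delta_mx j 0); rewrite -colE.
Qed.

Definition zvec : Fmod k := \col_i (if i == ord0 then Xvar k * Yvar k ^+ 4 else 0).

Definition Mbar : set (Fmod k) := [set v | exists m a, Msub k m /\ v = m + a *: zvec].

Lemma sym1_zvec : sym1 zvec = w 3.
Proof.
by rewrite sym1E !mxE /= mpolyC0 mul0r addr0 /alg_basis /= mpolyCM rmorphXn.
Qed.

Lemma Msub0 : Msub k 0.
Proof. by exists 0; rewrite mulmx0. Qed.

Lemma Msub_Mbar : Msub k `<=` Mbar.
Proof. by move=> v Mv; exists v, 0; rewrite scale0r addr0. Qed.

Lemma rees_zvec : rees Mbar (w 3).
Proof.
rewrite -sym1_zvec; apply: rees_gen; exists 0, 1; split; first exact: Msub0.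
by rewrite add0r scale1r.
Qed.

Lemma rees_Mbar_ind (P : S -> Prop) : (forall a : A, P a%:MP) -> (forall j, P (sgen j)) ->
  P (w 3) -> (forall s t, P s -> P t -> P (s + t)) -> (forall s t, P s -> P t -> P (s * t)) ->
  forall s, rees Mbar s -> P s.
Proof.
move=> PC Pg Pz PD PM; apply: rees_ind => [a|v [m [a [Mm ->]]]|p q _ Pp _ Pq|p q _ Pp _ Pq].
- exact: PC.
- rewrite sym1D sym1Z sym1_zvec; apply/PD; last exact: PM.
  have [c ->] := Msub_sym1 Mm.
  elim/big_rec: _ => [|j z _ Pz']; first by rewrite -(mpolyC0 2 A); apply: PC.
  by apply/PD => //; apply/PM.
- exact: PD.
exact: PM.
Qed.

Lemma rees_Msub_ind (P : S -> Prop) : (forall a : A, P a%:MP) -> (forall j, P (sgen j)) ->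
  (forall s t, P s -> P t -> P (s + t)) -> (forall s t, P s -> P t -> P (s * t)) ->
  forall s, rees (Msub k) s -> P s.
Proof.
move=> PC Pg PD PM; apply: rees_ind => [a|v Mv|p q _ Pp _ Pq|p q _ Pp _ Pq].
- exact: PC.
- have [c ->] := Msub_sym1 Mv.
  elim/big_rec: _ => [|j z _ Pz']; first by rewrite -(mpolyC0 2 A); apply: PC.
  by apply/PD => //; apply/PM.
- exact: PD.
exact: PM.
Qed.

Lemma phi_x : exists b, phi k b = x.
Proof. by exists (Xvar k)%:MP; apply: phiC. Qed.
Lemma phi_y : exists b, phi k b = y.
Proof. by exists (Yvar k)%:MP; apply: phiC. Qed.
Lemma phi_u1 : exists b, phi k b = u1.
Proof. by have [h _ _] := phiT k; exists 'X_ord0; apply: h. Qed.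
Lemma phi_u2 : exists b, phi k b = u2.
Proof. by have [_ h _] := phiT k; exists 'X_(lift ord0 ord0); apply: h. Qed.
Lemma phi_u3 : exists b, phi k b = u3.
Proof. by have [_ _ h] := phiT k; exists 'X_ord_max; apply: h. Qed.

Lemma rees_Msub_gens :
  [/\ rees (Msub k) (w 1), rees (Msub k) (w 2), rees (Msub k) (w 4) & rees (Msub k) (w 5)] /\
  [/\ rees (Msub k) u1, rees (Msub k) u2, rees (Msub k) u3 & rees (Msub k) (u1 - w 1)].
Proof.
have r (j : nat) : (j < 7)%N -> rees (Msub k) sgens`_j.
  by move=> lt; have := rees_sgen (Ordinal lt); rewrite sgenE.
have [a b] := (r 0%N isT, r 3 isT).
split; split; [exact: a|exact: (r 1%N)|exact: (r 4)|exact: (r 5)| |exact: (r 2)|exact: (r 6)|exact: b].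
by rewrite -(subrK (w 1) u1); apply: rees_add.
Qed.

(** The span is a ring containing A and the generators of M'; conversely the u_i and the basis
    elements other than z already lie in R(M). *)
Lemma rees_spanP s : rees Mbar s <-> T s.
Proof.
have [px py] := (phi_x, phi_y); have [p1 p2 p3] := And3 phi_u1 phi_u2 phi_u3.
have Tb l : (l < 6)%N -> T (w l) by apply: span_alg_base.
split.
  apply: rees_Mbar_ind => [a|j||p q|p q].
  - by apply: span_alg_phi; exists a%:MP; apply: phiC.
  - rewrite sgenE; case: j => [[|[|[|[|[|[|[|//]]]]]]] lt] /=.
    + exact: (Tb 1%N).
    + exact: (Tb 2).
    + exact: (span_alg_phi _ _ _ _ p2).
    + exact: (span_algB (span_alg_phi _ _ _ _ p1) (Tb 1%N isT)).
    + exact: (Tb 4).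
    + exact: (Tb 5).
    + exact: (span_alg_phi _ _ _ _ p3).
  - exact: (Tb 3).
  - exact: span_algD.
  exact: (span_algM py p1 p2 p3).
have [[r1 r2 r4 r5] [ru1 ru2 ru3 _]] := rees_Msub_gens.
have sub := rees_sub Msub_Mbar.
have rphi b : rees Mbar (phi k b).
  move: b; apply: mpoly_ring_ind => [a|i|p q|p q].
  - by rewrite phiC; apply: rees_const.
  - have [h1 h2 h3] := phiT k.
    case: (eqVneq i ord0) => [->|n1]; first by rewrite h1; apply: sub.
    case: (eqVneq i (lift ord0 ord0)) => [->|n2]; first by rewrite h2; apply: sub.
    have -> : i = ord_max by apply: val_inj; case: i n1 n2 => [[|[|[|//]]]] lt n1 n2.
    by rewrite h3; apply: sub.
  - by rewrite rmorphD; apply: rees_add.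
  by rewrite rmorphM; apply: rees_mul.
have rw l : (l < 6)%N -> rees Mbar (w l).
  case: l => [|[|[|[|[|[|//]]]]]] _; [exact: rees1|exact: sub|exact: sub|exact: rees_zvec
    |exact: sub|exact: sub].
move=> [v ->]; rewrite /alg_elt big_mkord; apply: rees_sumr => l.
by apply: rees_mul; [apply: rphi|apply: rw].
Qed.

Definition kS (c : k) : S := (psC 2 c)%:MP.

Lemma const_coef_kS c : const_coef (kS c) = c.
Proof. by rewrite /kS const_coefC /= eqxx. Qed.

Lemma rees_x : rees (Msub k) x. Proof. exact: rees_const. Qed.
Lemma rees_y : rees (Msub k) y. Proof. exact: rees_const. Qed.

Lemma rees_zmul_table j : rees (Msub k) (sgen j * w 3).
Proof.
have [rw ru] := rees_Msub_gens; rewrite sgenE.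
exact: (closed_zmul (@rees_add k _) (@rees_mul k _) (@rees_opp k _) rees_y rw ru (ltn_ord j)).
Qed.

Lemma rees_zz : rees (Msub k) (w 3 * w 3).
Proof.
have [rw ru] := rees_Msub_gens.
exact: (closed_zz (@rees_mul k _) rees_y rw ru).
Qed.

Lemma kSM c d : kS (c * d) = kS c * kS d.
Proof. by rewrite /kS rmorphM mpolyCM. Qed.

Lemma kSD c d : kS (c + d) = kS c + kS d.
Proof. by rewrite /kS rmorphD mpolyCD. Qed.

Lemma kS0 : kS 0 = 0.
Proof. by rewrite /kS raddf0 mpolyC0. Qed.

Lemma kS1 : kS 1 = 1.
Proof. by rewrite /kS rmorph1 mpolyC1. Qed.

Lemma rees_kS M c : rees M (kS c).
Proof. exact: rees_const. Qed.

Lemma const_split a : exists g h : A, a%:MP - kS (pscoef a 0%MM) = x * g%:MP + y * h%:MP.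
Proof.
have [|g [h gh]] := @ps_split k (a - psC 2 (pscoef a 0%MM)); first by rewrite /= eqxx subrr.
by exists g, h; rewrite /kS -mpolyCB gh mpolyCD !mpolyCM.
Qed.

Lemma rees_zmul_const a : rees (Msub k) ((a%:MP - kS (pscoef a 0%MM)) * w 3).
Proof.
have [rw ru] := rees_Msub_gens; have [g [h ->]] := const_split a.
exact: (closed_zmax (@rees_add k _) (@rees_mul k _) rees_x rees_y rw ru
  (rees_const _ g) (rees_const _ h)).
Qed.

(** With s_0 the constant coefficient of s, products are handled by s t - s_0 t_0 = s (t - t_0) +
    t_0 (s - s_0). *)
Lemma rees_zmul s : rees (Msub k) s -> rees (Msub k) ((s - kS (const_coef s)) * w 3).
Proof.
move=> rs; suff [//] : rees (Msub k) ((s - kS (const_coef s)) * w 3) /\ rees (Msub k) s.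
move: s rs; apply: rees_Msub_ind => [a|j|s t [rs rs'] [rt rt']|s t [rs rs'] [rt rt']].
- by split; [rewrite const_coefC; apply: rees_zmul_const|apply: rees_const].
- split; last exact: rees_sgen.
  by rewrite /sgen const_coef_sym1 kS0 subr0; apply: rees_zmul_table.
- split; last exact: (rees_add rs' rt').
  by rewrite const_coefD kSD split_add_z; exact: (rees_add rs rt).
split; last exact: (rees_mul rs' rt').
rewrite const_coefM kSM split_mul_z.
exact: (rees_add (rees_mul rs' rt) (rees_mul (rees_kS _ _) rs)).
Qed.

(** R(M) + k z is closed under products, since z^2 and (r - r_0) z lie in R(M), where r_0 is the
    constant coefficient of r. *)
Lemma rees_Mbar_split s : rees Mbar s -> exists r c, rees (Msub k) r /\ s = r + kS c * w 3.
Proof.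
have triv r : rees (Msub k) r -> exists r' c, rees (Msub k) r' /\ r = r' + kS c * w 3.
  by move=> rr; exists r, 0; rewrite kS0 mul0r addr0.
move: s; apply: rees_Mbar_ind => [a|j||_ _ [r [c [rr ->]]] [r' [c' [rr' ->]]]
    |_ _ [r [c [rr ->]]] [r' [c' [rr' ->]]]].
- by apply: triv; apply: rees_const.
- by apply: triv; apply: rees_sgen.
- exists 0, 1; split; first exact: rees0.
  by rewrite kS1 mul1r add0r.
- exists (r + r'), (c + c'); split; first exact: (rees_add rr rr').
  by rewrite kSD mulrDl addrACA.
pose al := kS (const_coef r); pose be := kS (const_coef r').
have [rc rc'] := (rees_kS (Msub k) c, rees_kS (Msub k) c').
exists (r * r' + (kS c' * ((r - al) * w 3) + (kS c * ((r' - be) * w 3)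
   + kS c * kS c' * (w 3 * w 3)))), (c' * const_coef r + c * const_coef r'); split.
  exact: (rees_add (rees_mul rr rr') (rees_add (rees_mul rc' (rees_zmul rr))
    (rees_add (rees_mul rc (rees_zmul rr')) (rees_mul (rees_mul rc rc') rees_zz)))).
by rewrite kSD !kSM; exact: split_mul_overring.
Qed.

Lemma const_coef_ideal : [/\ forall a b : S, const_coef a = 0 :> k -> const_coef b = 0 :> k ->
    const_coef (a + b) = 0 :> k,
  forall a b : S, const_coef b = 0 :> k -> const_coef (a * b) = 0 :> k
  & const_coef t1 = 0 :> k /\ const_coef t2 = 0 :> k].
Proof.
split.
- by move=> a b ca cb; rewrite const_coefD ca cb addr0.
- by move=> a b cb; rewrite const_coefM cb mulr0.
by split; rewrite /const_coef mcoeffX mnm1_eq0.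
Qed.

Lemma const_coef_basis l : (0 < l < 6)%N -> const_coef (w l) = 0 :> k.
Proof.
have [cD cM [c1 c2]] := const_coef_ideal.
exact: (@ideal_alg_basis S x y t1 t2 (fun s => const_coef s = 0) cM c1 c2 l).
Qed.

Lemma const_coef_red : [/\ const_coef u1 = 0 :> k, const_coef u2 = 0 :> k & const_coef u3 = 0 :> k].
Proof.
have [cD cM [c1 c2]] := const_coef_ideal.
exact: (@ideal_red S x y t1 t2 (fun s => const_coef s = 0) cD cM c1 c2).
Qed.

Lemma const_coef_xy : const_coef x = 0 :> k /\ const_coef y = 0 :> k.
Proof. by rewrite !const_coefC !psX0. Qed.

(** The listed generators generate the maximal ideal of R': every element of the image of B differs
    from a constant by a member of the ideal they generate, and a zero constant coefficient makes
    these constants disappear. *)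
Lemma span_max_ind (N : S -> Prop) : (forall s t, N s -> N t -> N (s + t)) ->
  (forall s t, T s -> N t -> N (s * t)) ->
  (forall g, g \in alg_gens x y t1 t2 -> N g) ->
  forall s, T s -> const_coef s = 0 :> k -> N s.
Proof.
move=> ND NM Ng.
have [px py] := (phi_x, phi_y); have [p1 p2 p3] := And3 phi_u1 phi_u2 phi_u3.
pose N' s := N s /\ const_coef s = 0 :> k.
have [cx cy] := const_coef_xy.
have cg := alg_gens_all (P := fun g => const_coef g = 0 :> k) cx cy const_coef_red
  const_coef_basis.
have N'g g : g \in alg_gens x y t1 t2 -> N' g by move=> hg; exact: (conj (Ng g hg) (cg g hg)).
have N'D s t : N' s -> N' t -> N' (s + t).
  by move=> [n1 c1] [n2 c2]; split; [apply: ND|rewrite const_coefD c1 c2 addr0].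
have N'M s t : T s -> N' t -> N' (s * t).
  by move=> Ts [n2 c2]; split; [apply: NM|rewrite const_coefM c2 mulr0].
have [gx gy g1 g2 g3] := alg_gens_mem x y t1 t2.
have [Ngx Ngy] := (N'g _ gx, N'g _ gy).
have [Nu1 Nu2 Nu3] := And3 (N'g _ g1) (N'g _ g2) (N'g _ g3).
have Nw l (lt : (0 < l < 6)%N) : N' (w l) := N'g _ (alg_basis_mem x y t1 t2 lt).
have TC a : T a%:MP by apply: span_alg_phi; exists a%:MP; apply: phiC.
have Nphi b : exists c, N' (phi k b - kS c).
  move: b; apply: mpoly_ring_ind => [a|i|p q [c Nc] [d Nd]|p q [c Nc] [d Nd]].
  - exists (pscoef a 0%MM).
    have [g [h gh]] := const_split a; rewrite phiC gh; apply: N'D.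
      by rewrite [x * _]mulrC; exact: (N'M _ _ (TC g) Ngx).
    by rewrite [y * _]mulrC; exact: (N'M _ _ (TC h) Ngy).
  - have [h1 h2 h3] := phiT k; exists 0; rewrite kS0 subr0.
    case: (eqVneq i ord0) => [->|n1]; first by rewrite h1.
    case: (eqVneq i (lift ord0 ord0)) => [->|n2]; first by rewrite h2.
    have -> : i = ord_max by apply: val_inj; case: i n1 n2 => [[|[|[|//]]]] lt n1 n2.
    by rewrite h3.
  - by exists (c + d); rewrite rmorphD kSD opprD addrACA; apply: N'D.
  exists (c * d); rewrite rmorphM kSM split_mul_sub; apply: N'D.
    exact: (N'M _ _ (span_alg_phi _ _ _ _ (ex_intro _ p erefl)) Nd).
  exact: (N'M _ _ (TC _) Nc).
move=> _ [v ->]; rewrite /alg_elt big_nat_recl //= [w 0]/alg_basis /= mulr1.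
have [c Nc] := Nphi (v 0 (inord 0)).
have N0 : N' 0.
  have := N'M _ _ (TC 0) Ngx; by rewrite mpolyC0 mul0r.
have Nr : N' (\sum_(0 <= l < 5) phi k (v 0 (inord l.+1)) * w l.+1).
  rewrite big_mkord; elim/big_rec: _ => // l z _ Nz; apply: N'D => //.
  exact: (N'M _ _ (span_alg_phi _ _ _ _ (ex_intro _ _ erefl)) (Nw l.+1 (ltn_ord l))).
rewrite -(subrK (kS c) (phi k _)) -addrA [kS c + _]addrC addrA.
set s := _ + _ in Nr Nc *; have Ns := N'D _ _ Nc Nr; rewrite const_coefD Ns.2 add0r const_coef_kS.
by move=> ->; rewrite kS0 addr0; case: Ns.
Qed.

Lemma span_max_mul s t : T s -> T t -> const_coef s = 0 :> k -> const_coef t = 0 :> k ->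
  reg_ideal x y t1 t2 (phi k) 4 (s * t).
Proof.
have [px py] := (phi_x, phi_y); have [p1 p2 p3] := And3 phi_u1 phi_u2 phi_u3.
have ID := @reg_idealD _ x y t1 t2 _ (phi k).
have IM a b := @reg_ideal_mulT _ x y t1 t2 _ (phi k) py p1 p2 p3 a b.
move=> Ts Tt cs ct; move: s Ts cs; apply: span_max_ind => [a b|a b Ta|g hg].
- by rewrite mulrDl; apply: ID.
- by rewrite -mulrA => h; apply: IM.
move: t Tt ct; apply: span_max_ind => [a b|a b Ta|h hh].
- by rewrite mulrDr; apply: ID.
- by rewrite mulrCA => h; apply: IM.
exact: (alg_gens_mul px py p1 p2 p3).
Qed.

End ReesModules.

(** * Localization *)

Section FractionCalculus.
Variable R : idomainType.
Local Notation "p %:F" := (@FracField.tofrac R p).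
Implicit Types a b c : R.

Lemma frac_eq a b a' b' : b != 0 -> b' != 0 -> a%:F / b%:F = a'%:F / b'%:F -> a * b' = a' * b.
Proof.
move=> b0 b0' /eqP; rewrite eqr_div ?tofrac_eq0 // -!tofracM tofrac_eq.
by move/eqP.
Qed.

Lemma fracD a b a' b' : b != 0 -> b' != 0 ->
  a%:F / b%:F + a'%:F / b'%:F = (a * b' + a' * b)%:F / (b * b')%:F.
Proof. by move=> b0 b0'; rewrite addf_div ?tofrac_eq0 // tofracD !tofracM. Qed.

Lemma fracM a b a' b' : a%:F / b%:F * (a'%:F / b'%:F) = (a * a')%:F / (b * b')%:F.
Proof. by rewrite mulf_div !tofracM. Qed.

Lemma frac_scale a b c : c != 0 -> a%:F / b%:F = (a * c)%:F / (b * c)%:F.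
Proof. by move=> c0; rewrite !tofracM -mulf_div divff ?mulr1 // tofrac_eq0. Qed.

Lemma frac_inv a b : a != 0 -> b != 0 -> a%:F / b%:F * (b%:F / a%:F) = 1.
Proof. by move=> a0 b0; rewrite fracM [b * a]mulrC divff // tofrac_eq0 mulf_neq0. Qed.

Lemma frac1 a : a%:F / 1%:F = a%:F.
Proof. by rewrite tofrac1 divr1. Qed.

End FractionCalculus.

Section Localization.
Variables (k : fieldType) (M : set (Fmod k)).
Local Notation A := (Aring k).
Local Notation S := (Salg k).
Local Notation F := {fraction S}.
Local Notation L := (rees_loc M).
Local Notation cc := (@const_coef k).
Local Notation "p %:F" := (@FracField.tofrac S p).
Implicit Types (a b s : S) (x : L).

Definition loc_val : {rmorphism L -> F} := val.

Lemma loc_val_inj : injective loc_val.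
Proof. exact: val_inj. Qed.

Lemma cc_neq0 b : cc b != 0 -> b != 0.
Proof. by apply: contraNneq => ->; rewrite const_coef0. Qed.

Lemma ccM_neq0 a b : cc a != 0 -> cc b != 0 -> cc (a * b) != 0.
Proof. by rewrite const_coefM => ca cb; apply: mulf_neq0. Qed.

Lemma rees_maxP b : rees M b -> rees_max M b <-> cc b = 0.
Proof. by move=> rb; split; [apply: const_coef_max|apply: rees_max_const_coef]. Qed.

(** The condition on the denominator is put through the constant coefficient, which is
    multiplicative; by [rees_maxP] it means lying outside the maximal ideal. *)
Definition loc_rep x a b := [/\ rees M a, rees M b, cc b != 0 & loc_val x = a%:F / b%:F].

Lemma loc_ex x : exists a b, loc_rep x a b.
Proof.
case: x => q qP; have /asboolP [a [b [ra rb nb qE]]] := qP.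
exists a, b; split => //; first by apply/eqP => cb; apply: nb; apply/rees_maxP.
Qed.

Lemma loc_make a b : rees M a -> rees M b -> cc b != 0 -> exists x, loc_rep x a b.
Proof.
move=> ra rb cb.
have qP : a%:F / b%:F \in rees_loc_pred M.
  apply/asboolP; exists a, b; split => //.
  by move=> /(rees_maxP rb) /eqP; rewrite (negbTE cb).
by exists (ReesLoc qP).
Qed.

Lemma loc_rep_eq x a b a' b' : loc_rep x a b -> loc_rep x a' b' -> a * b' = a' * b.
Proof.
move=> [_ _ nb xE] [_ _ nb']; rewrite xE.
exact: (frac_eq (cc_neq0 nb) (cc_neq0 nb')).
Qed.

Lemma loc_repD x x' a b a' b' : loc_rep x a b -> loc_rep x' a' b' ->
  loc_rep (x + x') (a * b' + a' * b) (b * b').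
Proof.
move=> [ra rb nb xE] [ra' rb' nb' xE']; split.
- exact: (rees_add (rees_mul ra rb') (rees_mul ra' rb)).
- exact: (rees_mul rb rb').
- exact: ccM_neq0.
by rewrite rmorphD xE xE'; exact: (fracD _ _ (cc_neq0 nb) (cc_neq0 nb')).
Qed.

Lemma loc_repM x x' a b a' b' : loc_rep x a b -> loc_rep x' a' b' ->
  loc_rep (x * x') (a * a') (b * b').
Proof.
move=> [ra rb nb xE] [ra' rb' nb' xE']; split; [exact: (rees_mul ra ra')|exact: (rees_mul rb rb')|exact: ccM_neq0|].
by rewrite rmorphM xE xE'; exact: fracM.
Qed.

Lemma loc_rep_scale x a b c : loc_rep x a b -> rees M c -> cc c != 0 ->
  loc_rep x (a * c) (b * c).
Proof.
move=> [ra rb nb xE] rc nc; split; [exact: (rees_mul ra rc)|exact: (rees_mul rb rc)|exact: ccM_neq0|].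
by rewrite xE; exact: (frac_scale _ _ (cc_neq0 nc)).
Qed.

Lemma loc_of s : rees M s -> exists x, loc_rep x s 1.
Proof.
move=> rs; apply: loc_make => //; first exact: rees1.
by rewrite const_coef1 oner_eq0.
Qed.

Lemma loc_rep1 x s : loc_rep x s 1 -> loc_val x = s%:F.
Proof. by case=> _ _ _ ->; exact: frac1. Qed.

Fact kloc_subproof c : (kS c : S)%:F \in rees_loc_pred M.
Proof.
apply/asboolP; exists (kS c), 1; split; try exact: rees_const.
  by move=> /(rees_maxP (rees1 M)) /eqP; rewrite const_coef1 oner_eq0.
exact: (esym (frac1 _)).
Qed.

Definition kloc c : L := ReesLoc (kloc_subproof c).

Lemma kloc_val c : loc_val (kloc c) = (kS c : S)%:F.
Proof. by []. Qed.

Fact kloc_additive : additive kloc.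
Proof.
move=> c d; apply: loc_val_inj; rewrite rmorphB !kloc_val -tofracB.
by rewrite /kS raddfB mpolyCB.
Qed.
HB.instance Definition _ := GRing.isAdditive.Build k L kloc kloc_additive.

Fact kloc_multiplicative : multiplicative kloc.
Proof.
split=> [c d|]; apply: loc_val_inj; rewrite ?rmorphM ?rmorph1 !kloc_val -?tofracM ?kSM //.
by rewrite kS1 tofrac1.
Qed.
HB.instance Definition _ := GRing.isMultiplicative.Build k L kloc kloc_multiplicative.

Lemma kloc_rep c : loc_rep (kloc c) (kS c) 1.
Proof.
split; [exact: rees_const|exact: rees1|by rewrite const_coef1 oner_eq0|].
exact: (esym (frac1 _)).
Qed.

(** A source of primes of the localization: kernels of morphisms from S to domains. It yields the
    maximal ideal and the whole chain used for the dimension. *)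
Definition loc_ker (D : idomainType) (f : {rmorphism S -> D}) : set L :=
  [set x | exists a b, loc_rep x a b /\ f a = 0].

Section LocKer.
Variables (D : idomainType) (f : {rmorphism S -> D}).
Hypothesis fcc : forall s, f s = 0 -> cc s = 0.

Lemma loc_ker_rep x a b : loc_rep x a b -> loc_ker f x <-> f a = 0.
Proof.
move=> xab; split; last by move=> fa; exists a, b.
case=> a' [b' [xab' fa']]; have [_ _ nb' _] := xab'.
have := congr1 f (loc_rep_eq xab xab'); rewrite !rmorphM fa' mul0r => /eqP.
rewrite mulf_eq0 => /orP [/eqP //|/eqP /fcc cb'].
by rewrite cb' eqxx in nb'.
Qed.

Lemma loc_ker_ideal : is_ideal (loc_ker f).
Proof.
split.
- have [r0 r1] := (rees0 M, rees1 M); exists 0, 1; split; last exact: rmorph0.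
  split => //; first by rewrite const_coef1 oner_eq0.
  by rewrite rmorph0 tofrac0 mul0r.
- move=> x x' [a [b [xab fa]]] [a' [b' [xab' fa']]].
  exists (a * b' + a' * b), (b * b'); split; first exact: loc_repD.
  by rewrite rmorphD !rmorphM fa fa' !mul0r addr0.
move=> c x [a [b [xab fa]]]; have [a' [b' cab]] := loc_ex c.
exists (a' * a), (b' * b); split; first exact: loc_repM.
by rewrite rmorphM fa mulr0.
Qed.

Lemma loc_ker_prime : prime_ideal (loc_ker f).
Proof.
split; first exact: loc_ker_ideal.
  have [x x1] := loc_of (rees1 M).
  have -> : 1 = x by apply: loc_val_inj; rewrite (loc_rep1 x1) rmorph1 tofrac1.
  by move=> /(loc_ker_rep x1) /eqP; rewrite rmorph1 oner_eq0.
move=> x x'; have [a [b xab]] := loc_ex x; have [a' [b' xab']] := loc_ex x'.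
move=> /(loc_ker_rep (loc_repM xab xab')) /eqP; rewrite rmorphM mulf_eq0.
by move=> /orP [] /eqP h; [left; apply/(loc_ker_rep xab)|right; apply/(loc_ker_rep xab')].
Qed.

End LocKer.

Lemma cc_additive : additive cc.
Proof. by move=> a b; rewrite /const_coef mcoeffB. Qed.

Definition ccoef : S -> k := cc.
HB.instance Definition _ := GRing.isAdditive.Build S k ccoef cc_additive.
Lemma ccoef_multiplicative : multiplicative ccoef.
Proof. by split; [apply: const_coefM|apply: const_coef1]. Qed.
HB.instance Definition _ := GRing.isMultiplicative.Build S k ccoef ccoef_multiplicative.

Definition mloc : set L := loc_ker ccoef.

Lemma mloc_rep x a b : loc_rep x a b -> mloc x <-> cc a = 0.
Proof. by apply: loc_ker_rep. Qed.

Lemma mloc_prime : prime_ideal mloc.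
Proof. by apply: loc_ker_prime. Qed.

Lemma mloc_unit x : ~ mloc x -> exists y, x * y = 1.
Proof.
have [a [b xab]] := loc_ex x; move=> /(mloc_rep xab) /eqP ca.
have [ra rb cb xE] := xab; have [y yba] := loc_make rb ra ca.
exists y; apply: loc_val_inj; have [_ _ _ yE] := yba.
by rewrite rmorphM xE yE rmorph1; exact: (frac_inv (cc_neq0 ca) (cc_neq0 cb)).
Qed.

Lemma mloc_split x : exists c, mloc (x - kloc c).
Proof.
have [a [b xab]] := loc_ex x; have [ra rb cb _] := xab.
exists (cc a / cc b).
have := loc_repD xab (loc_repM (kloc_rep (- 1)) (kloc_rep (cc a / cc b))).
rewrite -rmorphM mulN1r rmorphN => /mloc_rep h; apply/h.
rewrite !mulr1 const_coefD !const_coefM !const_coef_kS mulN1r.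
by rewrite mulNr divfK // subrr.
Qed.

(** An ideal of the localization is generated by its members with denominator 1, and these pull back
    to an ideal of the Noetherian ring [E]. *)
Lemma loc_noetherian (E : comNzRingType) (g : {rmorphism E -> S}) :
  noetherian E -> (forall e, rees M (g e)) -> (forall s, rees M s -> exists e, g e = s) ->
  noetherian L.
Proof.
move=> nE rg gr I Ii; have [I0 Ia Im] := Ii.
have /choice [h hP] : forall e, exists x, loc_rep x (g e) 1 by move=> e; apply: loc_of.
pose J : set E := [set e | I (h e)].
have hD e e' : h (e + e') = h e + h e'.
  by apply: loc_val_inj; rewrite rmorphD !(loc_rep1 (hP _)) rmorphD tofracD.
have hM e e' : h (e * e') = h e * h e'.
  by apply: loc_val_inj; rewrite rmorphM !(loc_rep1 (hP _)) rmorphM tofracM.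
have h0 : h 0 = 0 by apply: loc_val_inj; rewrite rmorph0 (loc_rep1 (hP _)) rmorph0 tofrac0.
have Ji : is_ideal J.
  split=> [|e e' Je Je'|c e Je]; rewrite /J /= ?h0 // ?hD ?hM; first exact: Ia.
  exact: Im.
have [s sE] := nE _ Ji; exists (map h s); apply/seteqP; split; last first.
  apply: ideal_gen_sub => // _ /mapP [e es ->].
  by have : J e by rewrite sE; apply: mem_ideal_gen.
move=> x Ix; have [a [b xab]] := loc_ex x; have [ra rb cb xE] := xab.
have [e ea] := gr _ ra; have [e' eb] := gr _ rb.
have heE : h e = x * h e'.
  apply: loc_val_inj; rewrite rmorphM !(loc_rep1 (hP _)) ea eb xE.
  by rewrite divfK // tofrac_eq0; exact: cc_neq0.
have : J e by rewrite /J /= heE mulrC; apply: Im.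
rewrite sE => -[c cE].
have [y yE] : exists y, h e' * y = 1.
  apply: mloc_unit => /(mloc_rep (hP e')); rewrite eb => cb0.
  by rewrite cb0 eqxx in cb.
have [G0 Ga Gm] := ideal_gen_ideal (map h s).
have -> : x = y * h e by rewrite heE [y * _]mulrC -mulrA yE mulr1.
apply/Gm; rewrite cE.
have -> : h (\sum_(i < size s) c i * s`_i) = \sum_(i < size s) h (c i) * h s`_i.
  by rewrite (big_morph h hD h0); apply: eq_bigr => i _; rewrite hM.
apply: ideal_sum; first exact: ideal_gen_ideal.
by move=> i _; apply/Gm/mem_ideal_gen/map_f/mem_nth.
Qed.

End Localization.

Arguments loc_val {k M}.

Section LocalizationInclusion.
Variables (k : fieldType) (M M' : set (Fmod k)) (MM : M `<=` M').

Fact loc_incl_subproof (x : rees_loc M) : val x \in rees_loc_pred M'.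
Proof.
have [a [b [ra rb cb xE]]] := loc_ex x.
have [y [_ _ _ yE]] := loc_make (rees_sub MM ra) (rees_sub MM rb) cb.
have -> : val x = val y := etrans xE (esym yE).
exact: valP.
Qed.

Definition loc_incl (x : rees_loc M) : rees_loc M' := ReesLoc (loc_incl_subproof x).

Lemma loc_inclE x : loc_val (loc_incl x) = loc_val x.
Proof. by []. Qed.

Fact loc_incl_additive : additive loc_incl.
Proof. by move=> x y; apply: loc_val_inj; rewrite rmorphB !loc_inclE rmorphB. Qed.
HB.instance Definition _ := GRing.isAdditive.Build _ _ loc_incl loc_incl_additive.

Fact loc_incl_multiplicative : multiplicative loc_incl.
Proof.
split=> [x y|]; apply: loc_val_inj; last by rewrite loc_inclE !rmorph1.
by rewrite rmorphM !loc_inclE rmorphM.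
Qed.
HB.instance Definition _ := GRing.isMultiplicative.Build _ _ loc_incl loc_incl_multiplicative.

Lemma loc_incl_inj : injective loc_incl.
Proof. by move=> x y /(congr1 val) /= /val_inj. Qed.

Lemma loc_incl_rep x a b : loc_rep x a b -> loc_rep (loc_incl x) a b.
Proof. by move=> [ra rb cb xE]; split => //; apply: rees_sub MM _ _. Qed.

End LocalizationInclusion.

Section FieldIdentities.
Variables (K : fieldType) (p s b D n r : K).

Lemma field_clear : b != 0 -> p * (s / b) * (b * D) = p * (s * D).
Proof. by move=> b0; field. Qed.

Lemma field_clear_term : D != 0 -> n / D * r * (b * D) = r * (n * b).
Proof. by move=> D0; field. Qed.

End FieldIdentities.

Section FractionSums.
Variable R : idomainType.
Local Notation "p %:F" := (@FracField.tofrac R p).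

Lemma tofrac_sum j (F : 'I_j -> R) : (\sum_i F i)%:F = \sum_i (F i)%:F.
Proof. exact: rmorph_sum. Qed.

(** Takes a relation between fractions to one between numerators, where graded regularity applies;
    [frac_sum] leads back. *)
Lemma frac_clear (p s b D : R) j (n r : nat -> R) : b != 0 -> D != 0 ->
  p%:F * (s%:F / b%:F) = \sum_(l < j) (n l)%:F / D%:F * (r l)%:F ->
  p * (s * D) = \sum_(l < j) r l * (n l * b).
Proof.
move=> b0 D0 E; apply/eqP; rewrite -tofrac_eq; apply/eqP.
have b0' : b%:F != 0 by rewrite tofrac_eq0.
have D0' : D%:F != 0 by rewrite tofrac_eq0.
rewrite !tofracM -(field_clear _ _ _ b0') E mulr_suml tofrac_sum.
by apply: eq_bigr => l _; rewrite !tofracM; exact: field_clear_term.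
Qed.

Lemma frac_sum (s b D : R) j (t r : nat -> R) : b != 0 -> D != 0 ->
  s * D = \sum_(l < j) r l * t l ->
  s%:F / b%:F = \sum_(l < j) (t l)%:F / (b * D)%:F * (r l)%:F.
Proof.
move=> b0 D0 E; rewrite (frac_scale _ _ D0) E tofrac_sum mulr_suml.
by apply: eq_bigr => l _; rewrite (tofracM (r l)) [_ * (t l)%:F]mulrC [RHS]mulrAC.
Qed.

End FractionSums.

Lemma loc_cross k (M : set (Fmod k)) (x x' : rees_loc M) a b a' b' :
  loc_rep x a b -> loc_rep x' a' b' -> a * b' = a' * b -> x = x'.
Proof.
move=> [ra rb nb xE] [ra' rb' nb' xE'] E; apply: loc_val_inj; rewrite xE xE'.
by apply/eqP; rewrite eqr_div ?tofrac_eq0 ?cc_neq0 // -!tofracM E.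
Qed.

Lemma loc_common k (M : set (Fmod k)) (c : nat -> rees_loc M) j :
  exists D (n : nat -> Salg k), [/\ rees M D, const_coef D != 0
    & forall l, (l < j)%N -> loc_rep (c l) (n l) D].
Proof.
elim: j => [|j [D [n [rD cD nD]]]].
  by exists 1, (fun=> 0); split; [exact: rees1|rewrite const_coef1 oner_eq0|].
have [a [b cab]] := loc_ex (c j); have [ra rb cb _] := cab.
exists (D * b), (fun l => if l == j then a * D else n l * b); split.
- exact: rees_mul.
- exact: ccM_neq0.
move=> l; rewrite ltnS leq_eqVlt => /predU1P [->|lt].
  by rewrite eqxx [D * b]mulrC; apply: loc_rep_scale.
by rewrite ltn_eqF //; apply: loc_rep_scale => //; apply: nD.
Qed.

Lemma ideal_pow3_sub (R : comNzRingType) (m I : set R) : is_ideal I ->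
  (forall a b c, m a -> m b -> m c -> I (a * b * c)) -> ideal_pow m 3 `<=` I.
Proof.
move=> Ii mI; have [I0 Ia Im] := Ii.
have quo a : is_ideal [set b | I (a * b)].
  split=> [|b c Ib Ic|b c Ic] /=; first by rewrite mulr0.
    by rewrite mulrDr; apply: Ia.
  by rewrite mulrCA; apply: Im.
apply: ideal_mul_sub => // a b ma; move: b; apply: ideal_mul_sub (quo a) _ => b c mb.
move: c; have q2 : is_ideal [set c | I (a * (b * c))].
  split=> [|c d Ic Id|c d Id] /=; first by rewrite !mulr0.
    by rewrite !mulrDr; apply: Ia.
  by rewrite [b * _]mulrCA [a * _]mulrCA; apply: Im.
apply: ideal_mul_sub q2 _ => c d mc _ /=; rewrite !mulrA; apply: ideal_mulr => //.
exact: mI.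
Qed.

Lemma mcoeff_linear (A : comNzRingType) n (c : 'I_n -> A) i :
  (\sum_j c j *: 'X_j : {mpoly A[n]})@_U_(i) = c i.
Proof.
rewrite raddf_sum /= (bigD1 i) //= mcoeffZ mcoeffX eqxx mulr1 big1 ?addr0 // => j ne.
rewrite mcoeffZ mcoeffX; case: eqP => [/(congr1 (fun m : 'X_{1..n} => m j))|_]; last by rewrite mulr0.
by rewrite !mnm1E eqxx eq_sym (negbTE ne).
Qed.

(** * The degree one component of R(M) and coefficients of power series *)

Section DegreeOne.
Variable k : fieldType.
Local Notation A := (Aring k).
Local Notation S := {mpoly A[2]}.

(** Leibniz' rule: a coefficient of degree one is the constant term of a partial derivative. *)
Lemma mcoeffM_U (p q : S) i : (p * q)@_U_(i) = p@_0%MM * q@_U_(i) + p@_U_(i) * q@_0%MM.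
Proof.
have d (f : S) : f@_U_(i) = (f^`M(i))@_0%MM.
  by rewrite mcoeff_mderiv mnm0E mulr1n add0m.
rewrite !d mderivM mcoeffD !(mcoeff0_is_multiplicative _ _).1.
by rewrite addrC [X in _ + X]mulrC mulrC.
Qed.

Lemma mcoeff_sym1 (v : 'cV[A]_2) i : (sym1 v)@_U_(i) = v i 0.
Proof.
exact: (mcoeff_linear (fun i => v i 0)).
Qed.

Lemma Msub_submodule : is_submodule (Msub k).
Proof.
split; first exact: Msub0.
  by move=> _ _ [u ->] [v ->]; exists (u + v); rewrite mulmxDr.
by move=> a _ [u ->]; exists (a *: u); rewrite -scalemxAr.
Qed.

Lemma rees_deg1 s : rees (Msub k) s -> exists2 v, Msub k v & forall i, s@_U_(i) = v i 0.
Proof.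
have [M0 MD MZ] := Msub_submodule.
move: s; apply: rees_ind => [a|v Mv|p q _ [u Mu uE] _ [v Mv vE]|p q _ [u Mu uE] _ [v Mv vE]].
- by exists 0 => // i; rewrite mcoeffC mnm1_eq0 mulr0 mxE.
- by exists v => // i; rewrite mcoeff_sym1.
- by exists (u + v); [apply: MD|move=> i; rewrite mcoeffD uE vE mxE].
exists (p@_0%MM *: v + q@_0%MM *: u); first by apply: MD; apply: MZ.
by move=> i; rewrite mcoeffM_U uE vE !mxE [_ * u i 0]mulrC.
Qed.


Lemma pscoefXn (i : 'I_2) j (f : A) m :
  pscoef (psX k i ^+ j * f) m = if (j <= m i)%N then pscoef f (m - U_(i) *+ j)%MM else 0.
Proof.
elim: j m f => [|j IH] m f; first by rewrite mul1r mulm0n subm0.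
rewrite exprSr -mulrA IH; case: ifP => [le|gt]; last by case: ifP => // /ltnW; rewrite gt.
rewrite pscoefXM mnmBE mulmnE mnm1E eqxx mul1n subn_gt0.
by case: ifP => // _; rewrite submDA mulmSr.
Qed.

Definition mn a b : 'X_{1..2} := (U_(ord0) *+ a + U_(ord_max) *+ b)%MM.

Lemma mn0 a b : mn a b ord0 = a.
Proof. by rewrite mnmDE !mulmnE !mnm1E eqxx mul1n mul0n addn0. Qed.

Lemma mn1 a b : mn a b ord_max = b.
Proof. by rewrite mnmDE !mulmnE !mnm1E eqxx mul1n mul0n add0n. Qed.

Lemma mnP (m m' : 'X_{1..2}) : m ord0 = m' ord0 -> m ord_max = m' ord_max -> m = m'.
Proof.
move=> e0 e1; apply/mnmP => i; have [->|n0] := eqVneq i ord0; first by [].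
by have -> : i = ord_max by apply: val_inj; case: i n0 => [[|[|//]]].
Qed.

Lemma mnE (m : 'X_{1..2}) : m = mn (m ord0) (m ord_max).
Proof. by apply: mnP; rewrite ?mn0 ?mn1. Qed.

Definition cf a b (f : A) : k := pscoef f (mn a b).

Lemma cfD a b f g : cf a b (f + g) = cf a b f + cf a b g.
Proof. by []. Qed.

Lemma cf0 a b : cf a b 0 = 0.
Proof. by []. Qed.

Lemma cfB a b f g : cf a b (f - g) = cf a b f - cf a b g.
Proof. by []. Qed.

Lemma cf_mulX i a b f :
  cf a b (Xvar k ^+ i * f) = if (i <= a)%N then cf (a - i) b f else 0.
Proof.
rewrite /cf pscoefXn mn0; case: ifP => // _; congr pscoef; apply: mnP;
  by rewrite mnmBE mulmnE mnm1E ?eqxx ?mn0 ?mn1 ?mul1n ?mul0n ?subn0.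
Qed.

Lemma cf_mulY i a b f :
  cf a b (Yvar k ^+ i * f) = if (i <= b)%N then cf a (b - i) f else 0.
Proof.
rewrite /cf pscoefXn mn1; case: ifP => // _; congr pscoef; apply: mnP;
  by rewrite mnmBE mulmnE mnm1E ?eqxx ?mn0 ?mn1 ?mul1n ?mul0n ?subn0.
Qed.

Lemma cf_mulX1 a b f : cf a b (Xvar k * f) = if (1 <= a)%N then cf (a - 1) b f else 0.
Proof. exact: (cf_mulX 1). Qed.

Lemma cf_const : cf 0 0 =1 (fun f => pscoef f 0%MM).
Proof. by move=> f; congr pscoef; apply: mnP; rewrite ?mn0 ?mn1 mnm0E. Qed.

Lemma Mmat_col (u : 'cV[A]_7) : exists c : nat -> A,
  (Mmat k *m u) ord0 0 = Xvar k ^+ 3 * c 0%N + Xvar k ^+ 2 * (Yvar k ^+ 2 * c 1%N)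
     + Xvar k * (Yvar k ^+ 3 * c 2) + Yvar k ^+ 5 * c 3 /\
  (Mmat k *m u) ord_max 0 = Xvar k ^+ 3 * c 2 + Xvar k ^+ 2 * (Yvar k ^+ 2 * c 4)
     + Xvar k * (Yvar k ^+ 4 * c 5) + Yvar k ^+ 5 * c 6.
Proof.
exists (fun j => u (inord j) 0); rewrite !mxE !big_ord_recl !big_ord0.
rewrite !mxE /= !mul0r !add0r !addr0 !mulrA.
rewrite !addrA; split.
  by congr (_ * u _ _ + _ * u _ _ + _ * u _ _ + _ * u _ _);
    apply: val_inj; rewrite /= inordK.
by congr (_ * u _ _ + _ * u _ _ + _ * u _ _ + _ * u _ _);
  apply: val_inj; rewrite /= inordK.
Qed.

(* Vanishes on M, since X Y^3 t1 + X^3 t2 is the only generator it sees. *)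
Definition msep (v : 'cV[A]_2) : k := cf 1 4 (v ord0 0) - cf 3 1 (v ord_max 0).

Lemma msep_Msub v : Msub k v -> msep v = 0.
Proof.
move=> [u ->]; have [c [e0 e1]] := Mmat_col u; rewrite /msep e0 e1.
rewrite !cfD !cf_mulX !cf_mulX1 !cf_mulY /=.
by rewrite !(addr0, add0r) subrr.
Qed.

Lemma msep_zvec : msep (zvec k) = 1.
Proof.
have e : (ord_max == ord0 :> 'I_2) = false by [].
rewrite /msep !mxE eqxx e cf0 subr0 -[_ * _ ^+ 4]mulr1 -mulrA cf_mulX1 cf_mulY.
by rewrite cf_const /= eqxx.
Qed.

Lemma zvec_notin : ~ Msub k (zvec k).
Proof. by move=> /msep_Msub; rewrite msep_zvec => /eqP; rewrite oner_eq0. Qed.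

Lemma w3_notin : ~ rees (Msub k) (sym1 (zvec k)).
Proof.
move=> /rees_deg1 [v Mv vE]; apply: zvec_notin.
suff -> : zvec k = v by [].
by apply/colP => i; rewrite -vE mcoeff_sym1.
Qed.

End DegreeOne.

(** * The Buchsbaum property *)

Section SplitFractions.
Variables (C : comNzRingType) (s b e q r Z a q0 X z : C).

Lemma split_frac : q = b * e -> s * e = r + a * q0 * z -> X = r - a * ((q - q0) * z) ->
  s * (q * (1 * 1)) = (X * (1 * 1) + a * z * q) * b.
Proof.
move=> qE se ->; have -> : s * (q * (1 * 1)) = b * (s * e) by rewrite qE; ring.
by rewrite se; ring.
Qed.

Lemma split_denom : (r + a * z) * (r - a * z) = r * r - a * a * (z * z).
Proof. by ring. Qed.

End SplitFractions.

Section ReesBuchsbaum.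
Variable k : fieldType.
Local Notation A := (Aring k).
Local Notation S := {mpoly A[2]}.
Local Notation cc := (@const_coef k).
Local Notation "p %:F" := (@FracField.tofrac (Salg k) p).
Local Notation x := ((Xvar k)%:MP : S).
Local Notation y := ((Yvar k)%:MP : S).
Local Notation t1 := ('X_ord0 : S).
Local Notation t2 := ('X_ord_max : S).
Local Notation w := (alg_basis x y t1 t2).
Local Notation T := (span_alg x y t1 t2 (phi k)).
Local Notation preg := (reg_alg x y t1 t2).
Local Notation L := (rees_loc (Msub k)).
Local Notation W := (rees_loc (@Mbar k)).
Local Notation incl := (loc_incl (@Msub_Mbar k)).

Lemma rees_loc_noetherian : noetherian L.
Proof.
pose g : {rmorphism {mpoly A[7]} -> S} := mpoly_morph (@mpolyC 2 A) (@sgen k).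
apply: (loc_noetherian (g := g)).
- by apply: noetherian_mpoly; apply: noetherian_pseries.
- apply: mpoly_ring_ind => [a|i|p q rp rq|p q rp rq].
  + rewrite /g mpoly_morphC; exact: rees_const.
  + rewrite /g mpoly_morphX; exact: rees_sgen.
  + rewrite rmorphD; exact: (rees_add rp rq).
  + rewrite (rmorphM g); exact: (rees_mul rp rq).
apply: rees_Msub_ind => [a|j|_ _ [p <-] [q <-]|_ _ [p <-] [q <-]].
- by exists a%:MP; exact: mpoly_morphC.
- by exists 'X_j; exact: mpoly_morphX.
- by exists (p + q); exact: rmorphD.
by exists (p * q); exact: rmorphM.
Qed.

Variable z : W.
Hypothesis zE : loc_rep z (w 3) 1.

Lemma cc_w3 : cc (w 3) = 0.
Proof. exact: const_coef_basis. Qed.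

(** A denominator be + c z is moved into R(M) by its conjugate be - c z, since z^2 lies in R(M). A
    fraction (r + d z) / q then has z-part (d / q_0) z, where q_0 is the constant coefficient of q,
    because (q - q_0) z lies in R(M). *)
Lemma loc_split om : exists x a, om = incl x + incl (kloc (Msub k) a) * z.
Proof.
have [s [b omE]] := loc_ex om; have [rs rb cb _] := omE.
have [be [c [rbe bE]]] := rees_Mbar_split rb.
pose e : Salg k := be - kS c * w 3.
pose q : Salg k := b * e.
have qE : q = be * be - kS c * kS c * (w 3 * w 3) by rewrite /q /e bE; exact: split_denom.
have rc := rees_kS (Msub k) c.
have rq : rees (Msub k) q.
  rewrite qE; exact: (rees_add (rees_mul rbe rbe) (rees_opp (rees_mul (rees_mul rc rc) (@rees_zz k)))).
have cz d : cc (kS d * w 3) = 0 by rewrite const_coefM cc_w3 mulr0.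
have cbe : cc be = cc b by rewrite bE const_coefD cz addr0.
have ce : cc e = cc be.
  have := const_coefD e (kS c * w 3); rewrite cz addr0 => <-; congr cc; exact: subrK.
have cq : cc q != 0 by rewrite /q const_coefM ce cbe mulf_neq0.
have re : rees (@Mbar k) e.
  apply: (rees_add (rees_sub (@Msub_Mbar k) rbe)); apply: rees_opp.
  exact: (rees_mul (rees_kS _ _) (@rees_zvec k)).
have [r [d [rr seE]]] := rees_Mbar_split (rees_mul rs re).
pose a := d / cc q; pose X : Salg k := r - kS a * ((q - kS (cc q)) * w 3).
have rX : rees (Msub k) X.
  exact: (rees_add rr (rees_opp (rees_mul (rees_kS _ _) (rees_zmul rq)))).
have [x xE] := loc_make rX rq cq; exists x, a.
apply: (loc_cross omE (loc_repD (loc_incl_rep (@Msub_Mbar k) xE)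
  (loc_repM (loc_incl_rep (@Msub_Mbar k) (kloc_rep (Msub k) a)) zE))).
apply: (split_frac (erefl _) _ (erefl _)); rewrite -kSM divfK //; exact: seE.
Qed.

Lemma mloc_zmul x : mloc x -> exists2 y, mloc y & incl x * z = incl y.
Proof.
have [a [b xE]] := loc_ex x; have [ra rb cb _] := xE => /(mloc_rep xE) ca.
have raz : rees (Msub k) (a * w 3).
  by have := rees_zmul ra; rewrite ca kS0 subr0.
have [y yE] := loc_make raz rb cb; exists y.
  by apply/(mloc_rep yE); rewrite const_coefM cc_w3 mulr0.
apply: (loc_cross (loc_repM (loc_incl_rep (@Msub_Mbar k) xE) zE)
  (loc_incl_rep (@Msub_Mbar k) yE)).
rewrite mulr1; exact: erefl.
Qed.

(** If z = a / b, then b_0 z = a - (b - b_0) z lies in R(M), where b_0 is the nonzero constant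
    coefficient of b; but z is not in R(M). *)
Lemma z_notin x : z <> incl x.
Proof.
move=> zx; have [a [b xE]] := loc_ex x; have [ra rb cb _] := xE.
have xE' := loc_incl_rep (@Msub_Mbar k) xE; rewrite -zx in xE'.
have := loc_rep_eq zE xE'; rewrite mulr1 => E.
apply: (@w3_notin k); rewrite sym1_zvec.
have h : rees (Msub k) (kS (cc b) * w 3).
  have -> : kS (cc b) * w 3 = a - (b - kS (cc b)) * w 3.
    by rewrite mulrBl [b * _]mulrC E subKr.
  exact: (rees_add ra (rees_opp (rees_zmul rb))).
have := rees_mul (rees_kS (Msub k) (cc b)^-1) h.
have scale (C : comNzRingType) (c c' z' : C) : c' * c = 1 -> c' * (c * z') = z'.
  by move=> cc1; rewrite mulrA cc1 mul1r.
by rewrite scale // -kSM mulVf // kS1.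
Qed.

Variable p : nat -> L.
Hypothesis pE : forall j, (j < 4)%N -> loc_rep (p j) (preg j) 1.

Lemma preg_max j : (j < 4)%N -> rees (Msub k) (preg j) /\ cc (preg j) = 0.
Proof.
have [_ [ru1 ru2 ru3 _]] := rees_Msub_gens k.
have [[cx cy] [c1 c2 c3]] := (const_coef_xy k, const_coef_red k).
have [rx ry] := (rees_x k, rees_y k).
case: j => [|[|[|[|//]]]] _; rewrite /reg_alg [nth _ _ _]/=; split => //.
  exact: (rees_add ru3 (rees_opp rx)).
by rewrite (@cc_additive k (red_u3 y t2) x) c3 cx subrr.
Qed.

Lemma p_max j : (j < 4)%N -> mloc (p j).
Proof. by move=> lt; apply/(mloc_rep (pE lt)); have [] := preg_max lt. Qed.

Lemma p_regular j om : (j < 4)%N ->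
  pre_ideal (incl \o p) j (incl (p j) * om) -> pre_ideal (incl \o p) j om.
Proof.
move=> lt [c cE]; have [s [b omE]] := loc_ex om; have [rs rb cb omv] := omE.
have [D [n [rD cD nE]]] := loc_common c j.
have pv l : (l < 4)%N -> loc_val (incl (p l)) = (preg l)%:F.
  by move=> lt'; exact: (loc_rep1 (loc_incl_rep (@Msub_Mbar k) (pE lt'))).
have [b0 D0] := (cc_neq0 cb, cc_neq0 cD).
have lt4 (l : 'I_j) : (l < 4)%N := ltn_trans (ltn_ord l) lt.
have : preg j * (s * D) = \sum_(l < j) preg l * (n l * b).
  apply: (frac_clear b0 D0).
  have := congr1 loc_val cE; rewrite rmorphM omv pv // rmorph_sum => ->.
  apply: eq_bigr => l _; have [_ _ _ nv] := nE l (ltn_ord l).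
  by rewrite rmorphM nv; congr (_ * _); exact: pv.
move=> h; have [||t [Tt tE]] := @reg_alg_regular k j (s * D) lt.
- exact/rees_spanP/rees_mul.
- exists (fun l => if (l < j)%N then n l * b else 0); split.
    move=> l; apply/rees_spanP; case: ifP => [ltl|_]; last exact: rees0.
    by have [rn _ _ _] := nE l ltl; exact: rees_mul.
  by rewrite h; apply: eq_bigr => l _; rewrite ltn_ord.
have /choice [d dE] : forall l, exists d : W, loc_rep d (t l) (b * D).
  by move=> l; apply: loc_make; [apply/rees_spanP|apply: rees_mul|apply: ccM_neq0].
exists d; apply: loc_val_inj; rewrite omv rmorph_sum.
etransitivity; first exact: (frac_sum b0 D0 tE).
apply: eq_bigr => l _; have [_ _ _ dv] := dE l.
by rewrite [RHS]rmorphM dv; congr (_ * _); exact: (esym (pv l (lt4 l))).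
Qed.

(** A product of two members of m is a combination of the parameters with coefficients in R'; a
    third factor from m brings these coefficients back into R. *)
Lemma mloc_pow3 : ideal_pow (mloc (M := Msub k)) 3 `<=` pre_ideal p 4.
Proof.
apply: ideal_pow3_sub; first exact: pre_ideal_ideal.
move=> a1 a2 a3 m1 m2 m3.
have [s1 [b1 a1E]] := loc_ex a1; have [s2 [b2 a2E]] := loc_ex a2.
have [s3 [b3 a3E]] := loc_ex a3.
move/(mloc_rep a1E): m1 => c1; move/(mloc_rep a2E): m2 => c2; move/(mloc_rep a3E): m3 => c3.
have [r1 rb1 cb1 _] := a1E; have [r2 rb2 cb2 _] := a2E; have [r3 rb3 cb3 _] := a3E.
have TS s : rees (Msub k) s -> T s.
  by move=> rs; apply/rees_spanP; apply: rees_sub rs; exact: Msub_Mbar.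
have [t [Tt tE]] := span_max_mul (TS _ r1) (TS _ r2) c1 c2.
have aE := loc_repM (loc_repM a1E a2E) a3E; have [_ rb cb av] := aE.
have rt l : rees (Msub k) (t l * s3).
  have /rees_Mbar_split [r [c [rr ->]]] : rees (@Mbar k) (t l) by apply/rees_spanP.
  have rz : rees (Msub k) (s3 * w 3) by have := rees_zmul r3; rewrite c3 kS0 subr0.
  rewrite mulrDl -mulrA [w 3 * s3]mulrC; exact: (rees_add (rees_mul rr r3) (rees_mul (rees_kS _ _) rz)).
have /choice [d dE] : forall l, exists d : L, loc_rep d (t l * s3) (b1 * b2 * b3 * 1).
  by move=> l; apply: loc_make; rewrite ?mulr1.
exists d; apply: loc_val_inj; rewrite av rmorph_sum.
have E : s1 * s2 * s3 * 1 = \sum_(l < 4) preg l * (t l * s3).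
  rewrite mulr1 tE mulr_suml; apply: eq_bigr => l _; exact: (esym (mulrA _ _ _)).
etransitivity; first exact: (frac_sum (t := fun l => t l * s3) (r := preg) (cc_neq0 cb) (oner_neq0 _) E).
apply: eq_bigr => l _; have [_ _ _ dv] := dE l.
by rewrite [RHS]rmorphM dv; congr (_ * _); exact: (esym (loc_rep1 (pE (ltn_ord l)))).
Qed.

End ReesBuchsbaum.

Lemma alg_basis_morph (C D : comNzRingType) (f : {rmorphism C -> D}) (x y t1 t2 : C) :
  f (alg_basis x y t1 t2 1) = f x ^+ 3 * f t1 /\
  f (alg_basis x y t1 t2 4) = f x ^+ 2 * f y ^+ 2 * f t2.
Proof. by rewrite /alg_basis /= !rmorphM. Qed.

(** * A chain of primes of length 4 *)

Section PrimeChain.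
Variable k : fieldType.
Local Notation A := (Aring k).
Local Notation S := {mpoly A[2]}.
Local Notation cc := (@const_coef k).
Local Notation x := ((Xvar k)%:MP : S).
Local Notation y := ((Yvar k)%:MP : S).
Local Notation t1 := ('X_ord0 : S).
Local Notation t2 := ('X_ord_max : S).
Local Notation w := (alg_basis x y t1 t2).

(** The maps [kill_mor j] set t_2, t_1, Y, X to zero in this order, one more at each step. *)
Definition kill_ps (j : nat) : {rmorphism A -> A} :=
  if (j <= 2)%N then idfun : {rmorphism A -> A} else
  if j == 3 then ps_kill ord_max : {rmorphism A -> A} else
  ps_kill ord0 \o ps_kill ord_max : {rmorphism A -> A}.

Definition kill_var (j : nat) (i : 'I_2) : S :=
  if j == 0%N then 'X_i else if (j == 1%N) && (i == ord0) then 'X_i else 0.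

Definition kill_mor (j : nat) : {rmorphism S -> S} :=
  mpoly_morph (@mpolyC 2 A \o kill_ps j) (kill_var j).

Lemma kill_morC j a : kill_mor j a%:MP = (kill_ps j a)%:MP.
Proof. exact: mpoly_morphC. Qed.

Lemma kill_morX j i : kill_mor j 'X_i = kill_var j i.
Proof. exact: mpoly_morphX. Qed.

Lemma kill_ps_const j a : pscoef (kill_ps j a) 0%MM = pscoef a 0%MM.
Proof.
rewrite /kill_ps; case: ifP => _ //; case: ifP => _ /=; by rewrite !mnm0E.
Qed.

Lemma cc_kill_mor j s : cc (kill_mor j s) = cc s.
Proof.
move: s; refine (@mpoly_morph_eq A k 2 (@ccoef k \o kill_mor j) (@ccoef k) _ _) => [a|i].
  apply: (etrans (congr1 cc (kill_morC j a))).
  by rewrite [LHS]const_coefC kill_ps_const; exact: (esym (const_coefC _)).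
apply: (etrans (congr1 cc (kill_morX j i))).
have cX : cc ('X_i : S) = 0 by rewrite /const_coef mcoeffX mnm1_eq0.
apply: etrans (esym cX); rewrite /kill_var.
by do ?[case: ifP => _]; rewrite ?cX ?const_coef0.
Qed.

Lemma kill_psS j a : kill_ps j.+1 (kill_ps j a) = kill_ps j.+1 a.
Proof.
case: j => [|[|[|[|j]]]] //; rewrite /kill_ps /=.
  by rewrite ps_kill_idem.
by apply: pseriesP => m /=; do ?case: ifP.
Qed.

Lemma kill_morS j s : kill_mor j.+1 (kill_mor j s) = kill_mor j.+1 s.
Proof.
move: s; refine (@mpoly_morph_eq A S 2 (kill_mor j.+1 \o kill_mor j) (kill_mor j.+1) _ _) => [a|i].
  apply: (etrans (congr1 (kill_mor j.+1) (kill_morC j a))).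
  by rewrite !kill_morC kill_psS.
apply: (etrans (congr1 (kill_mor j.+1) (kill_morX j i))).
rewrite [RHS]kill_morX /kill_var [j.+1 == 0%N]/=.
case: ifP => [_|j0]; first exact: kill_morX.
case: ifP => [_|_]; first exact: kill_morX.
rewrite rmorph0; case: ifP => // /andP [/eqP [j1]]; by rewrite j1 in j0.
Qed.

(** Strictness is needed inside R(M), so t_2 and t_1 are replaced by the members X^2 Y^2 t_2 and X^3
    t_1. *)
Lemma kill_witness j : (j < 4)%N ->
  exists s, [/\ rees (Msub k) s, kill_mor j.+1 s = 0 & kill_mor j s <> 0].
Proof.
have [X0 Y0] := A_neq0 k.
have [[rw1 _ rw4 _] _] := rees_Msub_gens k.
have C0 (a : A) : a != 0 -> (a%:MP : S) != 0 by rewrite mpolyC_eq0.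
have t0 i : ('X_i : S) != 0.
  apply/eqP => /(congr1 (mcoeff U_(i)%MM)); rewrite mcoeffX eqxx mcoeff0 => /eqP.
  by rewrite oner_eq0.
have vE n a : kill_mor n 'X_a = kill_var n a := kill_morX n a.
have m3 (D : idomainType) (a b c : D) : a != 0 -> b != 0 -> c != 0 -> a ^+ 2 * b ^+ 2 * c <> 0.
  by move=> a0 b0 c0; apply/eqP; rewrite !mulf_neq0 ?expf_neq0.
have m2 (D : idomainType) (a b : D) : a != 0 -> b != 0 -> a ^+ 3 * b <> 0.
  by move=> a0 b0; apply/eqP; rewrite !mulf_neq0 ?expf_neq0.
have z0 (D : comNzRingType) (a b : D) : b = 0 -> a * b = 0 by move=> ->; rewrite mulr0.
have kill (i l : 'I_2) : ps_kill l (psX k i) = if i == l then 0 else psX k i by exact: ps_killX.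
case: j => [|[|[|[|//]]]] _.
- exists (w 4); have [_ e0] := alg_basis_morph (kill_mor 0) x y t1 t2.
  have [_ e1] := alg_basis_morph (kill_mor 1) x y t1 t2; split=> //.
    by rewrite e1; apply: z0; rewrite vE.
  rewrite e0 vE !kill_morC; apply: m3; [exact: (C0 _ X0)|exact: (C0 _ Y0)|exact: t0].
- exists (w 1); have [e1 _] := alg_basis_morph (kill_mor 1) x y t1 t2.
  have [e2 _] := alg_basis_morph (kill_mor 2) x y t1 t2; split=> //.
    by rewrite e2; apply: z0; rewrite vE.
  rewrite e1 vE !kill_morC; apply: m2; [exact: (C0 _ X0)|exact: t0].
- exists y; split; first exact: rees_y.
    rewrite kill_morC /kill_ps /= kill eqxx; exact: mpolyC0.
  by rewrite kill_morC; apply/eqP; exact: (C0 _ Y0).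
exists x; split; first exact: rees_x.
  rewrite kill_morC /kill_ps /= kill (_ : (ord0 == ord_max :> 'I_2) = false) // kill eqxx.
  exact: mpolyC0.
rewrite kill_morC /kill_ps /= kill (_ : (ord0 == ord_max :> 'I_2) = false) //.
by apply/eqP; exact: (C0 _ X0).
Qed.

Lemma rees_prime_chain :
  strict_chain (@prime_ideal (rees_loc (Msub k))) 4 (fun j => loc_ker (M := Msub k) (kill_mor j)).
Proof.
have kcc j s : kill_mor j s = 0 -> cc s = 0.
  by move=> s0; rewrite -(cc_kill_mor j) s0; exact: const_coef0.
split=> [j _|j lt]; first refine (@loc_ker_prime k (Msub k) _ _ (@kcc j)).
split.
  move=> a [s [b [aE s0]]]; exists s, b; split => //.
  by rewrite -kill_morS s0 rmorph0.
have [s [rs s1 s0]] := kill_witness lt; have [a aE] := loc_of rs.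
move=> /(_ a) h; apply: s0; apply/(loc_ker_rep (@kcc j) aE)/h.
exact/(loc_ker_rep (@kcc j.+1) aE).
Qed.

Lemma Msub_buchsbaum : rees_buchsbaum (Msub k).
Proof.
have [z zE] := loc_of (rees_zvec k).
have /choice [p pE] : forall j, exists p, (j < 4)%N ->
    loc_rep (M := Msub k) p (reg_alg x y t1 t2 j) 1.
  move=> j; case: (ltnP j 4) => [lt|_]; last by exists 0.
  by have [rp _] := preg_max k lt; have [p pE] := loc_of rp; exists p.
apply: (@buchsbaum_criterion k (rees_loc (Msub k)) (rees_loc (@Mbar k)) (kloc (Msub k))
  (loc_incl (@Msub_Mbar k)) (@mloc k (Msub k)) z).
- exact: loc_incl_inj.
- exact: rees_loc_noetherian.
- by have [] := mloc_prime (Msub k).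
- by have [] := mloc_prime (Msub k).
- exact: mloc_unit.
- exact: mloc_split.
- exact: (loc_split zE).
- exact: (mloc_zmul zE).
- exact: (z_notin zE).
- exact: (p_max pE).
- exact: (p_regular pE).
- exact: (mloc_pow3 pE).
exact: rees_prime_chain.
Qed.

End PrimeChain.

(** * Closures *)

Section WeightedOrder.
Variable k : fieldType.
Variable (wX wY : nat).
Hypothesis wY0 : (0 < wY)%N.
Local Notation A := (pseries 2 k).
Implicit Types (f g : A) (m : 'X_{1..2}) (o : nat).

Definition wt m := (wX * m ord0 + wY * m ord_max)%N.

Lemma wtD m m' : wt (m + m')%MM = (wt m + wt m')%N.
Proof. by rewrite /wt !mnmDE !mulnDr addnACA. Qed.

Definition ordge o f := forall m, pscoef f m != 0 -> (o <= wt m)%N.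

Lemma ordgeP o f : ordge o f <-> forall m, (wt m < o)%N -> pscoef f m = 0.
Proof.
split=> [fo m lt|fo m]; last by apply: contraNT; rewrite -ltnNge => /fo ->.
by apply/eqP; apply: contraTT lt => /fo; rewrite -leqNgt.
Qed.

Lemma ordge0 o : ordge o 0.
Proof. by move=> m; rewrite eqxx. Qed.

Lemma ordge_leq o o' f : (o' <= o)%N -> ordge o f -> ordge o' f.
Proof. by move=> le fo m /fo; apply: leq_trans. Qed.

Lemma ordgeD o f g : ordge o f -> ordge o g -> ordge o (f + g).
Proof.
move=> /ordgeP fo /ordgeP go; apply/ordgeP => m lt.
by rewrite pscoefD fo ?go ?addr0.
Qed.

Lemma ordgeN o f : ordge o f -> ordge o (- f).
Proof. by move=> /ordgeP fo; apply/ordgeP => m lt; rewrite /= fo ?oppr0. Qed.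

Lemma ordge_sum (I : finType) (P : pred I) o (F : I -> A) :
  (forall i, P i -> ordge o (F i)) -> ordge o (\sum_(i | P i) F i).
Proof. by move=> h; elim/big_rec: _ => [|i f Pi]; [exact: ordge0|apply/ordgeD/h]. Qed.

Lemma ordgeM o o' f g : ordge o f -> ordge o' g -> ordge (o + o') (f * g).
Proof.
move=> /ordgeP fo /ordgeP go; apply/ordgeP => m lt.
rewrite pscoefM big1 // => l /eqP mE.
have [lt1|le1] := ltnP (wt l.1) o; first by rewrite fo ?mul0r.
rewrite [pscoef g _]go ?mulr0 //.
have := congr1 wt mE; rewrite wtD => e; rewrite e in lt.
by rewrite -(ltn_add2l o); apply: leq_trans lt; rewrite ltnS leq_add2r.
Qed.

Lemma ordge_exp o f n : ordge o f -> ordge (o * n) (f ^+ n).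
Proof.
move=> fo; elim: n => [|n IH]; first by rewrite muln0.
by rewrite exprS mulnS; apply: ordgeM.
Qed.

(* m is the lowest exponent of f, for the weight refined by the exponent of X. *)
Definition lead f m := pscoef f m != 0 /\
  forall m', pscoef f m' != 0 -> (wt m < wt m')%N \/ wt m' = wt m /\ (m ord0 <= m' ord0)%N.

Lemma lead_exists f : f != 0 -> exists m, lead f m.
Proof.
move=> f0; have [m0 fm0] : exists m, pscoef f m != 0.
  apply: contrapT => nex; case/eqP: f0; apply: pseriesP => m.
  by apply/eqP; apply: contrapT => /negP fm; apply: nex; exists m.
have exo : exists o, `[< exists m, wt m = o /\ pscoef f m != 0 >].
  by exists (wt m0); apply/asboolP; exists m0.
case: (ex_minnP exo) => o /asboolP [m1 [m1o fm1]] omin.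
have exa : exists a, `[< exists m, [/\ m ord0 = a, wt m = o & pscoef f m != 0] >].
  by exists (m1 ord0); apply/asboolP; exists m1.
case: (ex_minnP exa) => a /asboolP [m [ma mo fm]] amin.
exists m; split=> // m' fm'; have := omin (wt m').
rewrite leq_eqVlt mo => /(_ (asboolT (ex_intro _ m' (conj erefl fm')))) /orP [/eqP e|lt]; last by left.
right; split=> //; rewrite ma; apply: amin; apply/asboolP; exists m'.
by rewrite -e.
Qed.

(** As wY is positive, weight and exponent of X determine a monomial, so the sum of the lowest
    exponents is reached by one pair only. *)
Lemma leadM f g m m' : lead f m -> lead g m' -> lead (f * g) (m + m')%MM.
Proof.
move=> [fm fl] [gm gl]; split; last first.
  move=> u; rewrite pscoefM => nz.
  have [l lE /andP [fl1 gl2]] : exists2 l : 'X_{1..2 < (mdeg u).+1, (mdeg u).+1},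
      u = (l.1 + l.2)%MM & (pscoef f l.1 != 0) && (pscoef g l.2 != 0).
    apply: contrapT => nex; case/eqP: nz; rewrite big1 // => l /eqP lE; apply/eqP.
    apply: contrapT => /negP; rewrite mulf_eq0 negb_or => h; apply: nex.
    by exists l.
  have := congr1 (fun v : 'X_{1..2} => v ord0) lE; have := congr1 wt lE.
  rewrite !wtD !mnmDE => -> ->.
  by case: (fl _ fl1) => [|[]]; case: (gl _ gl2) => [|[]]; lia.
rewrite pscoefM; set u := (m + m')%MM.
have lt1 : (mdeg m < (mdeg u).+1)%N by rewrite mdegD ltnS leq_addr.
have lt2 : (mdeg m' < (mdeg u).+1)%N by rewrite mdegD ltnS leq_addl.
rewrite (bigD1 (BMultinom lt1, BMultinom lt2)) //= big1 ?addr0 ?mulf_neq0 //.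
move=> [[k1 h1] [k2 h2]] /= /andP [/eqP uE ne].
apply/eqP; rewrite mulf_eq0; apply: contraNT ne; rewrite negb_or => /andP [f1 g2].
have uw : (wt m + wt m' = wt k1 + wt k2)%N by rewrite -!wtD -uE.
have u0 : (m ord0 + m' ord0 = k1 ord0 + k2 ord0)%N.
  by have := congr1 (fun v : 'X_{1..2} => v ord0) uE; rewrite !mnmDE.
have [e1 e2] : wt k1 = wt m /\ k1 ord0 = m ord0.
  by case: (fl _ f1) => [|[]]; case: (gl _ g2) => [|[]]; lia.
have e3 : k1 = m.
  apply: mnP => //; move: e1; rewrite /wt e2 => /addnI /eqP.
  by rewrite eqn_pmul2l // => /eqP.
have e4 : k2 = m' by apply: (@addmI _ m); rewrite -{1}e3 -uE.
by rewrite xpair_eqE -!val_eqE /= e3 e4 !eqxx.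
Qed.

Lemma lead1 : lead 1 0%MM.
Proof.
split; first by rewrite /= eqxx oner_eq0.
by move=> m' _; rewrite /wt !mnm0E; lia.
Qed.

Lemma lead_exp f m n : lead f m -> lead (f ^+ n) (m *+ n)%MM.
Proof.
move=> fm; elim: n => [|n IH]; first exact: lead1.
by rewrite exprS mulmS; apply: leadM.
Qed.

Lemma lead_psX (i : 'I_2) : lead (psX k i) U_(i)%MM.
Proof.
split; first by rewrite /= eqxx oner_eq0.
by move=> m' /=; case: (m' =P _) => [-> _|_]; [right|rewrite eqxx].
Qed.

Lemma lead_ordge f m : lead f m -> ordge (wt m) f.
Proof. by move=> [_ fl] m' /fl [/ltnW|[-> _]]. Qed.

Lemma wtMn m n : wt (m *+ n)%MM = (wt m * n)%N.
Proof. by rewrite /wt !mulmnE !mulnA mulnDl. Qed.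

Lemma ordge_cancel i e N o f : wt (U_(i) *+ e)%MM = N ->
  ordge (o + N) (psX k i ^+ e * f) -> ordge o f.
Proof.
move=> wN fo; have [->|f0] := eqVneq f 0; first exact: ordge0.
have [m fm] := lead_exists f0.
have [nz _] := leadM (lead_exp e (lead_psX i)) fm.
have := fo _ nz; rewrite wtD wN [(N + _)%N]addnC leq_add2r => le.
exact: ordge_leq le (lead_ordge fm).
Qed.

(* Valuation rings are integrally closed: compare lowest terms. *)
Lemma ordge_integral N n (s : A) (c : nat -> A) :
  (forall i, (i < n)%N -> ordge (N * (n - i)) (c i)) ->
  s ^+ n + \sum_(i < n) c i * s ^+ i = 0 -> ordge N s.
Proof.
move=> cN E; have [->|s0] := eqVneq s 0; first exact: ordge0.
have [m sm] := lead_exists s0; have so := lead_ordge sm.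
have [le|lt] := leqP N (wt m); first exact: ordge_leq le so.
have [/negP nz _] := lead_exp n sm; case: nz; apply/eqP.
have := congr1 (fun f => pscoef f (m *+ n)%MM) E; rewrite pscoefD.
have /ordgeP h : ordge (wt m * n).+1 (\sum_(i < n) c i * s ^+ i).
  apply: ordge_sum => i _.
  have := ordgeM (cN i (ltn_ord i)) (@ordge_exp _ _ i so); apply: ordge_leq.
  have := ltn_ord i; move: (wt m) lt (val i) => o lt i' lti.
  by rewrite -[in X in (X < _)%N](subnKC (ltnW lti)) mulnDr addnC ltn_add2r ltn_pmul2r ?subn_gt0.
by rewrite h ?addr0 // wtMn.
Qed.

End WeightedOrder.

Lemma morph_comb (C D : comNzRingType) (f : {rmorphism C -> D}) (a b t1 t2 : C) :
  f (a * t1 + b * t2) = f a * f t1 + f b * f t2.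
Proof. by rewrite rmorphD !rmorphM. Qed.

Lemma polyC_comb (C : comNzRingType) (a b c d : C) :
  a%:P * (c%:P * 'X) + b%:P * (d%:P * 'X) = (a * c + b * d)%:P * 'X.
Proof. by rewrite polyCD !polyCM mulrDl !mulrA. Qed.

Lemma morph_linear_mul (C D : comNzRingType) (f : {rmorphism C -> {poly D}}) s t (a b : D) l :
  f s = a%:P * 'X -> f t = b%:P * 'X -> f (s * t ^+ l) = (a * b ^+ l)%:P * 'X^(l.+1).
Proof.
move=> fs ft; rewrite rmorphM rmorphXn fs ft exprMn polyCM rmorphXn exprS -!mulrA.
by congr (_ * _); rewrite mulrCA.
Qed.

Lemma morph_linear_coef (C D : comNzRingType) (f : {rmorphism C -> {poly D}}) c s (a : D) i n :
  (i <= n)%N -> f s = a%:P * 'X -> (f (c * s ^+ i))`_n = (f c)`_(n - i) * a ^+ i.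
Proof.
move=> le fs; rewrite rmorphM rmorphXn fs exprMn -rmorphXn mulrA.
by rewrite coefMXn coefMC ltnNge le.
Qed.

Section ClosureTest.
Variable k : fieldType.
Variables (wX wY : nat) (N e : nat) (al be : Aring k) (i0 : 'I_2) (j0 : 'I_7).
Local Notation A := (Aring k).
Local Notation S := {mpoly A[2]}.
Local Notation ordge := (ordge wX wY).

(** A linear form on F, to be tested by a weighted order. [Psi] extends it to S, with a variable
    that records the degree. *)
Definition psi (v : 'cV[A]_2) : A := v ord0 0 * al + v ord_max 0 * be.

Hypothesis wY0 : (0 < wY)%N.
Hypothesis gN : forall j, ordge N (psi (col j (Mmat k))).
Hypothesis g0 : psi (col j0 (Mmat k)) = psX k i0 ^+ e.
Hypothesis wN : wt wX wY (U_(i0) *+ e)%MM = N.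

Definition Psi : {rmorphism S -> {poly A}} :=
  mpoly_morph (@polyC A) (fun i => (nth 0 [:: al; be] i)%:P * 'X).

Lemma PsiC a : Psi a%:MP = a%:P.
Proof. exact: mpoly_morphC. Qed.

Lemma PsiX : Psi 'X_ord0 = al%:P * 'X /\ Psi 'X_ord_max = be%:P * 'X.
Proof. by have [n1 n2] := nth_ord2 0 al be; split; rewrite /Psi mpoly_morphX ?n1 ?n2. Qed.

Lemma Psi_sym1 v : Psi (sym1 v) = (psi v)%:P * 'X.
Proof.
have [h1 h2] := PsiX; have := polyC_comb (v ord0 0) (v ord_max 0) al be.
rewrite -h1 -h2 -(PsiC (v ord0 0)) -(PsiC (v ord_max 0)) => <-.
rewrite sym1E; exact: (morph_comb Psi).
Qed.

Lemma Psi_ord s n : rees (Msub k) s -> ordge (N * n) (Psi s)`_n.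
Proof.
move=> rs; move: s rs n; apply: rees_Msub_ind => [a|j|s t hs ht|s t hs ht] n.
- rewrite PsiC coefC; case: n => [|n]; last exact: ordge0.
  by rewrite muln0.
- rewrite /sgen Psi_sym1 coefMX; case: n => [|n]; first exact: ordge0.
  rewrite coefC; case: n => [|n]; last exact: ordge0.
  by rewrite muln1; exact: gN.
- by rewrite rmorphD coefD; apply: ordgeD.
rewrite (rmorphM Psi) coefM; apply: ordge_sum => i _.
have -> : (N * n = N * i + N * (n - i))%N by rewrite -mulnDr subnKC // -ltnS.
by apply: ordgeM.
Qed.

(** The test multiplies [v] by the l-th power of the generator [j0], whose value is exactly a power
    of a variable of weight N. The product has order at least N (l + 1), and N l of this can be
    cancelled. *)
Lemma ratliff_rush_ordge v : ratliff_rush (Msub k) v -> ordge N (psi v).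
Proof.
move=> [l l0 h]; pose p : S := sym1 (col j0 (Mmat k)) ^+ l.
have rp : rees_pow (Msub k) l p.
  split; rewrite /p.
    elim: l {l0 h p} => [|l IH]; first exact: rees1.
    by rewrite exprS; apply: rees_mul => //; exact: rees_sgen.
  elim: l {l0 h p} => [|l IH]; first exact: dhomog1.
  by rewrite exprS; exact: (dhomogM (sym1_homog _) IH).
have [rsp _] := h _ rp; have := @Psi_ord _ l.+1 rsp.
have -> : Psi (sym1 v * p) = ((psi v) * psi (col j0 (Mmat k)) ^+ l)%:P * 'X^(l.+1).
  exact: (morph_linear_mul l (Psi_sym1 v) (Psi_sym1 _)).
rewrite coefCM coefXn eqxx mulr1 g0 mulrC -exprM mulnS => o.
apply: (@ordge_cancel k wX wY wY0 i0 (e * l)%N (N * l)%N) o.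
by rewrite -wN -wtMn; congr wt; apply/mnmP => i; rewrite !mulmnE mulnA.
Qed.

(** Taking the coefficient of degree n in the image under [Psi] of an equation of degree n yields an
    equation for psi v whose i-th coefficient has order at least N (n - i). *)
Lemma integral_closure_ordge v : integral_closure (Msub k) v -> ordge N (psi v).
Proof.
move=> [p [pm pc /rootP p0]]; pose n := (size p).-1.
have pE : size p = n.+1 by rewrite /n prednK // size_poly_gt0 monic_neq0.
apply: (@ordge_integral k wX wY wY0 N n _ (fun i => (Psi p`_i)`_(n - i))).
  by move=> i _; apply: Psi_ord.
have := congr1 (fun q => (Psi q)`_n) p0.
rewrite horner_coef pE rmorph_sum coef_sum rmorph0 coef0 big_ord_recr /= => E.
rewrite -[RHS]E addrC; congr (_ + _).
  apply: etrans (esym (morph_linear_coef _ (leqnn n) (Psi_sym1 v))).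
  by move/monicP: pm; rewrite lead_coefE -/n => ->; rewrite subnn rmorph1 coef1 mul1r.
by apply: eq_bigr => i _; apply: (esym (morph_linear_coef _ (ltnW (ltn_ord i)) (Psi_sym1 v))).
Qed.

End ClosureTest.

Lemma stairs_match (C : comNzRingType) (x y f1 f2 f4 g1 p q : C) :
  x ^+ 3 * f1 + x ^+ 2 * (y ^+ 2 * f2) + x * (y ^+ 3 * (x * p + y * q + g1)) + y ^+ 5 * f4 -
    q * (x * y ^+ 4) =
  x ^+ 3 * f1 + x ^+ 2 * (y ^+ 2 * (f2 + y * p)) + x * (y ^+ 3 * g1) + y ^+ 5 * f4.
Proof. by ring. Qed.

Section Closures.
Variable k : fieldType.
Local Notation A := (Aring k).
Local Notation S := {mpoly A[2]}.
Local Notation X := (Xvar k).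
Local Notation Y := (Yvar k).
Implicit Types (f g : A) (v : Fmod k).

Lemma Mmat_entry j : col j (Mmat k) ord0 0 = (Mmat_row1 X Y)`_j /\
  col j (Mmat k) ord_max 0 = (Mmat_row2 X Y)`_j.
Proof. by rewrite !mxE. Qed.

Lemma ordge_psX wX wY (i : 'I_2) n : ordge wX wY (wt wX wY U_(i)%MM * n) (psX k i ^+ n).
Proof. by apply: ordge_exp; apply: lead_ordge; exact: lead_psX. Qed.

Lemma ordge_XY wX wY a b : ordge wX wY (wX * a + wY * b) (X ^+ a * Y ^+ b).
Proof.
have w0 : wt wX wY U_(ord0)%MM = wX by rewrite /wt !mnm1E muln1 muln0 addn0.
have w1 : wt wX wY U_(ord_max)%MM = wY by rewrite /wt !mnm1E muln1 muln0.
apply: ordgeM; first by have := @ordge_psX wX wY ord0 a; rewrite w0.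
by have := @ordge_psX wX wY ord_max b; rewrite w1.
Qed.

(** Only the third generator has two nonzero entries, whose contributions may cancel; so its bound
    is a separate hypothesis. *)
Lemma psi_ord wX wY N oa ob (al be : A) :
  ordge wX wY oa al -> ordge wX wY ob be ->
  [&& N <= wX * 3 + oa, N <= wX * 2 + wY * 2 + oa & N <= wY * 5 + oa]%N ->
  [&& N <= wX * 2 + wY * 2 + ob, N <= wX * 1 + wY * 4 + ob & N <= wY * 5 + ob]%N ->
  ordge wX wY N (X * Y ^+ 3 * al + X ^+ 3 * be) ->
  forall j, ordge wX wY N (psi al be (col j (Mmat k))).
Proof.
move=> hal hbe /and3P [a1 a2 a4] /and3P [b5 b6 b7] h2 j.
have oa' a b : (N <= wX * a + wY * b + oa)%N -> ordge wX wY N (X ^+ a * Y ^+ b * al).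
  by move=> le; apply: ordge_leq le (ordgeM (@ordge_XY _ _ _ _) hal).
have ob' a b : (N <= wX * a + wY * b + ob)%N -> ordge wX wY N (X ^+ a * Y ^+ b * be).
  by move=> le; apply: ordge_leq le (ordgeM (@ordge_XY _ _ _ _) hbe).
have [e0 e1] := Mmat_entry j; rewrite /psi e0 e1.
case: j {e0 e1} => [[|[|[|[|[|[|[|//]]]]]]] lt]; rewrite /Mmat_row1 /Mmat_row2 [nth _ _ _]/=;
  rewrite [X in _ + X * be]/= ?mul0r ?add0r ?addr0.
- by have := oa' 3 0%N; rewrite muln0 addn0 expr0 mulr1; apply.
- exact: oa'.
- exact: h2.
- by have := oa' 0%N 5; rewrite muln0 add0n expr0 mul1r; apply.
- exact: ob'.
- exact: (ob' 1%N 4).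
by have := ob' 0%N 5; rewrite muln0 add0n expr0 mul1r; apply.
Qed.

Lemma cf_ordge wX wY N f a b : ordge wX wY N f -> (wX * a + wY * b < N)%N -> cf a b f = 0.
Proof. by move=> /ordgeP fo lt; apply: fo; rewrite /wt mn0 mn1. Qed.

(** f is cut by powers of X: all terms from X^3 on, and a series in Y alone for each of X^2, X and
    1. *)
Lemma ps_stairs b2 b1 b0 f :
  (forall j, (j < b2)%N -> cf 2 j f = 0) -> (forall j, (j < b1)%N -> cf 1 j f = 0) ->
  (forall j, (j < b0)%N -> cf 0 j f = 0) ->
  exists f1 f2 f3 f4,
    f = X ^+ 3 * f1 + X ^+ 2 * (Y ^+ b2 * f2) + X * (Y ^+ b1 * f3) + Y ^+ b0 * f4.
Proof.
move=> h2 h1 h0; pose F a b := PSeries (fun m : 'X_{1..2} =>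
  if m ord0 == 0%N then cf a (m ord_max + b)%N f else 0) : A.
have cF a b i j : cf i j (F a b) = if i == 0%N then cf a (j + b)%N f else 0.
  by rewrite /cf /F /= mn0 mn1.
pose f1 : A := PSeries (fun m => cf (m ord0 + 3) (m ord_max) f).
have cf1 i j : cf i j f1 = cf (i + 3) j f by rewrite /cf /f1 /= mn0 mn1.
exists f1, (F 2 b2), (F 1%N b1), (F 0%N b0).
apply: pseriesP => m; rewrite (mnE m); move: (m ord0) (m ord_max) => a b.
change (cf a b f = cf a b (X ^+ 3 * f1 + X ^+ 2 * (Y ^+ b2 * F 2 b2) +
  X * (Y ^+ b1 * F 1%N b1) + Y ^+ b0 * F 0%N b0)).
rewrite !cfD !cf_mulX !cf_mulX1 !cf_mulY !cF cf1.
case: a => [|[|[|a]]]; rewrite ?(subn0, subSS, addr0, add0r) /=.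
- by case: leqP => [le|/h0 //]; rewrite subnK.
- by case: leqP => [le|/h1 ->]; rewrite ?subnK //; case: ifP; rewrite addr0.
- by case: leqP => [le|/h2 ->]; rewrite ?subnK //; do ?case: ifP; rewrite !addr0.
by rewrite addn3; do ?case: ifP; rewrite !addr0.
Qed.

Lemma MsubI (c : nat -> A) v :
  v ord0 0 = X ^+ 3 * c 0%N + X ^+ 2 * (Y ^+ 2 * c 1%N) + X * (Y ^+ 3 * c 2) + Y ^+ 5 * c 3 ->
  v ord_max 0 = X ^+ 3 * c 2 + X ^+ 2 * (Y ^+ 2 * c 4) + X * (Y ^+ 4 * c 5) + Y ^+ 5 * c 6 ->
  Msub k v.
Proof.
move=> e0 e1; exists (\col_j c j); apply/colP => i.
have [->|n0] := eqVneq i ord0.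
  rewrite e0 !mxE !big_ord_recl !big_ord0 !mxE /= !mul0r !add0r !addr0 !mulrA.
  by rewrite !addrA.
have -> : i = ord_max by apply: val_inj; case: i n0 => [[|[|//]]].
rewrite e1 !mxE !big_ord_recl !big_ord0 !mxE /= !mul0r !add0r !addr0 !mulrA.
by rewrite !addrA.
Qed.

(** The two orders cut out the monomial ideals (X^3, X^2 Y^2, X Y^3, Y^5) and (X^3, X^2 Y^2, X Y^4,
    Y^5) of the rows. The third generator ties the cofactor f3 of X Y^3 to the cofactor g1 of X^3;
    their difference X p + Y q is absorbed by X^2 Y^2 t_1 and by z. *)
Lemma Mbar_cf v :
  ordge 3 2 9 (v ord0 0) -> ordge 5 3 15 (v ord_max 0) ->
  cf 1 3 (v ord0 0) = cf 3 0 (v ord_max 0) -> Mbar v.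
Proof.
set f := v ord0 0; set g := v ord_max 0 => fo go E.
have [|||f1 [f2 [f3 [f4 fE]]]] := @ps_stairs 2 3 5 f; try by move=> j lt; apply: cf_ordge fo _; lia.
have [|||g1 [g2 [g3 [g4 gE]]]] := @ps_stairs 2 4 5 g; try by move=> j lt; apply: cf_ordge go _; lia.
have /ps_split [p [q pq]] : pscoef (f3 - g1) 0%MM = 0.
  have : cf 0 0 (f3 - g1) = 0.
    rewrite cfB; move: E; rewrite fE gE !cfD !cf_mulX !cf_mulX1 !cf_mulY /= !(addr0, add0r) => ->.
    by rewrite subrr.
  by rewrite cf_const.
pose m : Fmod k := v - q *: zvec k.
exists m, q; split; last by rewrite subrK.
apply: (MsubI (c := nth 0 [:: f1; f2 + Y * p; g1; f4; g2; g3; g4])).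
  rewrite !mxE -/f fE /= -[f3](subrK g1) pq.
  exact: stairs_match.
have e : (ord_max == ord0 :> 'I_2) = false by [].
by rewrite !mxE e mulr0 subr0 -/g.
Qed.

Lemma Mbar_sub_ratliff_rush : Mbar (k := k) `<=` ratliff_rush (Msub k).
Proof.
move=> _ [m [a [Mm ->]]]; exists 1%N => // p pM; have [rp hp] := pM.
split; last exact: (dhomogM (sym1_homog _) hp).
have rz : rees (Msub k) (p * sym1 (zvec k)).
  by have := rees_zmul rp; rewrite (const_coef_pos pM) kS0 subr0 sym1_zvec.
have aux (C : comNzRingType) (s b z p' : C) : (s + b * z) * p' = s * p' + b * (p' * z) by ring.
rewrite sym1D sym1Z aux.
exact: (rees_add (rees_mul (rees_gen Mm) rp) (rees_mul (rees_const _ a) rz)).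
Qed.

(** The equation T^2 - 2 c T + (c^2 - e^2) involves e only through its square. *)
Lemma quadratic_integral (C : idomainType) (P : C -> Prop) (c e : C) :
  P 0 -> P 1 -> (forall a b, P a -> P b -> P (a + b)) -> (forall a, P a -> P (- a)) ->
  (forall a b, P a -> P b -> P (a * b)) -> P c -> P (e * e) ->
  exists p : {poly C}, [/\ p \is monic, forall i, P p`_i & root p (c + e)].
Proof.
move=> P0 P1 PD PN PM Pc Pe; pose s := [:: c * c - e * e; - (c + c); 1].
have pE : Poly s = s :> seq C by rewrite (@PolyK _ 0) //= oner_neq0.
exists (Poly s); split.
- by rewrite monicE lead_coefE pE.
- move=> i; rewrite pE /s; case: i => [|[|[|i]]] /=; rewrite ?nth_nil //.
    by apply/PD/PN => //; apply: PM.
  by apply/PN/PD.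
by apply/rootP; rewrite horner_Poly /=; ring.
Qed.

Lemma Mbar_sub_integral_closure : Mbar (k := k) `<=` integral_closure (Msub k).
Proof.
move=> _ [m [a [Mm ->]]]; rewrite /integral_closure /= sym1D.
have re : rees (Msub k) (sym1 (a *: zvec k) * sym1 (a *: zvec k)).
  rewrite sym1Z sym1_zvec.
  have aux (C : comNzRingType) (b z : C) : b * z * (b * z) = b * b * (z * z) by ring.
  rewrite aux; have ra := rees_const (Msub k) a.
  exact: (rees_mul (rees_mul ra ra) (@rees_zz k)).
apply: (quadratic_integral (P := rees (Msub k))) => //.
- exact: rees0.
- exact: rees1.
- exact: rees_add.
- exact: rees_opp.
- exact: rees_mul.
exact: rees_gen.
Qed.

(* Mbar is cut out by three monomial valuations: of the first entry f, of the second
   entry g, and of X^2 f - Y^3 g. *)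
Lemma closure_sub_Mbar (Q : set (Fmod k)) :
  (forall wX wY N e al be i0 j0, (0 < wY)%N ->
     (forall j, ordge wX wY N (psi al be (col j (Mmat k)))) ->
     psi al be (col j0 (Mmat k)) = psX k i0 ^+ e -> wt wX wY (U_(i0) *+ e)%MM = N ->
     forall v, Q v -> ordge wX wY N (psi al be v)) ->
  Q `<=` Mbar (k := k).
Proof.
move=> h v Qv.
have o1 wX wY : ordge wX wY 0 (1 : A) by [].
(* 0 has every order; 100 just exceeds the bounds 9 and 15 used below. *)
have o0 wX wY : ordge wX wY 100 (0 : A) by exact: ordge0.
have wU (i : 'I_2) e wX wY : wt wX wY (U_(i) *+ e)%MM = (if i == ord0 then wX * e else wY * e)%N.
  rewrite wtMn /wt !mnm1E; case: eqVneq => [->|n0].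
    by rewrite muln1 muln0 addn0.
  by rewrite (_ : i = ord_max) ?muln1 ?muln0 //; apply: val_inj; case: i n0 => [[|[|//]]].
have [e00 e01] := Mmat_entry ord0; have [e60 e61] := Mmat_entry ord_max.
have wtE a b c d : (a * c + b * d)%N = wt a b (mn c d) by rewrite /wt mn0 mn1.
apply: Mbar_cf.
- have -> : v ord0 0 = psi 1 0 v by rewrite /psi mulr1 mulr0 addr0.
  apply: (h 3 2 9 3 1 0 ord0 ord0) => [//||||//]; last by rewrite wU.
    apply: (psi_ord (o1 3 2) (o0 3 2)) => //.
    by rewrite mulr1 mulr0 addr0; exact: (@ordge_XY 3 2 1 3).
  by rewrite /psi e00 mulr1 mulr0 addr0.
- have -> : v ord_max 0 = psi 0 1 v by rewrite /psi mulr1 mulr0 add0r.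
  apply: (h 5 3 15 5 0 1 ord_max ord_max) => [//||||//]; last by rewrite wU.
    apply: (psi_ord (o0 5 3) (o1 5 3)) => //.
    by rewrite mulr1 mulr0 add0r; have := @ordge_XY 5 3 3 0; rewrite expr0 mulr1.
  by rewrite /psi e61 mulr1 mulr0 add0r.
(* This form kills the third generator and takes every generator to order at least 40, the first to
   X^5. As X^3 Y^3 has weight 39, its coefficient vanishes, which is the equality of coefficients
   still to be shown. *)
have : ordge 8 5 40 (psi (X ^+ 2) (- Y ^+ 3) v).
  apply: (h 8 5 40 5 _ _ ord0 ord0) => [//||||//]; last by rewrite wU.
    have oX : ordge 8 5 16 (X ^+ 2).
      by have := @ordge_XY 8 5 2 0; rewrite expr0 mulr1.
    have oY : ordge 8 5 15 (- Y ^+ 3).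
      by apply: ordgeN; have := @ordge_XY 8 5 0 3; rewrite expr0 mul1r.
    apply: (psi_ord oX oY) => //.
    have aux (C : comNzRingType) (x y : C) : x * y ^+ 3 * x ^+ 2 + x ^+ 3 * (- y ^+ 3) = 0 by ring.
    by rewrite aux; exact: ordge0.
  by rewrite /psi e00 e01 /= mul0r addr0 -exprD.
move=> /(@cf_ordge 8 5 40 _ 3 3) /(_ isT).
rewrite /psi mulrN cfB ![v _ 0 * _]mulrC cf_mulX cf_mulY /= => /eqP.
by rewrite subr_eq0 => /eqP.
Qed.

Lemma ratliff_rush_Msub : ratliff_rush (Msub k) = Mbar (k := k).
Proof.
apply/seteqP; split; last exact: Mbar_sub_ratliff_rush.
apply: closure_sub_Mbar => wX wY N e al be i0 j0 wY0 hN h0 wN v.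
exact: (ratliff_rush_ordge wY0 hN h0 wN).
Qed.

Lemma integral_closure_Msub : integral_closure (Msub k) = Mbar (k := k).
Proof.
apply/seteqP; split; last exact: Mbar_sub_integral_closure.
apply: closure_sub_Mbar => wX wY N e al be i0 j0 wY0 hN h0 wN v.
exact: (integral_closure_ordge wY0 hN).
Qed.

Lemma Msub_neq_Mbar : Msub k <> Mbar (k := k).
Proof.
move=> E; apply: (@zvec_notin k); rewrite E; exists 0, 1; split; first exact: Msub0.
by rewrite add0r scale1r.
Qed.

End Closures.

(** * Indecomposability *)

Lemma det2_kernel (D : idomainType) (p1 p2 q1 q2 z1 z2 : D) : p1 * q2 - p2 * q1 != 0 ->
  z1 * p1 + z2 * q1 = 0 -> z1 * p2 + z2 * q2 = 0 -> z1 = 0 /\ z2 = 0.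
Proof.
move=> d0 h1 h2; split; apply: (mulIf d0); rewrite mul0r.
  have -> : z1 * (p1 * q2 - p2 * q1) = (z1 * p1 + z2 * q1) * q2 - (z1 * p2 + z2 * q2) * q1 by ring.
  by rewrite h1 h2 !mul0r subrr.
have -> : z2 * (p1 * q2 - p2 * q1) = (z1 * p2 + z2 * q2) * p1 - (z1 * p1 + z2 * q1) * p2 by ring.
by rewrite h1 h2 !mul0r subrr.
Qed.

Section Monomials.
Variables (C : comNzRingType) (x y v0 v1 w0 w1 : C).

Lemma mul_pow_swap : y ^+ 3 * (x ^+ 2 * y ^+ 2) = x ^+ 2 * y ^+ 5.
Proof. by ring. Qed.
Lemma mul_pow_swap1 : y ^+ 2 * (x * y ^+ 3) = x * y ^+ 5.
Proof. by ring. Qed.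
Lemma mul_pow_swap2 : y ^+ 2 * x ^+ 3 = x * (x ^+ 2 * y ^+ 2).
Proof. by ring. Qed.
Lemma mul_swap3 : x ^+ 3 * y ^+ 5 * v0 = v0 * y ^+ 5 * x ^+ 3.
Proof. by ring. Qed.
Lemma mul_swap4 : x ^+ 3 * y ^+ 5 * v1 = v1 * x ^+ 3 * y ^+ 5.
Proof. by ring. Qed.
Lemma mul_swap5 : v0 * y ^+ 5 * x ^+ 3 * w0 + v1 * x ^+ 3 * y ^+ 5 * w1 =
  x ^+ 3 * y ^+ 5 * (v0 * w0 + v1 * w1).
Proof. by ring. Qed.

End Monomials.

Lemma scale_entry (C : comNzRingType) n (a : C) (z : 'cV[C]_n) i : (a *: z) i 0 = a * z i 0.
Proof. by rewrite mxE. Qed.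

Lemma lincomb_entry (C : comNzRingType) n (a b : C) (z z' : 'cV[C]_n) i :
  (a *: z + b *: z') i 0 = a * z i 0 + b * z' i 0.
Proof. by rewrite mxE !scale_entry. Qed.

Lemma scale_comb (C : comNzRingType) n (a b c : C) (z z' : 'cV[C]_n) :
  (a * b) *: z + (a * c) *: z' = a *: (b *: z + c *: z').
Proof. by rewrite scalerDr !scalerA. Qed.

Lemma scale_inj (D : idomainType) n (a : D) (z z' : 'cV[D]_n) : a != 0 -> a *: z = a *: z' -> z = z'.
Proof.
move=> a0 E; apply/colP => i; apply: (mulfI a0).
by rewrite -!scale_entry E.
Qed.

Lemma fix_kernel1 (C : comNzRingType) (p q z z' : C) : p * z + q * z' = z -> z * (p - 1) + z' * q = 0.
Proof. by move=> /eqP; rewrite -subr_eq0 => /eqP <-; ring. Qed.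

Lemma fix_kernel2 (C : comNzRingType) (p q z z' : C) : p * z + q * z' = z' -> z * p + z' * (q - 1) = 0.
Proof. by move=> /eqP; rewrite -subr_eq0 => /eqP <-; ring. Qed.

Section Indecomposable.
Variable k : fieldType.
Local Notation A := (Aring k).
Local Notation F := (Fmod k).
Local Notation X := (Xvar k).
Local Notation Y := (Yvar k).
Implicit Types (f g : A) (u v : F).

Lemma vecP u v : u ord0 0 = v ord0 0 -> u ord_max 0 = v ord_max 0 -> u = v.
Proof.
move=> e0 e1; apply/colP => i; have [->|n0] := eqVneq i ord0; first exact: e0.
by have -> : i = ord_max by apply: val_inj; case: i n0 => [[|[|//]]].
Qed.

Lemma XY_coprime m n f g : Y ^+ n * f = X ^+ m * g -> exists h, f = X ^+ m * h /\ g = Y ^+ n * h.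
Proof.
move=> E; pose h : A := PSeries (fun u : 'X_{1..2} => cf (u ord0 + m) (u ord_max) f).
have fE : f = X ^+ m * h.
  apply: pseriesP => u; rewrite (mnE u); move: (u ord0) (u ord_max) => a b.
  change (cf a b f = cf a b (X ^+ m * h)); rewrite cf_mulX; case: leqP => [le|lt].
    by rewrite [RHS]/cf /h /= mn0 mn1 subnK.
  have := congr1 (cf a (b + n)%N) E.
  by rewrite cf_mulX leqNgt lt cf_mulY leq_addl addnK.
exists h; split=> //; have [X0 _] := A_neq0 k.
by apply: (mulfI (expf_neq0 m X0)); rewrite -E {1}fE mulrCA.
Qed.

Lemma XY_coprime_vec m n u v : Y ^+ n *: u = X ^+ m *: v ->
  exists w, u = X ^+ m *: w /\ v = Y ^+ n *: w.
Proof.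
move=> E; have /choice [w wE] i : exists h, u i 0 = X ^+ m * h /\ v i 0 = Y ^+ n * h.
  by apply: XY_coprime; move/colP: E => /(_ i); rewrite !mxE.
by exists (\col_i w i); split; apply/colP => i; rewrite !mxE; have [] := wE i.
Qed.

(** Both are the constant term of the multiplier of the third generator. *)
Lemma Msub_cf v : Msub k v -> cf 1 3 (v ord0 0) = cf 3 0 (v ord_max 0).
Proof.
move=> [u ->]; have [c [-> ->]] := Mmat_col u.
by rewrite !cfD !cf_mulX !cf_mulX1 !cf_mulY /= !(addr0, add0r).
Qed.

Lemma Msub_col j : Msub k (col j (Mmat k)).
Proof. by exists (delta_mx j 0); rewrite -colE. Qed.

Variables N1 N2 : set F.
Hypotheses (N1s : is_submodule N1) (N2s : is_submodule N2).
Hypothesis ME : Msub k = [set x | exists y z, [/\ N1 y, N2 z & x = y + z]].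
Hypothesis N12 : N1 `&` N2 = [set 0].

Definition proj_rel v u := N1 u /\ N2 (v - u).

Lemma proj_ex v : Msub k v -> exists u, proj_rel v u.
Proof. by rewrite ME => -[y [z [Ny Nz ->]]]; exists y; split; rewrite // addrC addKr. Qed.

Lemma projZ a v u : proj_rel v u -> proj_rel (a *: v) (a *: u).
Proof.
have [[_ _ Z1] [_ _ Z2]] := (N1s, N2s).
by move=> [n1 n2]; split; [apply: Z1|rewrite -scalerBr; apply: Z2].
Qed.

Lemma projD v u v' u' : proj_rel v u -> proj_rel v' u' -> proj_rel (v + v') (u + u').
Proof.
have [[_ D1 _] [_ D2 _]] := (N1s, N2s).
by move=> [n1 n2] [n1' n2']; split; [apply: D1|rewrite opprD addrACA; apply: D2].
Qed.

Lemma proj_uniq v u u' : proj_rel v u -> proj_rel v u' -> u = u'.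
Proof.
have [[_ D1 Z1] [_ D2 Z2]] := (N1s, N2s); move=> [n1 n2] [n1' n2'].
suff : (N1 `&` N2) (u - u') by rewrite N12 => /eqP; rewrite subr_eq0 => /eqP.
split; first by apply: D1 => //; rewrite -scaleN1r; apply: Z1.
have -> : u - u' = (v - u') + -1 *: (v - u) by rewrite scaleN1r opprB [RHS]addrC addrA subrK.
by apply: D2 => //; apply: Z2.
Qed.

Lemma sub1 u : N1 u -> Msub k u.
Proof. by move=> Nu; rewrite ME; have [N0 _ _] := N2s; exists u, 0; rewrite addr0. Qed.

Lemma proj_id u : N1 u -> proj_rel u u.
Proof. by move=> Nu; split; rewrite // subrr; have [] := N2s. Qed.

Lemma proj_0 u : N2 u -> proj_rel u 0.
Proof. by move=> Nu; split; rewrite ?subr0 //; have [] := N1s. Qed.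

(** F / M has finite length and A has depth 2, so maps from M to F extend to F. Explicitly, X^3 and
    Y^5 times the first basis vector lie in M, and coprimality gives e_1. For the second, X^3 occurs
    only together with X Y^3 times the first, so e_2 takes two steps, by way of X^2 Y^2 and Y^5. *)
Lemma proj_matrix : exists e1 e2 : F,
  [/\ forall v u, proj_rel v u -> u = v ord0 0 *: e1 + v ord_max 0 *: e2,
      N1 (X ^+ 3 *: e1), N1 (X * Y ^+ 3 *: e1 + X ^+ 3 *: e2) & N1 (Y ^+ 5 *: e2)].
Proof.
have [c cM cE] : exists2 c : nat -> F, forall j, (j < 7)%N -> Msub k (c j) &
    forall j, (j < 7)%N -> c j ord0 0 = (Mmat_row1 X Y)`_j /\ c j ord_max 0 = (Mmat_row2 X Y)`_j.
  exists (fun j => col (inord j) (Mmat k)) => j lt; first exact: Msub_col.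
  by have := Mmat_entry k (inord j); rewrite inordK.
have pc j (lt : (j < 7)%N) : exists u, proj_rel (c j) u by apply/proj_ex/cM.
have [[ua pa] [uc qc] [ud pd]] := And3 (pc 0%N isT) (pc 2 isT) (pc 3 isT).
have [[ue pe] [ug pg]] := (pc 4 isT, pc 6 isT).
have [a0 a1] := cE 0%N isT; have [c0 c1] := cE 2 isT; have [d0 d1] := cE 3 isT.
have [l0 l1] := cE 4 isT; have [g0 g1] := cE 6 isT.
rewrite /Mmat_row1 /Mmat_row2 [nth _ _ _]/= in a0 a1 c0 c1 d0 d1 l0 l1 g0 g1.
have [|e1 [uaE udE]] := @XY_coprime_vec 3 5 ua ud.
  apply: proj_uniq (projZ (Y ^+ 5) pa) _.
  have -> : Y ^+ 5 *: c 0%N = X ^+ 3 *: c 3; last exact: projZ.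
  apply: vecP; rewrite [LHS]mxE [RHS]mxE; first by rewrite a0 d0; exact: mulrC.
  by rewrite a1 d1 !mulr0.
have [|r [ueE ugE]] := @XY_coprime_vec 2 3 ue ug.
  apply: proj_uniq (projZ (Y ^+ 3) pe) _.
  have -> : Y ^+ 3 *: c 4 = X ^+ 2 *: c 6; last exact: projZ.
  apply: vecP; rewrite [LHS]mxE [RHS]mxE; first by rewrite l0 g0 !mulr0.
  by rewrite l1 g1; exact: (@mul_pow_swap A).
have [|e2 [ucE rE]] := @XY_coprime_vec 3 2 (uc - X * Y ^+ 3 *: e1) r.
  have E : Y ^+ 2 *: uc = X *: ud + X *: ue.
    apply: proj_uniq (projZ (Y ^+ 2) qc) _.
    have -> : Y ^+ 2 *: c 2 = X *: c 3 + X *: c 4; last by apply: projD; apply: projZ.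
    apply: vecP; rewrite [LHS]mxE [RHS]mxE [X in _ = X + _]mxE [X in _ = _ + X]mxE.
      by rewrite c0 d0 l0 mulr0 addr0; exact: (@mul_pow_swap1 A).
    by rewrite c1 d1 l1 mulr0 add0r; exact: (@mul_pow_swap2 A).
  rewrite scalerBr E udE ueE !scalerA (@mul_pow_swap1 A) addrAC subrr add0r.
  exact: (congr1 (fun z => z *: r) (esym (exprS X 2))).
have ucE' : uc = X * Y ^+ 3 *: e1 + X ^+ 3 *: e2 by rewrite -ucE addrC subrK.
have ugE' : ug = Y ^+ 5 *: e2 by rewrite ugE rE scalerA; exact: (congr1 (fun z => z *: e2) (esym (exprD Y 3 2))).
exists e1, e2; split; last 1 first.
- by rewrite -ugE'; case: pg.
- move=> v u vu; have [X0 Y0] := A_neq0 k.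
  have nz : X ^+ 3 * Y ^+ 5 != 0 by rewrite mulf_neq0 ?expf_neq0.
  have E : (X ^+ 3 * Y ^+ 5) *: v = (v ord0 0 * Y ^+ 5) *: c 0%N + (v ord_max 0 * X ^+ 3) *: c 6.
    apply: vecP; rewrite [LHS]mxE [RHS]mxE [X in _ = X + _]mxE [X in _ = _ + X]mxE.
      by rewrite a0 g0 mulr0 addr0; exact: (@mul_swap3 A).
    by rewrite a1 g1 mulr0 add0r; exact: (@mul_swap4 A).
  have := projZ (X ^+ 3 * Y ^+ 5) vu; rewrite E => P.
  have := proj_uniq P (projD (projZ (v ord0 0 * Y ^+ 5) pa) (projZ (v ord_max 0 * X ^+ 3) pg)).
  rewrite uaE ugE' !scalerA => {}E.
  apply/colP => i; apply: (mulfI nz); rewrite lincomb_entry.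
  apply: etrans (esym (scale_entry _ _ _)) _; rewrite E lincomb_entry.
  exact: (@mul_swap5 A).
- by rewrite -uaE; case: pa.
by rewrite -ucE'; case: qc.
Qed.

(** By [Msub_cf], X^3 e_1 in M makes the lower left entry vanish at the origin, and X Y^3 e_1 + X^3
    e_2 in M makes the diagonal entries agree there, with an idempotent value in k. If it is 0, then
    E - 1 has nonzero determinant and E (E - 1) = 0 gives E = 0; if it is 1, then E is injective and
    N2, which it kills, is 0. *)
Lemma Msub_summand : N1 = [set 0] \/ N2 = [set 0].
Proof.
have [e1 [e2 [pE Na Nc Ng]]] := proj_matrix; have [X0 Y0] := A_neq0 k.
have X3 : X ^+ 3 != 0 by rewrite expf_neq0.
have Y5 : Y ^+ 5 != 0 by rewrite expf_neq0.
pose p1 := e1 ord0 0; pose p2 := e1 ord_max 0; pose q1 := e2 ord0 0; pose q2 := e2 ord_max 0.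
have cfA (f g : A) : pscoef (f * g) 0%MM = pscoef f 0%MM * pscoef g 0%MM by exact: pscoef0M.
have p20 : pscoef p2 0%MM = 0.
  have := Msub_cf (sub1 Na); rewrite !scale_entry !cf_mulX /= => /esym.
  by rewrite cf_const.
have pq : pscoef p1 0%MM = pscoef q2 0%MM.
  have := Msub_cf (sub1 Nc); rewrite !lincomb_entry -!(mulrA X (Y ^+ 3)) !cfD !cf_mulX !cf_mulX1 !cf_mulY /=.
  by rewrite !cf_const addr0 add0r.
have E1 : p1 *: e1 + p2 *: e2 = e1.
  have := pE _ _ (proj_id Na); rewrite !scale_entry scale_comb => E.
  exact: (esym (scale_inj X3 E)).
have E2 : q1 *: e1 + q2 *: e2 = e2.
  have := pE _ _ (proj_id Ng); rewrite !scale_entry scale_comb => E.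
  exact: (esym (scale_inj Y5 E)).
have E11 : p1 * p1 + p2 * q1 = p1.
  by move/colP: E1 => /(_ ord0); rewrite lincomb_entry.
have : pscoef p1 0%MM * (pscoef p1 0%MM - 1) == 0.
  have := congr1 (fun f => pscoef f 0%MM) E11; rewrite pscoefD !cfA p20 mul0r addr0 => E.
  by rewrite mulrBr mulr1 E subrr.
have one0 : pscoef (1 : A) 0%MM = 1 by rewrite /= eqxx.
rewrite mulf_eq0 subr_eq0 => /orP [] /eqP p10; [left|right].
  have d0 : (p1 - 1) * (q2 - 1) - q1 * p2 != 0.
    apply/eqP => /(congr1 (fun f => pscoef f 0%MM)).
    have cB (f g : A) : pscoef (f - g) 0%MM = pscoef f 0%MM - pscoef g 0%MM by [].
    rewrite cB !cfA !cB p20 -pq p10 one0 mulr0 !sub0r subr0 mulrNN mulr1 => /eqP.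
    by rewrite oner_eq0.
  have z i : e1 i 0 = 0 /\ e2 i 0 = 0.
    have h1 := congr1 (fun v : F => v i 0) E1; have h2 := congr1 (fun v : F => v i 0) E2.
    rewrite lincomb_entry in h1; rewrite lincomb_entry in h2.
    exact: (det2_kernel d0 (fix_kernel1 h1) (fix_kernel2 h2)).
  apply/seteqP; split => [u Nu|_ ->]; last by have [] := N1s.
  rewrite (pE _ _ (proj_id Nu)); apply/colP => i; have [z1 z2] := z i.
  by rewrite lincomb_entry z1 z2 !mulr0 addr0 mxE.
have d0 : p1 * q2 - p2 * q1 != 0.
  apply/eqP => /(congr1 (fun f => pscoef f 0%MM)).
  have cB (f g : A) : pscoef (f - g) 0%MM = pscoef f 0%MM - pscoef g 0%MM by [].
  by rewrite cB !cfA p20 -pq p10 mul0r subr0 mulr1 => /eqP; rewrite oner_eq0.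
apply/seteqP; split => [u Nu|_ ->]; last by have [] := N2s.
have /esym/colP E := pE _ _ (proj_0 Nu).
have [] := det2_kernel d0 (z1 := u ord0 0) (z2 := u ord_max 0).
- by have := E ord0; rewrite lincomb_entry mxE.
- by have := E ord_max; rewrite lincomb_entry mxE.
by move=> u0 u1; apply: vecP; rewrite mxE.
Qed.

End Indecomposable.

Lemma Msub_indecomposable k : indecomposable (Msub k).
Proof.
split; last by move=> N1 N2 N1s N2s ME N12; exact: (Msub_summand N1s N2s ME N12).
move=> E; have := Msub_col k ord0; rewrite E => /colP /(_ ord0).
have [-> _] := Mmat_entry k ord0; rewrite mxE /= => /eqP.
by have [X0 _] := A_neq0 k; rewrite expf_eq0 (negbTE X0).
Qed.

Theorem proposition5p11 (k : fieldType) (k_infinite : infinite_set [set: k]) :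
  [/\ rees_buchsbaum (Msub k),
      ratliff_rush (Msub k) = integral_closure (Msub k),
      Msub k <> integral_closure (Msub k)
    & indecomposable (Msub k)].
Proof.
split; first exact: Msub_buchsbaum.
- by rewrite ratliff_rush_Msub integral_closure_Msub.
- rewrite integral_closure_Msub; exact: Msub_neq_Mbar.
exact: Msub_indecomposable.
Qed.
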